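(* Let $f:\Lambda\to\Lambda$ be a ring homomorphism, linear over $\mathbb{R}$, such that for every partition $\lambda$ $$f(s_\lambda)=sp_\lambda+\sum_{\mu<\lambda}m_{\lambda\mu}\,sp_\mu$$ for some real constants $m_{\lambda\mu}$, where $\mu<\lambda$ refers to the strict extended dominance order. (a) Suppose all $m_{\lambda\mu}\ge0$. Then there is a $\kappa$-positive $p(x)\in\mathbb{R}[[x]]$ with $p(0)=1$ such that $f=f_p$. Conversely, $f_p$ has all $m_{\lambda\mu}\ge0$ for every $\kappa$-positive $p$. (b) Suppose moreover that all $m_{\lambda\mu}$ are nonnegative integers and that $m_{\lambda\mu}=0$ unless $|\lambda|\equiv|\mu|\pmod 2$. Then $p(x)=1$ or $p(x)=1/(1-x^2)$. Equivalently, $f$ is either the identity map $f_1$ or the map $f_{1/(1-x^2)}$.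
   Context: $\Lambda$ denotes the ring of symmetric functions in countably many variables with real coefficients, and $\hat\Lambda$ its completion allowing infinite sums of Schur functions. $s_\lambda$ is the Schur function, and $\langle\cdot,\cdot\rangle$ is the Hall inner product. For $\kappa\in\hat\Lambda$, $\kappa^\perp$ is the adjoint of multiplication by $\kappa$, so that $\kappa^\perp s_\lambda=\sum_\mu\langle\kappa,s_\mu\rangle s_{\lambda/\mu}$. $sp_\mu$ is the Koike–Terada universal symplectic character, characterized by $$\sum_\mu s_\mu(x)sp_\mu(y)=\frac{\prod_{i<j}(1-x_ix_j)}{\prod_{i,j}(1-x_iy_j)}.$$ Extended dominance order: for partitions $\lambda=(\lambda_1,\dots,\lambda_r)$ and $\mu=(\mu_1,\dots,\mu_s)$, write $\mu\le\lambda$ if $\mu_1+\cdots+\mu_k\le\lambda_1+\cdots+\lambda_k$ for all $1\le k\le s$, where $\lambda_i=0$ for $i>r$. The sizes $|\lambda|$ and $|\mu|$ need not be equal. Write $\mu<\lambda$ if $\mu\le\lambda$ and $\mu\neq\lambda$. For $p\in\mathbb{R}[[x]]$ with $p(0)=1$, set $$\kappa_p=\frac{\prod_i p(x_i)}{\prod_{i<j}(1-x_ix_j)},$$ and let $f_p:\Lambda\to\Lambda$ be the linear map $f_p(s_\lambda)=\sum_\nu\langle\kappa_p^\perp s_\lambda,s_\nu\rangle sp_\nu$. This map is a ring homomorphism. $p$ is called $\kappa$-positive if $\kappa_p$ has all nonnegative coefficients in the Schur basis. *)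

(* Defs.v *)
From mathcomp Require Import all_boot all_order all_algebra.
From mathcomp Require Import reals.
From Stdlib Require Import ClassicalEpsilon.

Set Implicit Arguments.
Unset Strict Implicit.
Unset Printing Implicit Defensive.

Import Order.TTheory GRing.Theory Num.Theory.
Local Open Scope ring_scope.

(* Formal power series in countably many variables x_1, x_2, ...       *)
(* A monomial x_1^{a_1} ... x_k^{a_k} is represented by the exponent   *)
(* sequence a = [:: a_1; ...; a_k] (variables beyond k have exponent 0,*)
(* so a and a ++ [:: 0] denote the same monomial).  A series is its    *)
(* coefficient function.                                               *)
Section Series.
Variable R : realType.

Definition series := seq nat -> R.

Definition sadd (F G : series) : series := fun a => F a + G a.
Definition sscale (c : R) (F : series) : series := fun a => c * F a.
Definition szero : series := fun _ => 0.
Definition sone : series := fun a => (sumn a == 0%N)%:R.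

Fixpoint subexps (a : seq nat) : seq (seq nat) :=
  match a with
  | [::] => [:: [::]]
  | x :: a' => [seq y :: t | y <- iota 0 x.+1, t <- subexps a']
  end.

Definition sdiffexp (a b : seq nat) : seq nat := [seq (p.1 - p.2)%N | p <- zip a b].

Definition smul (F G : series) : series :=
  fun a => \sum_(b <- subexps a) F b * G (sdiffexp a b).

Definition is_sym (F : series) : Prop :=
  forall a b : seq nat,
    perm_eq [seq x <- a | (0 < x)%N] [seq x <- b | (0 < x)%N] -> F a = F b.

Definition in_Lambda (F : series) : Prop :=
  is_sym F /\ exists d : nat, forall a, (d < sumn a)%N -> F a = 0.

Definition is_part (l : seq nat) : bool :=
  sorted geq l && all (fun x => 0 < x)%N l.

Fixpoint parts_aux (fuel m n : nat) : seq (seq nat) :=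
  if n is 0 then [:: [::]] else
  match fuel with
  | 0 => [::]
  | f.+1 => flatten [seq [seq k :: t | t <- parts_aux f k (n - k)]
                    | k <- iota 1 (minn m n)]
  end.

Definition parts (n : nat) : seq (seq nat) := parts_aux n n n.

Definition dom_le (mu lam : seq nat) : bool :=
  all (fun k => sumn (take k mu) <= sumn (take k lam))%N (iota 1 (size mu)).
Definition dom_lt (mu lam : seq nat) : bool := dom_le mu lam && (mu != lam).

Fixpoint interl (l : seq nat) : seq (seq nat) :=
  match l with
  | [::] => [:: [::]]
  | x :: l' => [seq y :: t | y <- iota (head 0%N l') (x - head 0%N l').+1,
                             t <- interl l']
  end.

(* partitions rho such that lam / rho is a horizontal strip of size k *)
Definition strips (lam : seq nat) (k : nat) : seq (seq nat) :=
  [seq [seq x <- r | (0 < x)%N] | r <- interl lam & sumn r + k == sumn lam].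

(* number of semistandard tableaux of skew shape lam/mu whose content is *)
(* the reverse of r  (removing the cells with the largest entry removes  *)
(* a horizontal strip)                                                   *)
Fixpoint skew_kostka_rev (lam mu : seq nat) (r : seq nat) : nat :=
  match r with
  | [::] => (lam == mu : nat)
  | k :: r' => sumn [seq skew_kostka_rev rho mu r' | rho <- strips lam k]
  end.

Definition skew_schur (lam mu : seq nat) : series :=
  fun a => (skew_kostka_rev lam mu (rev a))%:R.

Definition schur (lam : seq nat) : series := skew_schur lam [::].

(* Hall inner product with Schur functions: <F, s_mu> is the            *)
(* coefficient of s_mu in the (possibly infinite) Schur expansion of F. *)
Definition schur_expansion (F : series) (c : seq nat -> R) : Prop :=
  forall a : seq nat,
    F a = \sum_(lam <- parts (sumn a)) c lam * schur lam a.

Definition hall_schur (F : series) (mu : seq nat) : R :=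
  epsilon (inhabits (fun _ : seq nat => 0)) (schur_expansion F) mu.

Definition hser (k : nat) : series := fun a => (sumn a == k)%:R.

Definition hprod (b : seq nat) : series := foldr (fun k G => smul (hser k) G) sone b.

(* coefficient of x^a in prod_{i<j} (1 - x_i x_j): signed count of simple *)
(* graphs on the vertices 0..size a - 1 with degree sequence a           *)
Definition Pser : series :=
  fun a =>
    let k := size a in
    \sum_(E : {set 'I_k * 'I_k} |
            [forall e in E, (e.1 < e.2)%N] &&
            [forall i : 'I_k,
               #|[set e in E | (e.1 == i) || (e.2 == i)]| == nth 0%N a i])
       (-1) ^+ #|E|.

(* sp_mu, characterized by  sum_mu s_mu(x) sp_mu(y)                      *)
(*   = prod_{i<j}(1 - x_i x_j) / prod_{i,j}(1 - x_i y_j):                *)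
(* the coefficient of y^b on the right is P(x) h_{b_1}(x) h_{b_2}(x)...,  *)
(* so sp_mu[y^b] is the coefficient of s_mu(x) in P(x) h_b(x).            *)
Definition sp (mu : seq nat) : series :=
  fun b => hall_schur (smul Pser (hprod b)) mu.

(* p in R[[x]] is given by its coefficient sequence *)
Definition pprod (p : nat -> R) : series := fun a => \prod_(x <- a) p x.

(* kappa_p = prod_i p(x_i) / prod_{i<j} (1 - x_i x_j) *)
Definition kappa (p : nat -> R) : series :=
  epsilon (inhabits szero) (fun K => smul K Pser = pprod p).

Definition kappa_positive (p : nat -> R) : Prop :=
  forall mu, is_part mu -> 0 <= hall_schur (kappa p) mu.

(* kappa^perp s_lam = sum_mu <kappa, s_mu> s_{lam/mu}  (s_{lam/mu} = 0   *)
(* unless |mu| <= |lam|)                                                  *)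
Definition perp_schur (K : series) (lam : seq nat) : series :=
  fun a => \sum_(n < (sumn lam).+1) \sum_(mu <- parts n)
             hall_schur K mu * skew_schur lam mu a.

(* f_p(s_lam) = sum_nu <kappa_p^perp s_lam, s_nu> sp_nu  (the terms with *)
(* |nu| > |lam| vanish since kappa_p^perp s_lam has degree <= |lam|)     *)
Definition fp_schur (p : nat -> R) (lam : seq nat) : series :=
  fun b => \sum_(n < (sumn lam).+1) \sum_(nu <- parts n)
             hall_schur (perp_schur (kappa p) lam) nu * sp nu b.

(* sum_{mu < lam} m_{lam mu} sp_mu  (mu < lam forces |mu| <= |lam|) *)
Definition lower_sp (m : seq nat -> seq nat -> R) (lam : seq nat) : series :=
  fun b => \sum_(n < (sumn lam).+1) \sum_(mu <- parts n | dom_lt mu lam)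
             m lam mu * sp mu b.

Definition lin_ring_hom (f : series -> series) : Prop :=
  [/\ forall F, in_Lambda F -> in_Lambda (f F),
      forall F G, in_Lambda F -> in_Lambda G -> f (sadd F G) = sadd (f F) (f G),
      forall c F, in_Lambda F -> f (sscale c F) = sscale c (f F),
      forall F G, in_Lambda F -> in_Lambda G -> f (smul F G) = smul (f F) (f G)
    & f sone = sone].

Definition p_one : nat -> R := fun n => (n == 0%N)%:R.
Definition p_inv_sq : nat -> R := fun n => (~~ odd n)%:R.

End Series.

(* Main.v *)
Require Import Defs.
From HB Require Import structures.
From mathcomp Require Import all_boot all_order all_algebra.
From mathcomp Require Import perm.
From mathcomp Require Import boolp reals.
From mathcomp Require Import zify ring lra.
From Stdlib Require Import ClassicalEpsilon.
Import Defs.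
Set Implicit Arguments.
Unset Strict Implicit.
Unset Printing Implicit Defensive.
Import Order.TTheory GRing.Theory Num.Theory.
Local Open Scope ring_scope.

(* A homomorphism f is determined by the f (e_k), and dominance forces
   f (e_k) = sum_i c_{k,i} e_{k-i} with c_{k,0} = 1; f is some f_p exactly when
   c_{k,i} = q_i does not depend on k, and then sum_i (-1)^i q_i p_{k-i} = [k = 0].
   Independence is shown by induction on i = n, with u_k := c_{k,n} - c_{n,n}.
   Let f_p be built from the q_i := c_{i,i}.  Then f - f_p lowers the degree by n, and
   the top part of (f - f_p) s_lambda is D s_lambda for the derivation
   D e_k = u_k e_{k-n}.  Hence, for |mu| = |lambda| - n, m_{lambda,mu} is the coefficient
   of s_mu in D s_lambda, plus <kappa_p^perp s_lambda, s_mu>, which is 0 unless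
   mu is contained in lambda.  With partitions written by their column lengths:
     [b,b] -> [b+1,b-1-n] gives u_{b+1} + u_{b-1} <= 2 u_b,
     [b,b,n+2] -> [b+1,b+1] gives u_b - u_{b-1} >= u_{n+1},
   so u is linear for k >= n; [k] -> [k-n] bounds u from below, and [m,m] -> [m-1,m-n+1]
   for n >= 2, or the positivity of f (h_k) in one variable for n = 1, bounds the slope
   from above.  So u = 0.
   The converse is the positivity of the Littlewood-Richardson coefficients.
   For (b), the hooks kappa_(a) = p_a, kappa_(a,1) = p_{a-1} - p_{a+1} and
   kappa_(a,1,1) = p_{a+2} - p_2 p_a force p_2 to be 0 or 1, and then determine p. *)

(** * Series and horizontal strips *)

(** Two facts carry the reduction. First, [sp] and f_p are both skewing operators: sp_mu = P^perp
    s_mu with P = prod (1 - x_i x_j), and kappa_p P = prod p(x_i), so f_p s_lambda = (prod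
    p(x_i))^perp s_lambda, which makes f_p multiplicative with h_k |-> sum_j p_j h_{k-j}. Second,
    comparing f with the f_p built from the q_i leaves a coefficient of kappa_p^perp s_lambda of
    unknown sign, since kappa_p is not yet known to be positive at that stage. This dictates the
    choice of the pairs lambda, mu: either mu has a longer first column than lambda, so the
    coefficient is 0, or lambda and mu grow by equal rows, so the coefficient stays constant along
    the family and merely bounds u. Bounds suffice because u is already linear. Two columns yield
    only concavity of u; the reverse bound needs a third column, of height n + 2, for which the
    terms in u_{n+2} cancel and u_{n+1} remains. *)

Section SeriesRing.
Variable R : realType.
Implicit Types (F G H : series R) (a b t : seq nat).

(* on symmetric series, [T j] is the adjoint of multiplication by h_j *)
Definition T (j : nat) F : series R := fun a => F (j :: a).

Lemma smul_nil F G : smul F G [::] = F [::] * G [::].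
Proof. by rewrite /smul /= big_seq1. Qed.

(** Peeling off the first variable, F = sum_j x_1^j T_j F, turns most statements about products into
    inductions on the exponent sequence. *)
Lemma smul_cons F G x a :
  smul F G (x :: a) = \sum_(y < x.+1) smul (T y F) (T (x - y) G) a.
Proof.
rewrite /smul -[subexps _]/([seq y :: t | y <- iota 0 x.+1, t <- subexps a]).
rewrite (big_allpairs_dep (h := fun y t => y :: t)).
rewrite -(big_mkord xpredT (fun y => \sum_(b <- subexps a) F (y :: b) * G ((x - y)%N :: sdiffexp a b))).
by rewrite /index_iota subn0.
Qed.

Lemma smulE_T F G j : T j (smul F G) = fun a => \sum_(y < j.+1) smul (T y F) (T (j - y) G) a.
Proof. by apply: funext => a; rewrite /T smul_cons. Qed.

Lemma smul_suml (I : Type) (r : seq I) (P : pred I) (FF : I -> series R) G a :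
  smul (fun b => \sum_(i <- r | P i) FF i b) G a = \sum_(i <- r | P i) smul (FF i) G a.
Proof. by rewrite /smul exchange_big /=; apply: eq_bigr => b _; rewrite mulr_suml. Qed.

Lemma smulC F G : smul F G = smul G F.
Proof.
apply: funext => a; elim: a F G => [|x a IH] F G; first by rewrite !smul_nil mulrC.
rewrite !smul_cons (reindex_inj rev_ord_inj) /=; apply: eq_bigr => y _.
by rewrite IH subSS subKn // -ltnS.
Qed.

Lemma smul_sumr (I : Type) (r : seq I) (P : pred I) (FF : I -> series R) G a :
  smul G (fun b => \sum_(i <- r | P i) FF i b) a = \sum_(i <- r | P i) smul G (FF i) a.
Proof. by rewrite smulC smul_suml; apply: eq_bigr => i _; rewrite smulC. Qed.

Lemma smulA F G H : smul F (smul G H) = smul (smul F G) H.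
Proof.
apply: funext => a; elim: a F G H => [|x a IH] F G H; first by rewrite !smul_nil mulrA.
rewrite !smul_cons.
under eq_bigr do rewrite smulE_T smul_sumr.
under [RHS]eq_bigr do rewrite smulE_T smul_suml.
under eq_bigr => y _.
  under eq_bigr => z _ do rewrite IH.
  over.
(* The substitution i = y + z makes the inner range y <= i, after which the two sums can be
   exchanged. *)
rewrite (eq_bigr (fun y : 'I_x.+1 => \sum_(i < x.+1 | (y <= i)%N)
    smul (smul (T y F) (T (i - y) G)) (T (x - i) H) a)); last first.
  move=> y _.
  rewrite -(big_mkord xpredT (fun z => smul (smul (T y F) (T z G)) (T (x - y - z) H) a)).
  rewrite -(big_mkord (fun i => (y <= i)%N) (fun i => smul (smul (T y F) (T (i - y) G)) (T (x - i) H) a)).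
  have hy := ltn_ord y.
  rewrite [RHS](big_cat_nat (n := y)) /=; [|by []|by apply: ltnW].
  rewrite [X in _ = X + _]big_nat_cond [X in _ = X + _]big_pred0 ?add0r; last by move=> i; lia.
  rewrite -[X in _ = \sum_(X <= i < _ | _) _]add0n big_addn.
  rewrite subSn; last by rewrite -ltnS.
  rewrite [RHS]big_nat_cond [LHS]big_nat_cond.
  apply: eq_big => [i|i _]; first by rewrite leq_addl /= andbT.
  have -> : (i + y - y)%N = i by lia.
  by have -> : (x - (i + y))%N = (x - y - i)%N by lia.
rewrite [LHS](exchange_big_dep xpredT) //=.
apply: eq_bigr => y _.
rewrite -(big_mkord (fun i => i <= y)%N (fun i => smul (smul (T i F) (T (y - i) G)) (T (x - y) H) a)).
rewrite (big_cat_nat (n := y.+1)) //= [X in _ + X]big_nat_cond [X in _ + X]big_pred0; last by move=> i; lia.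
rewrite addr0 -(big_mkord xpredT (fun i => smul (smul (T i F) (T (y - i) G)) (T (x - y) H) a)).
by rewrite big_nat_cond [RHS]big_nat_cond; apply: eq_bigl => i; lia.
Qed.

Lemma smul1 F : smul (sone R) F = F.
Proof.
apply: funext => a; elim: a F => [|x a IH] F; first by rewrite smul_nil mul1r.
rewrite smul_cons big_ord_recl /= subn0.
have -> : T 0 (sone R) = sone R by apply: funext => b; rewrite /T /sone /=.
rewrite IH big1 ?addr0 // => i _.
have -> : T (bump 0 i) (sone R) = fun _ => \sum_(k <- Nil nat) 0.
  by apply: funext => b; rewrite /T /sone /= big_nil.
by rewrite (smul_suml _ _ (fun (k:nat) b => 0)) big_nil.
Qed.

Lemma smulDl F G H : smul (sadd F G) H = sadd (smul F H) (smul G H).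
Proof.
apply: funext => a; rewrite /smul /sadd -big_split /=.
by apply: eq_bigr => b _; rewrite mulrDl.
Qed.

End SeriesRing.

(** The alias carries the convolution ring structure, so that [ring] and the theory of big operators
    apply; its products and sums unfold to [smul] and [sadd]. *)
Definition sring (R : realType) : Type := series R.

HB.instance Definition _ (R : realType) := gen_eqMixin (sring R).
HB.instance Definition _ (R : realType) := gen_choiceMixin (sring R).

Definition sopp (R : realType) (F : sring R) : sring R := fun a => - F a.

Fact saddA (R : realType) : associative (@sadd R).
Proof. by move=> F G H; apply: funext => a; rewrite /sadd addrA. Qed.
Fact saddC (R : realType) : commutative (@sadd R).
Proof. by move=> F G; apply: funext => a; rewrite /sadd addrC. Qed.
Fact sadd0 (R : realType) : left_id (@szero R) (@sadd R).
Proof. by move=> F; apply: funext => a; rewrite /sadd add0r. Qed.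
Fact saddN (R : realType) : left_inverse (@szero R) (@sopp R) (@sadd R).
Proof. by move=> F; apply: funext => a; rewrite /sadd /sopp addNr. Qed.

HB.instance Definition _ (R : realType) :=
  GRing.isZmodule.Build (sring R) (@saddA R) (@saddC R) (@sadd0 R) (@saddN R).

Fact sone_neq0 (R : realType) : (sone R : sring R) != 0.
Proof.
apply/eqP => /(congr1 (fun F : sring R => F [::])).
by rewrite /sone /= => /eqP; rewrite oner_eq0.
Qed.

HB.instance Definition _ (R : realType) :=
  GRing.Zmodule_isComNzRing.Build (sring R) (@smulA R) (@smulC R) (@smul1 R) (@smulDl R) (@sone_neq0 R).

Section SeriesCoef.
Variable R : realType.
Implicit Types (F G : sring R) (a : seq nat).

Lemma serD F G a : (F + G) a = F a + G a. Proof. by []. Qed.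
Lemma serN F a : (- F) a = - F a. Proof. by []. Qed.
Lemma serB F G a : (F - G) a = F a - G a. Proof. by []. Qed.
Lemma ser0 a : (0 : sring R) a = 0. Proof. by []. Qed.
Lemma ser1 a : (1 : sring R) a = (sumn a == 0%N)%:R. Proof. by []. Qed.
Lemma ser_sum (I : Type) (r : seq I) (P : pred I) (FF : I -> sring R) a :
  (\sum_(i <- r | P i) FF i) a = \sum_(i <- r | P i) FF i a.
Proof. by elim/big_rec2: _ => //= i y1 y2 _ <-. Qed.
Lemma serM_nil F G : (F * G) [::] = F [::] * G [::].
Proof. exact: smul_nil. Qed.

(** Scalars are embedded as constant series, so that scaling becomes a product in the ring. *)
Definition sC (c : R) : sring R := sscale c (sone R).

Lemma serCM c F a : (sC c * F) a = c * F a.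
Proof.
rewrite -{2}[F]smul1 -[LHS]/(smul (sC c) F a) /smul mulr_sumr.
by apply: eq_bigr => d _; rewrite /sC /sscale mulrA.
Qed.

Lemma sscaleE c F : sscale c F = sC c * F.
Proof. by apply: funext => a; rewrite serCM. Qed.

Lemma T_mul j F G : (T j (F * G) : sring R) = \sum_(y < j.+1) (T y F : sring R) * T (j - y) G.
Proof. by apply: funext => a; rewrite ser_sum -[RHS]smul_cons. Qed.

Lemma T_add j F G : (T j (F + G) : sring R) = (T j F : sring R) + T j G. Proof. by []. Qed.
Lemma T_opp j F : (T j (- F) : sring R) = - (T j F : sring R). Proof. by []. Qed.
Lemma T_sum j (I : Type) (r : seq I) (P : pred I) (FF : I -> sring R) :
  (T j (\sum_(i <- r | P i) FF i) : sring R) = \sum_(i <- r | P i) (T j (FF i) : sring R).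
Proof. by apply: funext => a; rewrite /T !ser_sum. Qed.
Lemma T_C j c F : (T j (sC c * F) : sring R) = sC c * T j F.
Proof. by apply: funext => a; rewrite /T !serCM. Qed.

End SeriesCoef.

Section Partitions.
Implicit Types (l r lam mu rho : seq nat) (i j k n s : nat).
Local Open Scope nat_scope.

Lemma is_part_cons k l : is_part (k :: l) = [&& 0 < k, head 0 l <= k & is_part l].
Proof.
rewrite /is_part /=; case: l => [|y l] /=; first by rewrite !andbT.
by rewrite -!andbA; do !bool_congr.
Qed.

Lemma part_nil : is_part [::]. Proof. by []. Qed.

Lemma mem_parts_aux l f m n : n <= f ->
  (l \in parts_aux f m n) = [&& is_part l, head 0 l <= m & sumn l == n].
Proof.
elim: f l m n => [|f IH] l m [|n] //= hf.
1,2: rewrite inE; case: l => [|k l] //=; rewrite is_part_cons.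
1,2: by case: k => [|k] //=; rewrite !andbF.
apply/flatten_mapP/idP => [[k]|].
  rewrite mem_iota => hk /mapP [t]; rewrite IH; last by lia.
  move=> /and3P [ht1 ht2 /eqP ht3] -> /=; rewrite is_part_cons ht1 ht2 /=.
  by apply/and3P; split; lia.
case: l => [|k l] //=; rewrite is_part_cons => /and3P [/and3P[h1 h2 h3] h4 /eqP h5].
exists k; first by rewrite mem_iota; lia.
by apply/mapP; exists l => //; rewrite IH ?h2 ?h3 /=; [apply/eqP; lia | lia].
Qed.

Lemma mem_parts l n : (l \in parts n) = is_part l && (sumn l == n).
Proof.
rewrite /parts mem_parts_aux //; apply/and3P/andP => [[-> _ ->] //|[h1 h2]]; split => //.
by case: l h2 {h1} => //= k l /eqP; lia.
Qed.

Lemma uniq_parts n : uniq (parts n).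
Proof.
suff h f m : uniq (parts_aux f m n) by apply: h.
elim: f m n => [|f IH] m [|n] //=.
apply: allpairs_uniq_dep => //; first exact: iota_uniq.
by move=> [x1 y1] [x2 y2] _ _ [-> ->].
Qed.

Lemma partsP l n : reflect (is_part l /\ sumn l = n) (l \in parts n).
Proof. by rewrite mem_parts; apply: (iffP andP) => -[h /eqP]. Qed.

Lemma parts0 : parts 0 = [:: [::]]. Proof. by []. Qed.

Lemma part_anti l i j : is_part l -> i <= j -> nth 0 l j <= nth 0 l i.
Proof.
move=> /andP [hs _] hij; case: (ltnP j (size l)) => hj; last by rewrite (nth_default _ hj).
have geq_trans : transitive geq by move=> y x z /= h1 h2; apply: leq_trans h2 h1.
have geq_refl : reflexive geq by move=> x /=.
apply: (sorted_leq_nth geq_trans geq_refl 0 hs) => //; rewrite inE //.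
exact: leq_ltn_trans hij hj.
Qed.

Lemma part_size l i : is_part l -> (0 < nth 0 l i) = (i < size l).
Proof.
move=> /andP [_ /allP hp]; case: (ltnP i (size l)) => hi; last by rewrite nth_default.
by apply: hp; apply: mem_nth.
Qed.

Lemma part_ext l l' : is_part l -> is_part l' -> (forall i, nth 0 l i = nth 0 l' i) -> l = l'.
Proof.
move=> hl hl' h; have hs i : (i < size l) = (i < size l') by rewrite -!part_size // h.
have hsz : size l = size l'.
  by have := hs (size l); have := hs (size l'); rewrite !ltnn; lia.
by apply: (@eq_from_nth _ 0 _ _ hsz) => i _; apply: h.
Qed.

Lemma sumn_nth l n : size l <= n -> sumn l = \sum_(i < n) nth 0 l i.
Proof.
elim: l n => [|x l IH] n /=; first by move=> _; rewrite big1 // => i _; rewrite nth_nil.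
by case: n => [|n] //= hn; rewrite big_ord_recl /= (IH n).
Qed.

Lemma geq_sorted_nth r : (forall i, nth 0 r i.+1 <= nth 0 r i) -> sorted geq r.
Proof.
move=> h; apply/(sortedP 0) => i _ /=; exact: h.
Qed.

Lemma nth_filter_pos r i : (forall i, nth 0 r i.+1 <= nth 0 r i) ->
  nth 0 [seq x <- r | 0 < x] i = nth 0 r i.
Proof.
elim: r i => [|x r IH] i h //=.
have hr k : nth 0 r k.+1 <= nth 0 r k by apply: (h k.+1).
case: ltnP => hx; first by case: i => [|i] //=; rewrite IH.
have hz k : nth 0 (x :: r) k = 0.
  by elim: k => [|k IHk]; [rewrite /=; lia | have := h k; rewrite IHk leqn0 => /eqP].
by rewrite IH // hz; apply: (hz i.+1).
Qed.

Lemma filter_pos_part r : (forall i, nth 0 r i.+1 <= nth 0 r i) ->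
  is_part [seq x <- r | 0 < x].
Proof.
move=> h; apply/andP; split; last exact: filter_all.
apply: sorted_filter; first by move=> y x z /= h1 h2; apply: leq_trans h2 h1.
exact: geq_sorted_nth.
Qed.

Lemma sumn_filter_pos r : sumn [seq x <- r | 0 < x] = sumn r.
Proof. by elim: r => //= -[|x] r IH /=; rewrite IH. Qed.

(** Partitions have no zero parts, so a partition prescribed by its values is obtained by dropping
    zeros. If [f] is weakly decreasing and vanishes from [n] on, [nth] still returns [f]. *)
Definition mkp (f : nat -> nat) n := [seq x <- mkseq f n | 0 < x].

Section Mkp.
Variables (f : nat -> nat) (n : nat).
Hypotheses (f_anti : forall i, f i.+1 <= f i) (f0 : forall i, n <= i -> f i = 0).

Let nth_mk i : nth 0 (mkseq f n) i = f i.
Proof.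
by case: (ltnP i n) => hi; [rewrite nth_mkseq | rewrite nth_default ?size_mkseq ?f0].
Qed.

Lemma nth_mkp i : nth 0 (mkp f n) i = f i.
Proof. by rewrite nth_filter_pos // => k; rewrite !nth_mk. Qed.

Lemma mkp_part : is_part (mkp f n).
Proof. by apply: filter_pos_part => k; rewrite !nth_mk. Qed.

End Mkp.

(** Interlacing, that is, lam/rho is a horizontal strip. Beyond the range tested both sequences are
    0, so the test amounts to the condition for all i. *)
Definition hs lam rho :=
  all (fun i => nth 0 lam i.+1 <= nth 0 rho i <= nth 0 lam i)
      (iota 0 (maxn (size lam) (size rho))).

Lemma hsP lam rho :
  reflect (forall i, nth 0 lam i.+1 <= nth 0 rho i <= nth 0 lam i) (hs lam rho).
Proof.
apply: (iffP allP) => h i; last by move=> _; apply: h.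
case: (ltnP i (maxn (size lam) (size rho))) => hi; first by apply: h; rewrite mem_iota.
by rewrite !nth_default //; move: hi; rewrite geq_max => /andP[]; lia.
Qed.

Lemma hs_refl lam : is_part lam -> hs lam lam.
Proof. by move=> h; apply/hsP => i; rewrite leqnn part_anti. Qed.

Lemma hs_sumn lam rho : hs lam rho -> sumn rho <= sumn lam.
Proof.
move/hsP => h; rewrite (@sumn_nth rho (maxn (size lam) (size rho))) ?leq_maxr //.
rewrite (@sumn_nth lam (maxn (size lam) (size rho))) ?leq_maxl //.
by apply: leq_sum => i _; case/andP: (h i).
Qed.

Lemma mem_interl l r : is_part l ->
  r \in interl l = (size r == size l) &&
    all (fun i => nth 0 l i.+1 <= nth 0 r i <= nth 0 l i) (iota 0 (size l)).
Proof.
elim: l r => [|x l IH] r; first by rewrite /= inE; case: r.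
rewrite is_part_cons => /and3P[_ hx hl].
rewrite -[interl _]/([seq y :: t | y <- iota (head 0 l) (x - head 0 l).+1, t <- interl l]).
have all1 t y : all (fun i => nth 0 (x :: l) i.+1 <= nth 0 (y :: t) i <= nth 0 (x :: l) i) (iota 1 (size l)) =
    all (fun i => nth 0 l i.+1 <= nth 0 t i <= nth 0 l i) (iota 0 (size l)).
  by rewrite -[1]addn0 iotaDl all_map.
apply/allpairsPdep/idP => [[y [t [hy ht ->]]]|].
  move: hy ht; rewrite mem_iota IH // => hy /andP [/eqP hsz hall].
  by rewrite [X in X && _]/= hsz eqxx [iota _ _]/= [all _ _]/= all1 hall andbT /= nth0; lia.
case: r => [|y t] // /andP [hsz]; rewrite [iota _ _]/= [all _ _]/= all1 => /andP[hy hall].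
exists y, t; split => //; last by rewrite IH // hall andbT.
by rewrite mem_iota; move: hy; rewrite nth0; lia.
Qed.

Lemma uniq_interl l : uniq (interl l).
Proof.
elim: l => [|x l IH] //; apply: allpairs_uniq_dep => //; first exact: iota_uniq.
by move=> [x1 y1] [x2 y2] _ _ [-> ->].
Qed.

Lemma interl_nth l r : r \in interl l -> is_part l ->
  forall i, nth 0 l i.+1 <= nth 0 r i <= nth 0 l i.
Proof.
move=> hr hl i; move: hr; rewrite mem_interl // => /andP [/eqP hs /allP h].
case: (ltnP i (size l)) => hi; first by apply: h; rewrite mem_iota.
by rewrite !nth_default ?hs //; apply: leqW.
Qed.

(** [strips] is built from zero-padded sequences of the length of [lam]; dropping zeros is injective
    on weakly decreasing sequences of equal length, which matches them with partitions. *)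
Lemma perm_strips lam k : is_part lam ->
  perm_eq (strips lam k)
    [seq rho <- (if k <= sumn lam then parts (sumn lam - k) else [::]) | hs lam rho].
Proof.
move=> hl; have hanti r : r \in interl lam -> forall i, nth 0 r i.+1 <= nth 0 r i.
  move=> hr i; have h1 := interl_nth hr hl i; have h2 := interl_nth hr hl i.+1; lia.
have hsz r : r \in interl lam -> size r = size lam by rewrite mem_interl // => /andP[/eqP].
apply: uniq_perm.
- rewrite map_inj_in_uniq ?filter_uniq ?uniq_interl // => r1 r2.
  rewrite !mem_filter => /andP[_ h1] /andP[_ h2] heq.
  apply: (@eq_from_nth _ 0); first by rewrite !hsz.
  by move=> i _; rewrite -nth_filter_pos ?heq ?nth_filter_pos //; apply: hanti.
- by rewrite filter_uniq //; case: ifP => // _; apply: uniq_parts.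
move=> rho; apply/mapP/idP => [[r]|].
  rewrite mem_filter => /andP [/eqP hk hr] ->; rewrite mem_filter; apply/andP; split.
    by apply/hsP => i; rewrite nth_filter_pos ?(interl_nth hr hl) //; apply: hanti.
  rewrite ifT; last by lia.
  apply/partsP; split; first by apply: filter_pos_part; apply: hanti.
  by rewrite sumn_filter_pos; lia.
rewrite mem_filter; case: leqP => hk; rewrite ?in_nil ?andbF // => /andP[/hsP hh /partsP[hp hn]].
have hszr : size rho <= size lam.
  by rewrite leqNgt -part_size //; case/andP: (hh (size lam)) => _; rewrite [X in _ <= X]nth_default // leqn0 => /eqP ->.
have nth_r i : nth 0 (mkseq (nth 0 rho) (size lam)) i = nth 0 rho i.
  by case: (ltnP i (size lam)) => hi; [rewrite nth_mkseq | rewrite !nth_default ?size_mkseq //; apply: leq_trans hi].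
exists (mkseq (nth 0 rho) (size lam)).
  rewrite mem_filter mem_interl // size_mkseq eqxx /=; apply/andP; split.
    rewrite (@sumn_nth _ (size lam)) ?size_mkseq // (eq_bigr (fun i : 'I__ => nth 0 rho i)) => [|i _]; last exact: nth_r.
    by rewrite -sumn_nth //; lia.
  by apply/allP => i _; rewrite nth_r.
apply: part_ext => // [|i]; first by apply: filter_pos_part => i; rewrite !nth_r part_anti.
by rewrite nth_filter_pos ?nth_r // => j; rewrite !nth_r part_anti.
Qed.

End Partitions.

(** * Bijections between chains of horizontal strips *)

Section Reflection.
Implicit Types (l r lam mu rho tau : seq nat) (i j k n s : nat).
Local Open Scope nat_scope.

Lemma mem_strips lam k rho : is_part lam ->
  (rho \in strips lam k) = [&& is_part rho, hs lam rho & sumn rho + k == sumn lam].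
Proof.
move=> hl; rewrite (perm_mem (perm_strips k hl)) mem_filter.
case: leqP => hk; rewrite ?in_nil ?mem_parts.
  by rewrite andbCA; do !bool_congr; apply/eqP/eqP; lia.
by rewrite andbF; apply/esym/negbTE/negP => /and3P[_ _ /eqP]; lia.
Qed.

Lemma uniq_strips lam k : is_part lam -> uniq (strips lam k).
Proof.
move=> hl; rewrite (perm_uniq (perm_strips k hl)) filter_uniq //.
by case: ifP => // _; apply: uniq_parts.
Qed.

Definition ups mu k := [seq lam <- parts (sumn mu + k) | hs lam mu].

Lemma mem_ups mu k lam :
  (lam \in ups mu k) = [&& is_part lam, hs lam mu & sumn mu + k == sumn lam].
Proof. by rewrite mem_filter mem_parts andbCA [sumn lam == _]eq_sym. Qed.

Lemma uniq_ups mu k : uniq (ups mu k).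
Proof. by rewrite filter_uniq // uniq_parts. Qed.

Lemma perm_map_bij (A B : eqType) (f : A -> B) (g : B -> A) (s1 : seq A) (s2 : seq B) :
  uniq s1 -> uniq s2 ->
  (forall x, x \in s1 -> f x \in s2 /\ g (f x) = x) ->
  (forall y, y \in s2 -> g y \in s1 /\ f (g y) = y) ->
  perm_eq [seq f x | x <- s1] s2.
Proof.
move=> u1 u2 h1 h2; apply: uniq_perm => //.
  by rewrite map_inj_in_uniq // => x y /h1 [_ {2}<-] /h1 [_ {2}<-] ->.
move=> y; apply/mapP/idP => [[x /h1 [hx _] ->] //|/h2 [hy {1}<-]]; by exists (g y).
Qed.

(** If lam/rho and rho/mu are horizontal strips, the conditions on rho decouple: each rho_i ranges
    over the interval from [refl_lo] to [refl_hi]. Reversing every interval is the Bender-Knuth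
    involution. *)
Definition refl_hi lam mu i := minn (nth 0 lam i) (if i is j.+1 then nth 0 mu j else nth 0 lam 0).
Definition refl_lo lam mu i := maxn (nth 0 lam i.+1) (nth 0 mu i).
Definition refl lam mu rho :=
  mkp (fun i => refl_hi lam mu i + refl_lo lam mu i - nth 0 rho i) (size lam).

Lemma refl_bounds lam mu rho : hs lam rho -> hs rho mu ->
  forall i, refl_lo lam mu i <= nth 0 rho i <= refl_hi lam mu i.
Proof.
move=> /hsP h1 /hsP h2 i; rewrite /refl_lo /refl_hi.
have := h1 i; have := h2 i; case: i => [|i]; last have := h2 i; lia.
Qed.

Lemma bounds_hs lam mu rho : is_part lam -> is_part mu ->
  (forall i, refl_lo lam mu i <= nth 0 rho i <= refl_hi lam mu i) -> hs lam rho /\ hs rho mu.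
Proof.
move=> hl hm h; split; apply/hsP => i; have := h i; have := h i.+1.
  by rewrite /refl_lo /refl_hi; case: i => [|i]; lia.
rewrite /refl_lo /refl_hi; lia.
Qed.

Section ReflLemmas.
Variables lam mu rho : seq nat.
Hypotheses (hl : is_part lam) (hm : is_part mu) (h1 : hs lam rho) (h2 : hs rho mu).

Let hb := refl_bounds h1 h2.

Lemma refl_hi_le i : refl_hi lam mu i <= nth 0 lam i.
Proof. exact: geq_minl. Qed.

Lemma nth_refl i : nth 0 (refl lam mu rho) i = refl_hi lam mu i + refl_lo lam mu i - nth 0 rho i.
Proof.
apply: nth_mkp => {}i; first by have := hb i; have := hb i.+1; rewrite /refl_lo /refl_hi; lia.
by move=> hi; have := refl_hi_le i; have /andP[_ ] := hb i; have /andP[] := hb i; rewrite (nth_default _ hi); lia.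
Qed.

Lemma refl_part : is_part (refl lam mu rho).
Proof.
apply: mkp_part => i; first by have := hb i; have := hb i.+1; rewrite /refl_lo /refl_hi; lia.
by move=> hi; have := refl_hi_le i; have /andP[_ ] := hb i; have /andP[] := hb i; rewrite (nth_default _ hi); lia.
Qed.

Lemma refl_hs : hs lam (refl lam mu rho) /\ hs (refl lam mu rho) mu.
Proof. by apply: bounds_hs => // i; rewrite nth_refl; have := hb i; lia. Qed.

(** The minimum and the maximum of lam_{i+1} and mu_i add up to lam_{i+1} + mu_i, so the interval
    endpoints sum to |lam| + |mu|. Hence the reflection exchanges the sizes of the two strips. *)
Lemma refl_sumn : sumn (refl lam mu rho) + sumn rho = sumn lam + sumn mu.
Proof.
set n := (maxn (size lam) (maxn (size mu) (maxn (size rho) (size (refl lam mu rho))))).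
rewrite (@sumn_nth (refl lam mu rho) n.+1) ?(@sumn_nth rho n.+1) -?big_split /=; try lia.
rewrite (eq_bigr (fun i : 'I_n.+1 => refl_hi lam mu i + refl_lo lam mu i)); last first.
  by move=> i _; rewrite nth_refl; have := hb i; lia.
rewrite big_split /= big_ord_recl [X in _ + X]big_ord_recr /=.
rewrite -addnA [X in _ + X]addnA -big_split /= (eq_bigr (fun i : 'I_n => nth 0 lam i.+1 + nth 0 mu i)); last first.
  by move=> i _; rewrite /refl_hi /refl_lo /bump leq0n add1n; lia.
rewrite big_split /= /refl_lo !nth_default; try lia.
have -> : sumn lam = nth 0 lam 0 + \sum_(i < n) nth 0 lam i.+1.
  by rewrite (@sumn_nth lam n.+1) ?big_ord_recl //; lia.
by rewrite (@sumn_nth mu n) /refl_hi /= ?minnn; lia.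
Qed.
End ReflLemmas.

Lemma reflK lam mu rho : is_part lam -> is_part mu -> is_part rho -> hs lam rho -> hs rho mu ->
  refl lam mu (refl lam mu rho) = rho.
Proof.
move=> hl hm hr h1 h2; have [h3 h4] := refl_hs hl hm h1 h2.
apply: part_ext => // [|i]; first exact: refl_part.
by rewrite nth_refl // nth_refl //; have := refl_bounds h1 h2 i; lia.
Qed.

Lemma sum_strips_swap (V : nmodType) (G : seq nat -> V) lam k j : is_part lam ->
  (\sum_(rho <- strips lam k) \sum_(mu <- strips rho j) G mu =
  \sum_(rho <- strips lam j) \sum_(mu <- strips rho k) G mu)%R.
Proof.
move=> hl.
rewrite -(big_allpairs_dep (h := fun x y : seq nat => (x, y)) (F := fun p => G p.2)).
rewrite -(big_allpairs_dep (h := fun x y : seq nat => (x, y)) (F := fun p => G p.2)).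
pose f (p : seq nat * seq nat) := (refl lam p.2 p.1, p.2).
have hu k' j' : uniq [seq (x, y) | x <- strips lam k', y <- strips x j'].
  apply: allpairs_uniq_dep; first exact: uniq_strips.
    by move=> x; rewrite mem_strips // => /andP[hx _]; apply: uniq_strips.
  by move=> [x1 y1] [x2 y2] _ _ [-> ->].
have hf k' j' p : p \in [seq (x, y) | x <- strips lam k', y <- strips x j'] ->
    f p \in [seq (x, y) | x <- strips lam j', y <- strips x k'] /\ f (f p) = p.
  move=> /allpairsPdep [x [y [hx hy ->]]]; move: hx hy; rewrite mem_strips // => /and3P[hx1 hx2 /eqP hx3].
  rewrite mem_strips // => /and3P[hy1 hy2 /eqP hy3].
  have [h3 h4] := refl_hs hl hy1 hx2 hy2; have h5 := refl_part hl hy1 hx2 hy2.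
  have h6 := refl_sumn hl hy1 hx2 hy2.
  split; last by rewrite /f /= reflK.
  apply/allpairsPdep; exists (refl lam y x), y; split => //; rewrite mem_strips //.
    by rewrite h5 h3 /=; apply/eqP; lia.
  by rewrite hy1 h4 /=; apply/eqP; lia.
rewrite -(perm_big _ (perm_map_bij (hu k j) (hu j k) (hf k j) (hf j k))) big_map.
by apply: eq_bigr => -[x y].
Qed.

(** The local rule of growth diagrams (piecewise-linear RSK). For lam above mu and rho, lam_{i+1}
    lies between max(mu_{i+1}, rho_{i+1}) and min(mu_i, rho_i); reflecting it there gives a
    partition below both. The first part lam_0 is unbounded above, and its excess over max(mu_0,
    rho_0) is recorded separately as the [n] of the inverse map [upg]. *)
Definition upf mu rho lam :=
  mkp (fun i => maxn (nth 0 mu i.+1) (nth 0 rho i.+1) + minn (nth 0 mu i) (nth 0 rho i) - nth 0 lam i.+1)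
    (size mu).
Definition upg mu rho n tau :=
  mkp (fun i => if i is l.+1 then
     maxn (nth 0 mu l.+1) (nth 0 rho l.+1) + minn (nth 0 mu l) (nth 0 rho l) - nth 0 tau l
   else maxn (nth 0 mu 0) (nth 0 rho 0) + n) (maxn (size mu) (size rho)).+1.

Section UpF.
Variables mu rho lam : seq nat.
Hypotheses (hm : is_part mu) (hr : is_part rho) (hl : is_part lam) (h1 : hs lam mu) (h2 : hs lam rho).

Lemma nth_upf i : nth 0 (upf mu rho lam) i =
  maxn (nth 0 mu i.+1) (nth 0 rho i.+1) + minn (nth 0 mu i) (nth 0 rho i) - nth 0 lam i.+1.
Proof.
move/hsP: h1 => h1'; move/hsP: h2 => h2'; apply: nth_mkp => {}i.
  by have := h1' i; have := h1' i.+1; have := h1' i.+2; have := h2' i; have := h2' i.+1; have := h2' i.+2; lia.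
move=> hi; have := h2' i; have := h2' i.+1; rewrite ![nth 0 mu _]nth_default ?leqW //; lia.
Qed.

Lemma upf_part : is_part (upf mu rho lam).
Proof.
move/hsP: h1 => h1'; move/hsP: h2 => h2'; apply: mkp_part => i.
  by have := h1' i; have := h1' i.+1; have := h1' i.+2; have := h2' i; have := h2' i.+1; have := h2' i.+2; lia.
move=> hi; have := h2' i; have := h2' i.+1; rewrite ![nth 0 mu _]nth_default ?leqW //; lia.
Qed.

Lemma upf_hs : hs mu (upf mu rho lam) /\ hs rho (upf mu rho lam).
Proof.
move/hsP: h1 => h1'; move/hsP: h2 => h2'.
by split; apply/hsP => i; rewrite nth_upf; have := h1' i; have := h1' i.+1; have := h2' i; have := h2' i.+1; lia.
Qed.

Lemma upf_sumn : sumn (upf mu rho lam) + sumn lam =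
  sumn mu + sumn rho + (nth 0 lam 0 - maxn (nth 0 mu 0) (nth 0 rho 0)).
Proof.
move/hsP: h1 => h1'; move/hsP: h2 => h2'.
set n := (maxn (size lam) (maxn (size mu) (maxn (size rho) (size (upf mu rho lam))))).
rewrite (@sumn_nth (upf mu rho lam) n) ?(@sumn_nth lam n.+1); try lia.
rewrite big_ord_recl addnCA -big_split /=.
rewrite (eq_bigr (fun i : 'I_n => maxn (nth 0 mu i.+1) (nth 0 rho i.+1) + minn (nth 0 mu i) (nth 0 rho i))); last first.
  move=> i _; rewrite nth_upf /bump /= add1n.
  by have := h1' i; have := h1' i.+1; have := h2' i; have := h2' i.+1; lia.
have e : \sum_(i < n) maxn (nth 0 mu i.+1) (nth 0 rho i.+1) + maxn (nth 0 mu 0) (nth 0 rho 0) =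
   \sum_(i < n) maxn (nth 0 mu i) (nth 0 rho i).
  have : \sum_(i < n.+1) maxn (nth 0 mu i) (nth 0 rho i) = \sum_(i < n.+1) maxn (nth 0 mu i) (nth 0 rho i) by [].
  by rewrite {1}big_ord_recl big_ord_recr /= !(nth_default _ (n := n)); try lia; rewrite maxnn addn0 => <-; rewrite addnC.
have e2 : \sum_(i < n) maxn (nth 0 mu i) (nth 0 rho i) + \sum_(i < n) minn (nth 0 mu i) (nth 0 rho i) =
   sumn mu + sumn rho.
  rewrite (@sumn_nth mu n) ?(@sumn_nth rho n) -?big_split /=; try lia.
  by apply: eq_bigr => i _; lia.
have aux (A B C t x y : nat) : x <= y -> A + x = B -> B + C = t -> y + (A + C) = t + (y - x) by lia.
rewrite big_split /=; apply: aux e e2; rewrite geq_max.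
by case/andP: (h1' 0) => _ ->; case/andP: (h2' 0).
Qed.
End UpF.

Section UpG.
Variables (mu rho tau : seq nat) (n : nat).
Hypotheses (hm : is_part mu) (hr : is_part rho) (h1 : hs mu tau) (h2 : hs rho tau).

Lemma nth_upg i : nth 0 (upg mu rho n tau) i =
 if i is l.+1 then
     maxn (nth 0 mu l.+1) (nth 0 rho l.+1) + minn (nth 0 mu l) (nth 0 rho l) - nth 0 tau l
   else maxn (nth 0 mu 0) (nth 0 rho 0) + n.
Proof.
move/hsP: h1 => h1'; move/hsP: h2 => h2'; apply: nth_mkp => {}i.
  by case: i => [|i]; [have := h1' 0; have := h2' 0 | have := h1' i; have := h1' i.+1; have := h2' i; have := h2' i.+1]; lia.
case: i => // i hi; have := h2' i; have := h1' i.
by have := hi; rewrite ltnS geq_max => /andP[hi1 hi2]; rewrite (nth_default _ hi1) (nth_default _ hi2); lia.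
Qed.

Lemma upg_part : is_part (upg mu rho n tau).
Proof.
move/hsP: h1 => h1'; move/hsP: h2 => h2'; apply: mkp_part => i.
  by case: i => [|i]; [have := h1' 0; have := h2' 0 | have := h1' i; have := h1' i.+1; have := h2' i; have := h2' i.+1]; lia.
case: i => // i hi; have := h2' i; have := h1' i.
by have := hi; rewrite ltnS geq_max => /andP[hi1 hi2]; rewrite (nth_default _ hi1) (nth_default _ hi2); lia.
Qed.

Lemma upg_hs : hs (upg mu rho n tau) mu /\ hs (upg mu rho n tau) rho.
Proof.
move/hsP: h1 => h1'; move/hsP: h2 => h2'.
by split; apply/hsP => -[|i]; rewrite !nth_upg; have := h1' 0; have := h2' 0; try have := h1' i; try have := h1' i.+1; try have := h2' i; try have := h2' i.+1; lia.
Qed.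
End UpG.

(** The relation D_j U_k = sum_i U_{k-i} D_{j-i} between removing and adding horizontal strips; i is
    the excess of the first part of lam in the local rule. *)
Lemma sum_ups_strips (V : nmodType) (G : seq nat -> V) mu k j : is_part mu ->
  (\sum_(lam <- ups mu k) \sum_(rho <- strips lam j) G rho =
  \sum_(i <- iota 0 (minn j k).+1) \sum_(tau <- strips mu (j - i)) \sum_(rho <- ups tau (k - i)) G rho)%R.
Proof.
move=> hm.
rewrite -(big_allpairs_dep (h := fun x y : seq nat => (x, y)) (F := fun p => G p.2)).
under [RHS]eq_bigr do rewrite -(big_allpairs_dep (h := fun x y : seq nat => (x, y)) (F := fun p => G p.2)).
rewrite -(big_allpairs_dep (h := fun (x : nat) (y : seq nat * seq nat) => (x, y)) (F := fun p => G p.2.2)).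
pose f (p : seq nat * seq nat) :=
  (nth 0 p.1 0 - maxn (nth 0 mu 0) (nth 0 p.2 0), (upf mu p.2 p.1, p.2)).
pose g (p : nat * (seq nat * seq nat)) := (upg mu p.2.2 p.1 p.2.1, p.2.2).
set s1 := [seq (x, y) | x <- _, y <- _].
set s2 := [seq (x, y) | x <- _, y <- _].
have u1 : uniq s1.
  apply: allpairs_uniq_dep; first exact: uniq_ups.
    by move=> x; rewrite mem_ups => /andP[hx _]; apply: uniq_strips.
  by move=> [x1 y1] [x2 y2] _ _ [-> ->].
have u2 : uniq s2.
  apply: allpairs_uniq_dep; first exact: iota_uniq.
    move=> x _; apply: allpairs_uniq_dep; first exact: uniq_strips.
      by move=> y _; apply: uniq_ups.
    by move=> [x1 y1] [x2 y2] _ _ [-> ->].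
  by move=> [x1 y1] [x2 y2] _ _ [-> ->].
have hf p : p \in s1 -> f p \in s2 /\ g (f p) = p.
  move=> /allpairsPdep [lam [rho [hx hy ->]]]; move: hx hy; rewrite mem_ups => /and3P[hx1 hx2 /eqP hx3].
  rewrite mem_strips // => /and3P[hy1 hy2 /eqP hy3].
  have hh : sumn (upf mu rho lam) + sumn lam =
    sumn mu + sumn rho + (nth 0 lam 0 - maxn (nth 0 mu 0) (nth 0 rho 0)) by apply: upf_sumn.
  have [h3 h4] : hs mu (upf mu rho lam) /\ hs rho (upf mu rho lam) by apply: upf_hs.
  have h5 : is_part (upf mu rho lam) by apply: upf_part.
  have h6 := hs_sumn h3; have h7 := hs_sumn h4.
  have := hx2 => /hsP /(_ 0) hx20; have := hy2 => /hsP /(_ 0) hy20.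
  split; rewrite /f /g /=; last first.
    congr pair; apply: part_ext => // [|i]; first exact: upg_part.
    rewrite nth_upg //; case: i => [|i]; first lia.
    rewrite nth_upf //; have := hx2 => /hsP hq; have := hy2 => /hsP hq'.
    by have := hq i; have := hq i.+1; have := hq' i; have := hq' i.+1; lia.
  apply/allpairsPdep; eexists; eexists; split; last by reflexivity.
    by rewrite mem_iota; lia.
  apply/allpairsPdep; eexists; eexists; split; last by reflexivity.
    by rewrite mem_strips // h5 h3 /=; apply/eqP; lia.
  by rewrite mem_ups hy1 h4 /=; apply/eqP; lia.
have hg p : p \in s2 -> g p \in s1 /\ f (g p) = p.
  move=> /allpairsPdep [n [q [hn /allpairsPdep [tau [rho [hx hy ->]]] ->]]]; move: hn hx hy.
  rewrite mem_iota mem_strips // => hn /and3P[hx1 hx2 /eqP hx3].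
  rewrite mem_ups => /and3P[hy1 hy2 /eqP hy3]; rewrite /f /g /=.
  have [h3 h4] : hs (upg mu rho n tau) mu /\ hs (upg mu rho n tau) rho by apply: upg_hs.
  have h5 : is_part (upg mu rho n tau) by apply: upg_part.
  have e : upf mu rho (upg mu rho n tau) = tau.
    apply: part_ext => // [|i]; first exact: upf_part.
    rewrite nth_upf // nth_upg //; have := hx2 => /hsP hq; have := hy2 => /hsP hq'.
    by have := hq i; have := hq i.+1; have := hq' i; have := hq' i.+1; lia.
  have hh : sumn (upf mu rho (upg mu rho n tau)) + sumn (upg mu rho n tau) = sumn mu + sumn rho +
    (nth 0 (upg mu rho n tau) 0 - maxn (nth 0 mu 0) (nth 0 rho 0)) by apply: upf_sumn.
  rewrite e nth_upg //= in hh.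
  split; last by rewrite e nth_upg //=; congr pair; lia.
  apply/allpairsPdep; eexists; eexists; split; last by reflexivity.
    by rewrite mem_ups h5 h3 /=; apply/eqP; lia.
  by rewrite mem_strips // hy1 h4 /=; apply/eqP; lia.
by rewrite -(perm_big _ (perm_map_bij u1 u2 hf hg)) big_map.
Qed.

End Reflection.

(** * Skew Schur functions and the Pieri rule *)

Section Symmetry.

Lemma swap_perm (V : Type) (F : seq nat -> V) :
  (forall s x y t, F (s ++ x :: y :: t) = F (s ++ y :: x :: t)) ->
  forall a b s, perm_eq a b -> F (s ++ a) = F (s ++ b).
Proof.
move=> hsw; have hmv s b1 x b2 : F (s ++ b1 ++ x :: b2) = F (s ++ x :: b1 ++ b2).
  elim: b1 s => //= y b1 IH s.
  by rewrite -cat_rcons IH cat_rcons hsw.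
elim=> [|x a IH] b s hp; first by move: hp; rewrite perm_sym => /perm_nilP ->.
have hx : x \in b by rewrite -(perm_mem hp) inE eqxx.
case/splitPr: hx hp => b1 b2; rewrite perm_sym perm_catC /= perm_cons perm_catC perm_sym => hp.
by rewrite hmv -!cat_rcons; apply: IH.
Qed.

Lemma sym_intro (V : Type) (F : seq nat -> V) :
  (forall s x y t, F (s ++ x :: y :: t) = F (s ++ y :: x :: t)) ->
  (forall s t, F (s ++ 0%N :: t) = F (s ++ t)) ->
  forall a b, perm_eq [seq x <- a | (0 < x)%N] [seq x <- b | (0 < x)%N] -> F a = F b.
Proof.
move=> hsw h0; have hf a s : F (s ++ a) = F (s ++ [seq x <- a | (0 < x)%N]).
  elim: a s => //= -[|x] a IH s /=; first by rewrite h0.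
  by rewrite -!cat_rcons IH.
move=> a b hp; rewrite -[a]cat0s hf -[b]cat0s [RHS]hf.
exact: swap_perm.
Qed.

Lemma skew_kostka_cons lam mu k r :
  skew_kostka_rev lam mu (k :: r) = (\sum_(rho <- strips lam k) skew_kostka_rev rho mu r)%N.
Proof. by rewrite /= sumnE big_map. Qed.

Lemma strips0 lam : is_part lam -> perm_eq (strips lam 0) [:: lam].
Proof.
move=> hl; apply: uniq_perm => // [|rho]; first exact: uniq_strips.
rewrite mem_strips // inE; apply/and3P/eqP => [[hr /hsP h /eqP hs]|->]; last first.
  by rewrite hs_refl // addn0.
apply: part_ext => // i; apply/eqP.
pose n := maxn i.+1 (maxn (size rho) (size lam)).
have hn1 : (size lam <= n)%N by rewrite /n !leq_max leqnn !orbT.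
have hn2 : (size rho <= n)%N by rewrite /n !leq_max leqnn !orbT.
have hi : (i < n)%N by rewrite /n !leq_max leqnn.
have : (\sum_(i < n) (nth 0%N lam i - nth 0%N rho i) = 0)%N.
  rewrite sumnB => [|j _]; last by case/andP: (h j).
  by rewrite -(sumn_nth hn1) -(sumn_nth hn2) -hs addn0 subnn.
move/eqP; rewrite sum_nat_eq0 => /forallP /(_ (Ordinal hi)) /=.
by case/andP: (h i) => _ h1 h2; rewrite eqn_leq h1 /= -subn_eq0.
Qed.

Lemma skew_kostka_sym lam mu r r' : is_part lam ->
  perm_eq [seq x <- r | (0 < x)%N] [seq x <- r' | (0 < x)%N] ->
  skew_kostka_rev lam mu r = skew_kostka_rev lam mu r'.
Proof.
move=> hl; apply: (sym_intro (F := skew_kostka_rev lam mu)) => s.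
  move=> x y t; elim: s lam hl => [|z s IH] lam hl; rewrite ?cat0s ?cat_cons skew_kostka_cons.
    rewrite [RHS]skew_kostka_cons.
    under eq_bigr do rewrite skew_kostka_cons.
    under [RHS]eq_bigr do rewrite skew_kostka_cons.
    by apply: (sum_strips_swap (V := nat)).
  rewrite skew_kostka_cons; apply: eq_big_seq => rho.
  by rewrite mem_strips // => /andP[hr _]; apply: IH.
move=> t; elim: s lam hl => [|z s IH] lam hl; rewrite ?cat0s ?cat_cons skew_kostka_cons.
  by rewrite (perm_big _ (strips0 hl)) big_seq1.
rewrite skew_kostka_cons; apply: eq_big_seq => rho.
by rewrite mem_strips // => /andP[hr _]; apply: IH.
Qed.

Variable R : realType.
Implicit Types (F G : sring R) (a : seq nat).

Lemma is_sym_T F j : is_sym F -> is_sym (T j F).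
Proof. by move=> h a b hp; apply: h; rewrite /=; case: ifP => _ //=; rewrite perm_cons. Qed.

Lemma is_sym_sw F : is_sym F -> forall s x y t, F (s ++ x :: y :: t) = F (s ++ y :: x :: t).
Proof.
move=> h s x y t; apply: h; apply: perm_filter; rewrite perm_cat2l.
by apply/seq.permP => p /=; rewrite addnCA.
Qed.

Lemma is_sym_0 F : is_sym F -> (T 0 F : sring R) = F.
Proof. by move=> h; apply: funext => a; apply: h. Qed.

Lemma is_sym_TC F i j : is_sym F -> (T i (T j F) : sring R) = T j (T i F).
Proof. by move=> h; apply: funext => a; apply: (is_sym_sw h [::]). Qed.

Lemma is_symD F G : is_sym F -> is_sym G -> is_sym (F + G).
Proof. by move=> hF hG a b h; rewrite /GRing.add /= /sadd (hF a b) ?(hG a b). Qed.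

Lemma is_sym_sum (I : eqType) (r : seq I) (P : pred I) (FF : I -> sring R) :
  (forall i, i \in r -> P i -> is_sym (FF i)) -> is_sym (\sum_(i <- r | P i) FF i).
Proof.
move=> h a b hp; rewrite !ser_sum big_seq_cond [RHS]big_seq_cond.
by apply: eq_bigr => i /andP[h1 h2]; apply: h.
Qed.

Lemma sumn_filter_perm a b :
  perm_eq [seq x <- a | (0 < x)%N] [seq x <- b | (0 < x)%N] -> sumn a = sumn b.
Proof. by move=> h; rewrite -sumn_filter_pos -[RHS]sumn_filter_pos !sumnE (perm_big _ h). Qed.

Lemma is_sym_sumn (f : nat -> R) : is_sym (fun a => f (sumn a)).
Proof. by move=> a b /sumn_filter_perm ->. Qed.

Lemma is_sym_hser k : is_sym (hser R k). Proof. exact: (is_sym_sumn (fun n => (n == k)%:R)). Qed.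
Lemma is_sym1 : is_sym (1 : sring R). Proof. exact: (is_sym_sumn (fun n => (n == 0%N)%:R)). Qed.
Lemma is_symC c : is_sym (sC c : sring R).
Proof. exact: (is_sym_sumn (fun n => c * (n == 0%N)%:R)). Qed.

Lemma serM_cons F G x a :
  (F * G) (x :: a) = \sum_(y < x.+1) ((T y F : sring R) * (T (x - y) G : sring R)) a.
Proof. exact: smul_cons. Qed.

Lemma is_symM F G : is_sym F -> is_sym G -> is_sym (F * G).
Proof.
move=> hF hG; apply: sym_intro => s.
  move=> x y t; elim: s F G hF hG => [|z s IH] F G hF hG; last first.
    rewrite !cat_cons !serM_cons; apply: eq_bigr => i _.
    by apply: IH; apply: is_sym_T.
  rewrite !cat0s !serM_cons.
  under eq_bigr do rewrite serM_cons.
  under [RHS]eq_bigr do rewrite serM_cons.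
  rewrite exchange_big /=; apply: eq_bigr => i _; apply: eq_bigr => j _.
  by rewrite is_sym_TC // [X in _ * X]is_sym_TC.
move=> t; elim: s F G hF hG => [|z s IH] F G hF hG.
  by rewrite !cat0s serM_cons big_ord1 subn0 !is_sym_0.
by rewrite !cat_cons !serM_cons; apply: eq_bigr => i _; apply: IH; apply: is_sym_T.
Qed.

Lemma is_symN F : is_sym F -> is_sym (- F).
Proof. by move=> h a b hp; rewrite serN (h _ _ hp). Qed.

Lemma is_symB F G : is_sym F -> is_sym G -> is_sym (F - G).
Proof. by move=> hF hG; apply: is_symD => //; apply: is_symN. Qed.

Lemma is_symX F n : is_sym F -> is_sym (F ^+ n).
Proof. by move=> h; elim: n => [|n IH]; rewrite ?exprS; [exact: is_sym1 | exact: is_symM]. Qed.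

Lemma is_sym_skew lam mu : is_part lam -> is_sym (skew_schur R lam mu).
Proof.
move=> hl a b hp; rewrite /skew_schur (@skew_kostka_sym _ _ _ (rev b)) //.
by rewrite !filter_rev perm_rev perm_sym perm_rev perm_sym.
Qed.

(** [skew_kostka_rev] removes the last variable first, whereas [T] reads off the first one; symmetry
    reconciles the two. *)
Lemma T_skew lam mu j : is_part lam ->
  (T j (skew_schur R lam mu) : sring R) = \sum_(rho <- strips lam j) (skew_schur R rho mu : sring R).
Proof.
move=> hl; apply: funext => a; rewrite ser_sum /T /skew_schur.
rewrite (@skew_kostka_sym _ _ _ (j :: rev a)) //; last first.
  by apply: perm_filter; rewrite rev_cons perm_rcons.
by rewrite skew_kostka_cons natr_sum.
Qed.

Lemma T_hser k j : (T j (hser R k) : sring R) = if (j <= k)%N then hser R (k - j) : sring R else 0.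
Proof.
apply: funext => a; rewrite /T /hser /=; case: leqP => h.
  by rewrite -[in X in X = _](subnKC h) eqn_add2l.
by rewrite (_ : (_ == _) = false) //; apply/negbTE; lia.
Qed.

Lemma T_schur lam j : is_part lam ->
  (T j (schur R lam) : sring R) = \sum_(rho <- strips lam j) (schur R rho : sring R).
Proof. exact: T_skew. Qed.

(** Induction on the exponents. T_j of the left side is the sum of the h_{k-y} T_{j-y} s_mu, and the
    commutation of [ups] with [strips] brings the right side to the same form. *)
Lemma pieri k mu : is_part mu ->
  (hser R k : sring R) * schur R mu = \sum_(lam <- ups mu k) (schur R lam : sring R).
Proof.
move=> hm; apply: funext => a; rewrite ser_sum; elim: a k mu hm => [|j a IH] k mu hm.
  rewrite serM_nil /hser /schur /skew_schur /rev /=.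
  rewrite -(natr_sum R) -natrM; congr (_%:R).
  have [->|nz] := eqVneq k 0%N; last first.
    rewrite big1_seq ?[0%N == k]eq_sym ?(negbTE nz) // => lam /andP[_].
    rewrite mem_ups => /and3P[_ _ /eqP hs]; case: lam hs => //=; move: nz; lia.
  rewrite mul1n /ups addn0; have [->|nm] := eqVneq mu [::].
    by rewrite parts0 /= big_seq1.
  rewrite big1_seq // => lam; rewrite mem_filter mem_parts => /and3P[_ _ /andP[_ /eqP]].
  case: lam => //= /esym /eqP; move: nm hm; case: mu => //= x mu _.
  by rewrite is_part_cons => /and3P[]; lia.
rewrite serM_cons; under [RHS]eq_big_seq => lam.
  rewrite mem_ups => /and3P[hl _ _].
  have -> : schur R lam (j :: a) = \sum_(rho <- strips lam j) schur R rho a.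
    by rewrite -ser_sum -T_schur.
  over.
rewrite (sum_ups_strips (fun rho => schur R rho a) k j hm).
rewrite -(big_mkord xpredT (fun y => ((T y (hser R k) : sring R) * (T (j - y) (schur R mu) : sring R)) a)).
rewrite (big_cat_nat (n := (minn j k).+1)) //=; last by lia.
rewrite [X in _ + X]big_nat_cond [X in _ + X]big1 ?addr0; last first.
  move=> y hy; rewrite T_hser ifF ?mul0r //; lia.
rewrite big_seq_cond [RHS]big_seq_cond /index_iota subn0; apply: eq_bigr => y; rewrite mem_iota => hy.
rewrite T_hser ifT; last by lia.
rewrite T_schur // mulr_sumr ser_sum; apply: eq_big_seq => tau.
by rewrite mem_strips // => /andP[ht _]; apply: IH.
Qed.

End Symmetry.

(** * Schur expansions and adjoints *)

Section Triangular.
Variables (A : eqType) (R : fieldType) (K : A -> A -> R).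

(** A unitriangular system, stated for a list in which [K x y] vanishes whenever x precedes y, so
    that no indexing by ordinals is needed. *)
Lemma tri_solve (s : seq A) (F : A -> R) :
  uniq s -> pairwise (fun x y => K x y == 0) s -> (forall x, x \in s -> K x x = 1) ->
  exists c : A -> R, forall y, y \in s -> \sum_(x <- s) c x * K x y = F y.
Proof.
elim: s => [|x0 s IH] /=; first by exists (fun _ => 0).
move=> /andP[hn hu] /andP[/allP h0 hp] h1.
have [c hc] := IH hu hp (fun x hx => h1 x (mem_behead (s := x0 :: s) hx)).
pose c0 := F x0 - \sum_(x <- s) c x * K x x0.
exists (fun x => if x == x0 then c0 else c x) => y.
have hs : \sum_(x <- s) (if x == x0 then c0 else c x) * K x y = \sum_(x <- s) c x * K x y.
  by apply: eq_big_seq => x hx; case: eqP => // e; rewrite -e hx in hn.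
rewrite big_cons eqxx hs inE; case/predU1P => [->|hy].
  by rewrite h1 ?inE ?eqxx // mulr1 subrK.
by rewrite hc // (eqP (h0 _ hy)) mulr0 add0r.
Qed.

Lemma tri_inj (s : seq A) (c : A -> R) :
  uniq s -> pairwise (fun x y => K x y == 0) s -> (forall x, x \in s -> K x x = 1) ->
  (forall y, y \in s -> \sum_(x <- s) c x * K x y = 0) -> forall x, x \in s -> c x = 0.
Proof.
elim: s => [|x0 s IH] //= /andP[hn hu] /andP[/allP h0 hp] h1 hc.
have hs : forall x, x \in s -> c x = 0.
  apply: IH => // [x hx|y hy]; first by rewrite h1 // inE hx orbT.
  by have := hc y; rewrite inE hy orbT big_cons (eqP (h0 _ hy)) mulr0 add0r => /(_ isT).
move=> x; rewrite inE => /predU1P [->|]; last exact: hs.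
have := hc x0; rewrite inE eqxx big_cons h1 ?inE ?eqxx // mulr1 => /(_ isT).
by rewrite big1_seq ?addr0 // => y /andP[_ hy]; rewrite hs ?mul0r.
Qed.
End Triangular.

Section Kostka.
Implicit Types (lam mu rho r : seq nat).

(** The lexicographic order stands in for dominance: Kostka numbers are triangular for it too, and
    since it is total the partitions can be sorted. *)
Definition lexle lam mu : bool := ((lam : seqlexi nat) <= (mu : seqlexi nat))%O.

Lemma lexle_cons x lam y mu :
  lexle (x :: lam) (y :: mu) = (x <= y)%N && ((y <= x)%N ==> lexle lam mu).
Proof. by rewrite /lexle Order.SeqLexiOrder.lexi_cons !leEnat. Qed.

(** A horizontal strip in [x :: lam] has at most x cells, and exactly x only if [lam] remains. This
    drives the triangularity of the Kostka numbers. *)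
Lemma hs_behead x lam rho : is_part (x :: lam) -> hs (x :: lam) rho ->
  (sumn lam <= sumn rho)%N /\ (is_part rho -> sumn rho = sumn lam -> rho = lam).
Proof.
move=> hl /hsP h; pose n := maxn (size rho) (size lam).
have hn1 : (size lam <= n)%N by rewrite leq_maxr.
have hn2 : (size rho <= n)%N by rewrite leq_maxl.
rewrite (sumn_nth hn1) (sumn_nth hn2); split.
  by apply: leq_sum => i _; case/andP: (h i).
move=> hr hs; apply: part_ext => // [|i].
  by move: hl; rewrite is_part_cons => /and3P[].
have : (\sum_(i < n) (nth 0%N rho i - nth 0%N lam i) = 0)%N.
  by rewrite sumnB ?hs ?subnn // => j _; case/andP: (h j).
case: (ltnP i n) => hi; last by rewrite !nth_default //; apply: leq_trans hi.
move/eqP; rewrite sum_nat_eq0 => /forallP /(_ (Ordinal hi)) /=.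
by case/andP: (h i) => h1 _ h2; apply/eqP; rewrite eqn_leq h1 andbT -subn_eq0.
Qed.

Lemma strips_head x lam : is_part (x :: lam) -> perm_eq (strips (x :: lam) x) [:: lam].
Proof.
move=> hl; have hl' : is_part lam by move: hl; rewrite is_part_cons => /and3P[].
apply: uniq_perm => // [|rho]; first exact: uniq_strips.
rewrite mem_strips // inE; apply/and3P/eqP => [[hr h /eqP hs]|->].
  by apply: (proj2 (hs_behead hl h)) => //; move: hs => /=; lia.
split => //; last by rewrite /= addnC.
by apply/hsP => i; rewrite leqnn /=; have := part_anti hl (leqnSn i).
Qed.

Lemma kostka_lex lam mu : is_part lam -> is_part mu -> sumn mu = sumn lam ->
  (0 < skew_kostka_rev lam [::] mu)%N -> lexle mu lam.
Proof.
elim: mu lam => [|m mu IH] lam hl //; rewrite is_part_cons => /and3P[hm0 _ hm] hs.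
rewrite skew_kostka_cons lt0n sum_nat_seq_neq0.
case/hasP => rho; rewrite mem_strips // => /and3P[hr hh /eqP hrs] /= hk.
case: lam hl hs hh hrs => [|x lam] hl hs hh hrs.
  by move: hs => /=; lia.
have [h1 h2] := hs_behead hl hh; rewrite lexle_cons.
have hmx : (m <= x)%N by move: hrs => /=; lia.
rewrite hmx /=; apply/implyP => hxm; have e : m = x by lia.
rewrite -(h2 hr) => [|]; last by move: hrs => /=; lia.
by apply: IH => //; [move: hs hrs => /=; lia | rewrite lt0n].
Qed.

Lemma kostka_diag lam : is_part lam -> skew_kostka_rev lam [::] lam = 1%N.
Proof.
elim: lam => // x lam IH hl.
rewrite skew_kostka_cons (perm_big _ (strips_head hl)) big_seq1 IH //.
by move: hl; rewrite is_part_cons => /and3P[].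
Qed.

End Kostka.

Lemma pairwise_rev (A : Type) (r : rel A) s : pairwise r (rev s) = pairwise (fun x y => r y x) s.
Proof.
elim: s => //= x s IH; rewrite rev_cons -cats1 pairwise_cat IH /= !andbT.
by rewrite allrel1r all_rev.
Qed.

Section Hall.
Variable R : realType.
Implicit Types (F G : sring R) (a b lam mu nu : seq nat) (c : seq nat -> R) (n : nat).

Lemma schur_rev lam a : is_part lam -> schur R lam a = (skew_kostka_rev lam [::] a)%:R.
Proof.
by move=> hl; rewrite /schur /skew_schur (@skew_kostka_sym _ _ _ a) // filter_rev perm_rev.
Qed.

Lemma lexle_trans : transitive lexle. Proof. by move=> y x z; apply: le_trans. Qed.
Lemma lexle_total : total lexle. Proof. by move=> x y; apply: le_total. Qed.
Lemma lexle_anti x y : lexle x y -> lexle y x -> x = y.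
Proof. by move=> h1 h2; apply: (@le_anti _ (seqlexi nat)); apply/andP. Qed.

Lemma kostka_tri lam mu n : lam \in parts n -> mu \in parts n -> ~~ lexle mu lam -> schur R lam mu = 0.
Proof.
move=> /partsP[hl sl] /partsP[hm sm] hx; rewrite schur_rev //.
case: (posnP (skew_kostka_rev lam [::] mu)) => [-> //|/(kostka_lex hl hm) h].
by rewrite h ?sm ?sl in hx.
Qed.

Definition sparts n := sort lexle (parts n).

Lemma mem_sparts n mu : (mu \in sparts n) = (mu \in parts n). Proof. exact: mem_sort. Qed.

Lemma sparts_pairwise n : pairwise (fun lam mu => schur R lam mu == 0) (sparts n).
Proof.
have h : pairwise (fun x y => lexle x y && (x != y)) (sparts n).
  have : pairwise lexle (sparts n).
    by rewrite -(sorted_pairwise lexle_trans) sort_sorted //; exact: lexle_total.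
  have : uniq (sparts n) by rewrite sort_uniq uniq_parts.
  rewrite uniq_pairwise => h1 h2; rewrite pairwise_relI h2 /=.
  exact: h1.
apply: (sub_in_pairwise (P := mem (parts n))) h => [x y hx hy /andP[h1 h2]|].
  apply/eqP; apply: (kostka_tri hx hy); apply/negP => h3.
  by rewrite (lexle_anti h1 h3) eqxx in h2.
by apply/allP => x; rewrite mem_sparts.
Qed.

Lemma rsparts_pairwise n : pairwise (fun lam mu => schur R mu lam == 0) (rev (sparts n)).
Proof. by rewrite pairwise_rev sparts_pairwise. Qed.

Lemma schur_diag lam : is_part lam -> schur R lam lam = 1.
Proof. by move=> hl; rewrite schur_rev // kostka_diag. Qed.

Lemma kostka_solve n (F : seq nat -> R) :
  exists c, forall mu, mu \in parts n -> \sum_(lam <- parts n) c lam * schur R lam mu = F mu.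
Proof.
have [c hc] := tri_solve F (etrans (sort_uniq _ _) (uniq_parts n)) (sparts_pairwise n)
  (fun x hx => schur_diag (proj1 (partsP _ _ (etrans (esym (mem_sort _ _ x)) hx)))).
exists c => mu hm; rewrite -hc ?mem_sparts //.
by apply: perm_big; rewrite perm_sym; apply/permPl; apply: perm_sort.
Qed.

Lemma kostka_inj n c :
  (forall mu, mu \in parts n -> \sum_(lam <- parts n) c lam * schur R lam mu = 0) ->
  forall lam, lam \in parts n -> c lam = 0.
Proof.
move=> h lam hl; apply: (tri_inj (etrans (sort_uniq _ _) (uniq_parts n)) (sparts_pairwise n)
  (fun x hx => schur_diag (proj1 (partsP _ _ (etrans (esym (mem_sort _ _ x)) hx))))).
  move=> y; rewrite mem_sparts => hy; apply: etrans (h _ hy).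
  by apply: perm_big; apply/permPl; apply: perm_sort.
by rewrite mem_sparts.
Qed.

(** The transposed system; its solutions will express Schur functions through products of complete
    functions. *)
Lemma kostka_solve_tr n (F : seq nat -> R) :
  exists x, forall lam, lam \in parts n -> \sum_(b <- parts n) x b * schur R lam b = F lam.
Proof.
have hu : uniq (rev (sparts n)) by rewrite rev_uniq sort_uniq uniq_parts.
have [c hc] := @tri_solve _ _ (fun b lam => schur R lam b) _ F hu (rsparts_pairwise n)
  (fun x hx => schur_diag (proj1 (partsP _ _ (etrans (esym (mem_sort _ _ x)) (etrans (esym (mem_rev _ _)) hx))))).
exists c => lam hl; rewrite -hc ?mem_rev ?mem_sparts //.
by apply: perm_big; rewrite perm_sym perm_rev; apply/permPl; apply: perm_sort.
Qed.

Definition part_of a := sort geq [seq x <- a | (0 < x)%N].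

Lemma part_ofP a : part_of a \in parts (sumn a).
Proof.
apply/partsP; split; last first.
  rewrite -[RHS]sumn_filter_pos !sumnE; apply: perm_big; apply/permPl; exact: perm_sort.
apply/andP; split; first by apply: sort_sorted => x y /=; apply: leq_total.
by rewrite /part_of all_sort filter_all.
Qed.

Lemma sym_part_of F a : is_sym F -> F a = F (part_of a).
Proof.
move=> h; apply: h; rewrite /part_of perm_sym.
by rewrite (perm_trans (perm_filter _ (permEl (perm_sort _ _)))) // filter_id.
Qed.

Lemma is_sym_schur lam : is_part lam -> is_sym (schur R lam). Proof. exact: is_sym_skew. Qed.

Lemma sym_exp F : is_sym F -> exists c, schur_expansion F c.
Proof.
move=> hF; have /boolp.choice [c hc] : forall n, exists c, forall mu, mu \in parts n ->
    \sum_(lam <- parts n) c lam * schur R lam mu = F mu by move=> n; apply: kostka_solve.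
exists (fun lam => c (sumn lam) lam) => a.
rewrite (sym_part_of _ hF) -(hc (sumn a)) ?part_ofP //.
apply: eq_big_seq => lam /partsP[hl hs]; rewrite hs; congr (_ * _).
by rewrite -sym_part_of //; apply: is_sym_schur.
Qed.

(** [hall_schur] is an arbitrary choice; the existence of an expansion makes it a genuine one, and
    [hall_eq] shows that it is determined degree by degree. *)
Lemma hallE F : is_sym F -> schur_expansion F (hall_schur F).
Proof. by move=> hF; apply: (epsilon_spec _ (schur_expansion F) (sym_exp hF)). Qed.

Lemma hall_eq F c n : is_sym F ->
  (forall a, sumn a = n -> F a = \sum_(lam <- parts n) c lam * schur R lam a) ->
  forall mu, mu \in parts n -> hall_schur F mu = c mu.
Proof.
move=> hF hc mu hm; apply/eqP; rewrite -subr_eq0; apply/eqP.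
apply: (kostka_inj (c := fun mu => hall_schur F mu - c mu)) hm => nu /partsP[_ hs].
under eq_bigr do rewrite mulrBl.
by rewrite big_split /= sumrN -hc // -[in X in X - _]hs -hallE // subrr.
Qed.

Lemma hall_ext F G n : is_sym F -> is_sym G -> (forall a, sumn a = n -> F a = G a) ->
  forall mu, mu \in parts n -> hall_schur F mu = hall_schur G mu.
Proof. by move=> hF hG h; apply: hall_eq => // a ha; rewrite h // -ha hallE. Qed.

Lemma hall_sum (I : eqType) (r : seq I) (P : pred I) (x : I -> R) (FF : I -> sring R) mu :
  (forall i, i \in r -> is_sym (FF i)) -> is_part mu ->
  hall_schur (\sum_(i <- r | P i) sC (x i) * FF i) mu =
  \sum_(i <- r | P i) x i * hall_schur (FF i) mu.
Proof.
move=> hs hm; have hm' : mu \in parts (sumn mu) by apply/partsP.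
apply: (hall_eq (c := fun mu => \sum_(i <- r | P i) x i * hall_schur (FF i) mu)) hm' => [|a ha].
  by apply: is_sym_sum => i hi _; apply: is_symM; [exact: is_symC | exact: hs].
rewrite ser_sum; under [RHS]eq_bigr do rewrite mulr_suml.
rewrite [RHS]exchange_big /= big_seq_cond [RHS]big_seq_cond; apply: eq_bigr => i /andP[hi _].
rewrite serCM (hallE (hs i hi)) mulr_sumr ha; apply: eq_bigr => lam _; by rewrite mulrA.
Qed.

Lemma hallD F G mu : is_sym F -> is_sym G -> is_part mu ->
  hall_schur (F + G) mu = hall_schur F mu + hall_schur G mu.
Proof.
move=> hF hG hm.
have /(_ xpredT (fun=> 1) id mu) := @hall_sum _ [:: F; G].
rewrite !big_cons !big_nil !addr0 !mul1r /= => <- //.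
  have e1 H : sC 1 * H = H by apply: funext => a; rewrite serCM mul1r.
  by rewrite !e1.
by move=> i; rewrite !inE => /orP[] /eqP->.
Qed.

Lemma hallC x F mu : is_sym F -> is_part mu -> hall_schur (sC x * F) mu = x * hall_schur F mu.
Proof.
move=> hF hm; have /(_ xpredT (fun=> x) id mu) := @hall_sum _ [:: F].
by rewrite !big_cons !big_nil !addr0 => <- // i; rewrite inE => /eqP->.
Qed.

Lemma hallN F mu : is_sym F -> is_part mu -> hall_schur (- F) mu = - hall_schur F mu.
Proof.
move=> hF hm; have -> : - F = sC (- 1) * F by apply: funext => a; rewrite serCM serN mulN1r.
by rewrite hallC // mulN1r.
Qed.

Lemma skew_deg lam mu a : is_part lam -> skew_schur R lam mu a != 0 -> (sumn a + sumn mu = sumn lam)%N.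
Proof.
move=> hl; rewrite pnatr_eq0 -(sumn_rev a) -lt0n; elim: (rev a) lam hl => [|k r IH] nu hn.
  by rewrite /=; case: eqP => // ->.
rewrite skew_kostka_cons lt0n sum_nat_seq_neq0 => /hasP[rho].
rewrite mem_strips // => /and3P[hr _ /eqP <-] /=; rewrite -lt0n => /(IH _ hr) <-.
by rewrite [RHS]addnC addnA.
Qed.

Lemma hall_schurE lam mu : is_part lam -> is_part mu -> hall_schur (schur R lam) mu = (lam == mu)%:R.
Proof.
move=> hl hm; have hm' : mu \in parts (sumn mu) by apply/partsP.
apply: (hall_eq (c := fun mu => (lam == mu)%:R)) hm'; first exact: is_sym_schur.
move=> a ha; have [hin|hout] := boolP (lam \in parts (sumn mu)).
  rewrite (bigD1_seq lam) ?uniq_parts //= eqxx mul1r big1 ?addr0 // => x hx.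
  by rewrite eq_sym (negbTE hx) mul0r.
rewrite big1_seq => [|x /andP[_ hx]]; last first.
  have [e|_] := eqVneq lam x; last by rewrite mul0r.
  by rewrite e hx in hout.
have hd : sumn lam != sumn a by move: hout; rewrite mem_parts hl ha.
by apply/eqP; apply: contraNT hd => /(skew_deg hl) /=; rewrite addn0 => ->.
Qed.

End Hall.

(** * Skewing as the adjoint of multiplication *)

Section Adjoint.
Variable R : realType.
Implicit Types (F G K P : sring R) (a b lam mu nu theta : seq nat).

(** The end of the reversed word is the smallest letter, whose cells form a horizontal strip added
    to mu. Thus [skew_cons] peels the first variable off the inner shape, while [T_skew] peels it
    off the outer one. *)
Lemma skew_kostka_rcons lam mu r k : is_part lam -> is_part mu ->
  skew_kostka_rev lam mu (rcons r k) = (\sum_(nu <- ups mu k) skew_kostka_rev lam nu r)%N.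
Proof.
move=> hl hm; elim: r lam hl => [|x r IH] lam hl.
  rewrite skew_kostka_cons /=.
  have h1 (s : seq (seq nat)) (z : seq nat) : uniq s -> (\sum_(y <- s) (y == z) = (z \in s))%N.
    move=> hu; have [hz|hz] := boolP (z \in s).
      by rewrite (bigD1_seq z) //= eqxx big1 ?addn0 // => y /negbTE ->.
    by rewrite big1_seq // => y /andP[_ hy]; case: eqP => // e; rewrite -e hy in hz.
  under [RHS]eq_bigr do rewrite eq_sym.
  rewrite h1 ?uniq_strips // h1 ?uniq_ups // mem_strips // mem_ups hm hl.
  by rewrite /= andbC.
rewrite rcons_cons skew_kostka_cons.
under [RHS]eq_bigr do rewrite skew_kostka_cons.
rewrite [RHS]exchange_big /=; apply: eq_big_seq => rho.
by rewrite mem_strips // => /andP[hr _]; rewrite IH.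
Qed.

Lemma skew_cons lam mu k b : is_part lam -> is_part mu ->
  skew_schur R lam mu (k :: b) = \sum_(nu <- ups mu k) skew_schur R lam nu b.
Proof. by move=> hl hm; rewrite /skew_schur rev_cons skew_kostka_rcons // natr_sum. Qed.

Lemma hprod_cons k b : (hprod R (k :: b) : sring R) = (hser R k : sring R) * hprod R b.
Proof. by []. Qed.

Lemma is_sym_hprod b : is_sym (hprod R b).
Proof.
elim: b => [|k b IH]; first exact: is_sym1.
by rewrite hprod_cons; apply: is_symM => //; apply: is_sym_hser.
Qed.

Lemma hall_schur_hprod mu b lam : is_part mu -> is_part lam ->
  hall_schur ((schur R mu : sring R) * hprod R b) lam = skew_schur R lam mu b.
Proof.
move=> hm hl; elim: b mu hm => [|k b IH] mu hm.
  by rewrite mulr1 hall_schurE // /skew_schur /= eq_sym.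
rewrite hprod_cons mulrA [X in X * _]mulrC pieri // mulr_suml skew_cons //.
have e : \sum_(nu <- ups mu k) (schur R nu : sring R) * hprod R b =
  \sum_(nu <- ups mu k) sC 1 * ((schur R nu : sring R) * hprod R b).
  by apply: eq_bigr => nu _; apply: funext => a; rewrite serCM mul1r.
rewrite e hall_sum // => [|nu]; last first.
  by rewrite mem_ups => /andP[hn _]; apply: is_symM; [apply: is_sym_schur | apply: is_sym_hprod].
apply: eq_big_seq => nu; rewrite mem_ups => /andP[hn _].
by rewrite mul1r IH.
Qed.

Lemma schur_nil : (schur R [::] : sring R) = 1.
Proof.
apply: funext => a; rewrite ser1; have [h|h] := eqVneq (sumn a) 0%N; last first.
  by apply/eqP; apply: contraNT h => /(skew_deg part_nil) /=; rewrite addn0 => ->.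
rewrite (sym_part_of a (is_sym_schur R part_nil)).
by have := part_ofP a; rewrite h parts0 inE => /eqP ->.
Qed.

(** The Cauchy identity: both sides are the coefficient of x^a y^b in prod 1/(1 - x_i y_j). *)
Lemma hprodE b a : hprod R b a = \sum_(lam <- parts (sumn a)) schur R lam b * schur R lam a.
Proof.
rewrite (hallE (is_sym_hprod b)); apply: eq_big_seq => lam /partsP[hl _].
by rewrite [schur R lam b]/schur -(hall_schur_hprod b part_nil hl) schur_nil mul1r.
Qed.

Lemma schur_deg lam a : is_part lam -> sumn a <> sumn lam -> schur R lam a = 0.
Proof.
by move=> hl hd; apply/eqP; apply: contra_notT hd => /(skew_deg hl) /=; rewrite addn0.
Qed.

Lemma hprod_deg b a : sumn a <> sumn b -> hprod R b a = 0.
Proof.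
move=> hd; rewrite hprodE big1_seq // => lam /andP[_ /partsP[hl hs]].
by rewrite (schur_deg (a := b)) ?mul0r // => e; apply: hd; rewrite -hs -e.
Qed.

Lemma hprodC b a : hprod R b a = hprod R a b.
Proof.
have [e|/eqP ne] := eqVneq (sumn a) (sumn b); last by rewrite !hprod_deg // => /esym.
by rewrite !hprodE e; apply: eq_bigr => lam _; rewrite mulrC.
Qed.

(** The inverse Kostka coefficients x serve twice: they expand s_nu in the h_b, and they are dual to
    the Kostka numbers, so that pairing with s_nu becomes F |-> sum_b x_b F[b]. *)
Lemma schur_hprod nu : is_part nu ->
  exists x, (schur R nu : sring R) = \sum_(b <- parts (sumn nu)) sC (x b) * hprod R b /\
    forall tau, tau \in parts (sumn nu) ->
      \sum_(b <- parts (sumn nu)) x b * schur R tau b = (tau == nu)%:R.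
Proof.
move=> hn; have [x hx] := kostka_solve_tr (sumn nu) (fun tau => (tau == nu)%:R : R).
exists x; split => //; apply: funext => a; rewrite ser_sum.
have [e|/eqP ne] := eqVneq (sumn a) (sumn nu); last first.
  rewrite schur_deg // big1_seq // => b /andP[_ /partsP[_ hb]].
  by rewrite serCM hprod_deg ?mulr0 // hb.
under eq_bigr do rewrite serCM hprodE mulr_sumr e.
rewrite exchange_big /= (bigD1_seq nu) ?uniq_parts //=; last by apply/partsP.
rewrite [X in _ = _ + X]big1_seq ?addr0 => [|tau /andP[ht hin]].
  under eq_bigr do rewrite mulrA.
  by rewrite -mulr_suml hx ?eqxx ?mul1r //; apply/partsP.
under eq_bigr do rewrite mulrA.
by rewrite -mulr_suml hx // (negbTE ht) mul0r.
Qed.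

Lemma hall_schurM theta nu lam : is_part theta -> is_part nu -> is_part lam ->
  hall_schur ((schur R theta : sring R) * schur R nu) lam = hall_schur (skew_schur R lam theta) nu.
Proof.
move=> ht hn hl; have [x [-> hx]] := schur_hprod hn.
rewrite mulr_sumr; under eq_bigr do rewrite mulrCA.
rewrite hall_sum // => [|b _]; last first.
  by apply: is_symM; [apply: is_sym_schur | apply: is_sym_hprod].
under eq_big_seq => b /partsP[_ hb].
  rewrite hall_schur_hprod // (hallE (is_sym_skew R theta hl)) mulr_sumr hb.
  over.
rewrite exchange_big /= (bigD1_seq nu) ?uniq_parts //=; last by apply/partsP.
rewrite [X in _ + X]big1_seq ?addr0 => [|tau /andP[htau hin]].
  under eq_bigr do rewrite mulrCA.
  by rewrite -mulr_sumr hx ?eqxx ?mulr1 //; apply/partsP.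
under eq_bigr do rewrite mulrCA.
by rewrite -mulr_sumr hx // (negbTE htau) mulr0.
Qed.

Lemma serM_ext n F F' G : (forall b, (sumn b <= n)%N -> F b = F' b) ->
  forall a, (sumn a <= n)%N -> (F * G) a = (F' * G) a.
Proof.
move=> h a; elim: a n F F' G h => [|x a IH] n F F' G h hn; first by rewrite !serM_nil h.
rewrite !serM_cons; apply: eq_bigr => y _; apply: (IH (n - y)%N).
  by move=> b hb; apply: h; move: hn (ltn_ord y) => /=; lia.
by move: hn (ltn_ord y) => /=; lia.
Qed.

Definition schur_trunc (n : nat) F : sring R :=
  \sum_(k < n.+1) \sum_(mu <- parts k) sC (hall_schur F mu) * schur R mu.

Lemma schur_truncE n F a : is_sym F -> (sumn a <= n)%N -> schur_trunc n F a = F a.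
Proof.
move=> hF ha; rewrite /schur_trunc ser_sum (bigD1 (inord (sumn a))) //= [X in _ + X]big1 ?addr0 => [|k hk].
  by rewrite inordK // ser_sum (hallE hF); apply: eq_bigr => mu _; rewrite serCM.
rewrite ser_sum big1_seq // => mu /andP[_ /partsP[hm hs]].
rewrite serCM schur_deg ?mulr0 // => e; move: hk => /eqP; apply; apply: val_inj.
by rewrite /= inordK // e hs.
Qed.

(** Only the part of F of degree at most |lam| can reach s_lam, so F may be replaced by a finite
    Schur sum. *)
Lemma hallM F G lam : is_sym F -> is_sym G -> is_part lam ->
  hall_schur (F * G) lam =
  \sum_(n < (sumn lam).+1) \sum_(mu <- parts n) hall_schur F mu * hall_schur ((schur R mu : sring R) * G) lam.
Proof.
move=> hF hG hl.
have hs k mu : mu \in parts k -> is_sym ((schur R mu : sring R) * G).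
  by move=> /partsP[hm _]; apply: is_symM => //; apply: is_sym_schur.
have hs2 k : is_sym (\sum_(mu <- parts k) sC (hall_schur F mu) * ((schur R mu : sring R) * G)).
  by apply: is_sym_sum => mu hm _; apply: is_symM; [exact: is_symC | exact: hs hm].
have e : schur_trunc (sumn lam) F * G = \sum_(n < (sumn lam).+1)
    sC 1 * (\sum_(mu <- parts n) sC (hall_schur F mu) * ((schur R mu : sring R) * G)).
  rewrite /schur_trunc mulr_suml; apply: eq_bigr => n _; rewrite mulr_suml; apply: funext => a.
  rewrite serCM mul1r !ser_sum; apply: eq_bigr => mu _; by rewrite mulrA.
rewrite (@hall_ext _ _ (schur_trunc (sumn lam) F * G) (sumn lam)); [|exact: is_symM| | |exact/partsP].
- rewrite e hall_sum //.
  by apply: eq_bigr => n _; rewrite mul1r hall_sum // => mu hm; apply: hs hm.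
- by rewrite e; apply: is_sym_sum => n _ _; apply: is_symM => //; exact: is_symC.
- move=> a ha; apply: (@serM_ext (sumn lam)); last by rewrite ha.
  by move=> b hb; rewrite schur_truncE.
Qed.

Lemma perp_schurE F lam : (perp_schur F lam : sring R) =
  \sum_(n < (sumn lam).+1) \sum_(mu <- parts n) sC (hall_schur F mu) * skew_schur R lam mu.
Proof.
apply: funext => a; rewrite ser_sum; apply: eq_bigr => n _; rewrite ser_sum.
by apply: eq_bigr => mu _; rewrite serCM.
Qed.

Lemma hall_perp F lam nu : is_sym F -> is_part lam -> is_part nu ->
  hall_schur (perp_schur F lam) nu = hall_schur (F * schur R nu) lam.
Proof.
move=> hF hl hn; rewrite hallM //; last exact: is_sym_schur.
have hs2 k : is_sym (\sum_(mu <- parts k) sC (hall_schur F mu) * skew_schur R lam mu).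
  by apply: is_sym_sum => mu hm _; apply: is_symM; [exact: is_symC | exact: is_sym_skew].
have -> : (perp_schur F lam : sring R) = \sum_(n < (sumn lam).+1)
   sC 1 * \sum_(mu <- parts n) sC (hall_schur F mu) * skew_schur R lam mu.
  rewrite perp_schurE; apply: eq_bigr => n _; apply: funext => a; by rewrite serCM mul1r.
rewrite hall_sum //; apply: eq_bigr => n _; rewrite mul1r hall_sum => [|mu _|//]; last exact: is_sym_skew.
by apply: eq_big_seq => mu /partsP[hm _]; rewrite hall_schurM.
Qed.

(** The definition of [sp] has the form of the left side with F = P, so this identifies sp_mu with
    P^perp s_mu. *)
Lemma hall_hprodM F lam b : is_sym F -> is_part lam ->
  hall_schur (F * hprod R b) lam = perp_schur F lam b.
Proof.
move=> hF hl; rewrite hallM //; last exact: is_sym_hprod.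
by apply: eq_bigr => n _; apply: eq_big_seq => mu /partsP[hm _]; rewrite hall_schur_hprod.
Qed.

(** Adjointness against an arbitrary symmetric G. With G = P h_b it composes kappa_p^perp with the
    passage from s_nu to sp_nu. *)
Lemma sum_perp_hall F G lam : is_sym F -> is_sym G -> is_part lam ->
  \sum_(n < (sumn lam).+1) \sum_(nu <- parts n) hall_schur (perp_schur F lam) nu * hall_schur G nu
  = hall_schur (F * G) lam.
Proof.
move=> hF hG hl; rewrite [F * G]mulrC hallM //.
apply: eq_bigr => n _; apply: eq_big_seq => nu /partsP[hn _].
by rewrite hall_perp // [LHS]mulrC; congr (_ * hall_schur _ _); apply: (mulrC (F : sring R)).
Qed.

Definition contained nu lam := forall i, (nth 0%N nu i <= nth 0%N lam i)%N.

Lemma skew_contained lam mu a : is_part lam -> skew_schur R lam mu a != 0 -> contained mu lam.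
Proof.
move=> hl; rewrite pnatr_eq0 -lt0n; elim: (rev a) lam hl => [|k r IH] lam hl.
  by rewrite /=; case: eqP => // -> _ i.
rewrite skew_kostka_cons lt0n sum_nat_seq_neq0 => /hasP[rho].
rewrite mem_strips // => /and3P[hr /hsP h _] /=; rewrite -lt0n => /(IH _ hr) hc i.
by apply: leq_trans (hc i) _; case/andP: (h i).
Qed.

(** After expanding F in Schur functions and these in the h_b, every coefficient is a value of
    s_{lam/nu}, which is 0 unless nu lies inside lam. *)
Lemma hall_contained F nu lam : is_sym F -> is_part lam -> is_part nu ->
  hall_schur (F * schur R nu) lam != 0 -> contained nu lam.
Proof.
move=> hF hl hn h; apply: contrapT => hc.
have hz b : skew_schur R lam nu b = 0.
  by apply/eqP; apply: contra_notT hc => /(skew_contained hl).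
move/eqP: h; apply; rewrite hallM //; last exact: is_sym_schur.
rewrite big1 // => n _; rewrite big1_seq // => mu /andP[_ /partsP[hm _]].
rewrite [(schur R mu : sring R) * _]mulrC; have [x [-> _]] := schur_hprod hm.
rewrite mulr_sumr; under eq_bigr do rewrite mulrCA.
rewrite hall_sum // => [|b _]; last first.
  by apply: is_symM; [apply: is_sym_schur | apply: is_sym_hprod].
by rewrite big1 ?mulr0 // => b _; rewrite hall_schur_hprod // hz mulr0.
Qed.

Lemma hall_nil F : is_sym F -> hall_schur F [::] = F [::].
Proof. by move=> hF; rewrite [RHS](hallE hF) /= big_seq1 /schur /skew_schur /= mulr1. Qed.

Lemma hall0 lam : is_part lam -> hall_schur (0 : sring R) lam = 0.
Proof.
move=> hl; have h : is_sym (0 : sring R) by [].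
apply: (hall_eq (c := fun=> 0) h (n := sumn lam)); last exact/partsP.
by move=> a _; rewrite big1 // => mu _; rewrite mul0r.
Qed.

Lemma hall_skew_deg lam mu nu : is_part lam -> is_part nu ->
  (sumn nu + sumn mu <> sumn lam)%N -> hall_schur (skew_schur R lam mu) nu = 0.
Proof.
move=> hl hn h; rewrite -(hall0 hn); apply: (@hall_ext _ _ _ (sumn nu)); [exact: is_sym_skew|by [] | |exact/partsP].
by move=> a ha; apply/eqP; apply: contra_notT h => /(skew_deg hl) <-; rewrite ha.
Qed.

Lemma hall_perp_diag F lam : is_sym F -> is_part lam ->
  hall_schur (perp_schur F lam) lam = F [::].
Proof.
move=> hF hl; rewrite hall_perp // hallM //; last exact: is_sym_schur.
rewrite big_ord_recl [X in _ + X]big1 => [|n _].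
  by rewrite /= big_seq1 hall_nil // schur_nil mul1r hall_schurE // eqxx mulr1 addr0.
rewrite big1_seq // => mu /andP[_ /partsP[hm hs]].
by rewrite hall_schurM // hall_skew_deg ?mulr0 //; rewrite hs /= /bump; lia.
Qed.

Lemma contained_dom nu lam : is_part nu -> contained nu lam -> dom_le nu lam.
Proof.
move=> hn h; apply/allP => k _; elim: k nu lam {hn} h => [|k IH] nu lam h; first by rewrite !take0.
case: nu lam h => [|x nu] [|y lam] h //=.
  have := h 0%N => /=; rewrite leqn0 => /eqP ->; rewrite add0n.
  by have := IH nu [::]; rewrite /=; apply=> i; have := h i.+1; rewrite !nth_nil.
apply: leq_add; first exact: (h 0%N).
by apply: IH => i; apply: (h i.+1).
Qed.

End Adjoint.

(** * The series kappa_p *)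

Section GraphEmbedding.
Variables (R : realType) (k l : nat) (io : 'I_k -> 'I_l) (d : 'I_k -> nat) (d' : 'I_l -> nat).
Hypotheses (io_inj : injective io) (hd : forall i, d' (io i) = d i)
  (hd0 : forall j, d' j != 0%N -> exists i, io i = j).

Let inc (n : nat) (E : {set 'I_n * 'I_n}) := [forall e in E, (e.1 < e.2)%N].
Let dg (n : nat) (E : {set 'I_n * 'I_n}) (i : 'I_n) := [set e in E | (e.1 == i) || (e.2 == i)].
(** The injection of vertices need not preserve their order, so the image of an edge is reoriented
    to stay increasing. *)
Let m (e : 'I_k * 'I_k) : 'I_l * 'I_l :=
  if (io e.1 < io e.2)%N then (io e.1, io e.2) else (io e.2, io e.1).

Let m_inc (e : 'I_k * 'I_k) : (e.1 < e.2)%N -> ((m e).1 < (m e).2)%N.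
Proof.
move=> h; rewrite /m; case: ifP => //= /negbT; rewrite -leqNgt => h2; rewrite ltn_neqAle h2 andbT.
by apply: contraTneq h => /val_inj /io_inj ->; rewrite ltnn.
Qed.

Let m_inj (e f : 'I_k * 'I_k) : (e.1 < e.2)%N -> (f.1 < f.2)%N -> m e = m f -> e = f.
Proof.
case: e f => [e1 e2] [f1 f2] /= he hf; rewrite /m /=.
by case: ifP => _; case: ifP => _ [] /io_inj h1 /io_inj h2; subst => //; lia.
Qed.

Let m_deg (e : 'I_k * 'I_k) i : ((m e).1 == io i) || ((m e).2 == io i) = (e.1 == i) || (e.2 == i).
Proof. by rewrite /m; case: ifP => _ /=; rewrite !(inj_eq io_inj) // orbC. Qed.

Let m_deg0 (e : 'I_k * 'I_k) j : (forall i, io i <> j) -> ((m e).1 == j) || ((m e).2 == j) = false.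
Proof.
by move=> h; rewrite /m; case: ifP => _ /=; apply/negbTE; rewrite negb_or;
  apply/andP; split; apply/eqP; apply: h.
Qed.

Let card_m (E : {set 'I_k * 'I_k}) : inc E -> #|m @: E| = #|E|.
Proof.
move=> /forall_inP h; apply: card_in_imset => e f he hf; apply: m_inj; exact: h.
Qed.

Let dg_m (E : {set 'I_k * 'I_k}) i : inc E -> #|dg (m @: E) (io i)| = #|dg E i|.
Proof.
move=> hE; have -> : dg (m @: E) (io i) = m @: dg E i.
  apply/setP => f; rewrite inE; apply/andP/imsetP => [[/imsetP[e he ->]]|[e]].
    by rewrite m_deg => h; exists e => //; rewrite inE he.
  by rewrite inE => /andP[he h] ->; rewrite m_deg h imset_f.
apply: card_m; apply/forall_inP => e; rewrite inE => /andP[he _].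
by move/forall_inP: hE; apply.
Qed.

Let gsum (n : nat) (dd : 'I_n -> nat) : R :=
  \sum_(E : {set 'I_n * 'I_n} | inc E && [forall i, #|dg E i| == dd i]) (-1) ^+ #|E|.

(** Renumbering vertices or adding isolated ones does not change the signed count of graphs; this is
    what symmetry of P and invariance under padding by zeros require. *)
Lemma graph_sum_emb : gsum d = gsum d'.
Proof.
pose h' (E' : {set 'I_l * 'I_l}) := [set e : 'I_k * 'I_k | (e.1 < e.2)%N && (m e \in E')].
rewrite [RHS]/gsum (reindex_onto (fun E : {set 'I_k * 'I_k} => m @: E) h'); last first.
  move=> E' /andP[/forall_inP hi /forallP hg]; apply/setP => f; apply/imsetP/idP.
    by move=> [e]; rewrite inE => /andP[_ he] ->.
  move=> hf; have pos j : (f.1 == j) || (f.2 == j) -> exists i, io i = j.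
    move=> hj; apply: hd0; rewrite -(eqP (hg j)) -lt0n; apply/card_gt0P; exists f.
    by rewrite inE hf.
  have [u hu] : exists u, io u = f.1 by apply: pos; rewrite eqxx.
  have [v hv] : exists v, io v = f.2 by apply: pos; rewrite eqxx orbT.
  have hlt := hi f hf; have huv : u != v by apply: contraTneq hlt => e; rewrite -hu -hv e ltnn.
  case: (ltngtP u v) => huv'; last by rewrite (val_inj huv') eqxx in huv.
    have e : m (u, v) = f by rewrite /m /= hu hv hlt -surjective_pairing.
    by exists (u, v); rewrite ?e // inE /= huv' e.
  have e : m (v, u) = f by rewrite /m /= hu hv ltnNge ltnW //= -surjective_pairing.
  by exists (v, u); rewrite ?e // inE /= huv' e.
rewrite /gsum; apply: eq_big => [E|E /andP[hE _]]; last by rewrite card_m.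
have [hE|hE] := boolP (inc E); last first.
  apply/esym/negbTE; rewrite negb_and orbC; apply/orP; left.
  apply: contra hE => /eqP <-; apply/forall_inP => e; by rewrite inE => /andP[].
have -> : h' (m @: E) == E.
  apply/eqP/setP => e; rewrite inE; apply/andP/idP => [[he /imsetP[f hf hef]]|he].
    by rewrite (m_inj he _ hef) //; move/forall_inP: hE; apply.
  by split; [move/forall_inP: hE; apply | apply: imset_f].
have -> : inc (m @: E).
  apply/forall_inP => f /imsetP[e he ->]; apply: m_inc; by move/forall_inP: hE; apply.
rewrite /= andbT; apply/forallP/forallP => h j; last first.
  by have := h (io j); rewrite dg_m // hd.
have [hj|hj] := pselect (exists i, io i = j).
  by case: hj => i <-; rewrite dg_m // hd.
have -> : d' j = 0%N by apply/eqP; apply: contrapT => /negP /hd0.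
rewrite cards_eq0; apply/eqP/setP => f; rewrite !inE; apply/negbTE/negP => /andP[/imsetP[e _ ->]].
by rewrite m_deg0 // => i hi; apply: hj; exists i.
Qed.
End GraphEmbedding.

Section Kappa.
Variable R : realType.
Implicit Types (F G K : sring R) (a b : seq nat) (p : nat -> R).

Lemma Pser_emb a b (f : nat -> nat) :
  (forall i, (i < size a)%N -> (f i < size b)%N) ->
  (forall i j, (i < size a)%N -> (j < size a)%N -> f i = f j -> i = j) ->
  (forall i, (i < size a)%N -> nth 0%N b (f i) = nth 0%N a i) ->
  (forall j, (j < size b)%N -> nth 0%N b j != 0%N -> exists2 i, (i < size a)%N & f i = j) ->
  Pser R a = Pser R b.
Proof.
move=> h1 h2 h3 h4; pose io (i : 'I_(size a)) := Ordinal (h1 i (ltn_ord i)).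
apply: (@graph_sum_emb R (size a) (size b) io (fun i => nth 0%N a i) (fun i => nth 0%N b i)).
- by move=> i j /(congr1 val) hij; apply: val_inj; apply: (h2 _ _ (ltn_ord i) (ltn_ord j) hij).
- by move=> i; rewrite /io /= h3.
- move=> j hj; have [i hi hij] := h4 j (ltn_ord j) hj.
  by exists (Ordinal hi); apply: val_inj.
Qed.

Lemma is_sym_Pser : is_sym (Pser R).
Proof.
apply: sym_intro => s => [x y t|t].
  pose f i := if i == size s then (size s).+1 else if i == (size s).+1 then size s else i.
  have sz u v : size (s ++ u :: v :: t) = (size s + (size t).+2)%N by rewrite size_cat.
  have hf i : (i < size s + (size t).+2)%N -> (f i < size s + (size t).+2)%N by rewrite /f; case: ifP => _; [lia | case: ifP => _; lia].
  have ff i : f (f i) = i.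
    rewrite /f; have [->|h1] := eqVneq i (size s); first by rewrite eqxx ifF //; apply/eqP; lia.
    by have [->|h2] := eqVneq i (size s).+1; rewrite ?eqxx // (negbTE h1) (negbTE h2).
  have nf u v i : nth 0%N (s ++ v :: u :: t) (f i) = nth 0%N (s ++ u :: v :: t) i.
    rewrite /f !nth_cat; have [->|h1] := eqVneq i (size s); first by rewrite ltnn ltnNge leqnSn subSnn subnn.
    have [->|h2] := eqVneq i (size s).+1; first by rewrite ltnn ltnNge leqnSn subSnn subnn.
    case: ltnP => // h; have -> : (i - size s = (i - size s - 2).+2)%N by lia.
    by [].
  apply: (Pser_emb (f := f)) => [i|i j _ _ e|i _|j]; rewrite ?sz; first exact: hf.
  - by rewrite -(ff i) e ff.
  - exact: nf.
  - by move=> hj _; exists (f j); rewrite ?sz ?hf ?ff.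
pose f i := if (i < size s)%N then i else i.+1.
apply/esym; apply: (Pser_emb (f := f)) => [i|i j|i|j]; rewrite ?size_cat /=.
- by rewrite /f; case: ifP; lia.
- by move=> _ _; rewrite /f; do 2 case: ifP; lia.
- move=> hi; rewrite /f; case: (ltnP i (size s)) => h; rewrite !nth_cat; first by rewrite h.
  rewrite [X in _ = if X then _ else _]ltnNge h /=.
  by rewrite ltnNge leqW //= subSn.
- move=> hj; rewrite nth_cat; case: ltnP => h hn.
    by exists j; [lia | rewrite /f h].
  case: (ltngtP j (size s)) hn => [|h' _|->]; [lia| |by rewrite subnn].
  exists j.-1; first lia.
  by rewrite /f; case: ltnP; lia.
Qed.

Lemma Pser_nil : Pser R [::] = 1.
Proof.
rewrite /Pser (big_pred1 set0) ?cards0 // => E; apply/andP/eqP => [_|->].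
  by apply/setP => -[[]].
by split; apply/forallP => -[] // [].
Qed.

Lemma is_sym_pprod p : p 0%N = 1 -> is_sym (pprod p).
Proof.
move=> hp; have hf a : pprod p a = \prod_(x <- [seq x <- a | (0 < x)%N]) p x.
  rewrite big_filter [RHS]big_mkcond /=; apply: eq_bigr => x _.
  by case: posnP => // ->.
by move=> a b h; rewrite !hf; apply: perm_big.
Qed.

Lemma mem_subexps_sum a b : b \in subexps a -> (sumn b + sumn (sdiffexp a b))%N = sumn a.
Proof.
elim: a b => [|x a IH] b; first by rewrite inE => /eqP ->.
move=> /allpairsPdep [y [t [hy ht ->]]]; move: hy; rewrite mem_iota => hy.
by have := IH _ ht; rewrite /sdiffexp /=; lia.
Qed.

Definition order_ge n F := forall a, (sumn a < n)%N -> F a = 0.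

Lemma order_geM m n F G : order_ge m F -> order_ge n G -> order_ge (m + n) (F * G).
Proof.
move=> hF hG a ha; rewrite -[LHS]/(smul F G a) /smul big1_seq // => b /andP[_ /mem_subexps_sum hb].
case: (ltnP (sumn b) m) => h; first by rewrite hF ?mul0r.
by rewrite hG ?mulr0 //; lia.
Qed.

Lemma order_geX n F : order_ge 1 F -> order_ge n (F ^+ n).
Proof.
move=> hF; elim: n => [|n IH] //.
by rewrite exprS -add1n; apply: order_geM.
Qed.

(** The geometric series for 1/P, cut off at the degree of the monomial: (1 - P)^n has order at
    least n, so later terms contribute 0. *)
Definition Pinv : sring R := fun a => \sum_(n < (sumn a).+1) ((1 - (Pser R : sring R)) ^+ n) a.

Lemma sumn0_nil F a : is_sym F -> sumn a = 0%N -> F a = F [::].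
Proof.
move=> hF h; apply: hF; rewrite /= (_ : [seq x <- a | (0 < x)%N] = [::]) //.
by elim: a h => //= -[|x] a IH.
Qed.

Lemma order_ge_1P : order_ge 1 (1 - (Pser R : sring R)).
Proof.
move=> a; rewrite ltnS leqn0 => /eqP h.
by rewrite serB (sumn0_nil is_sym_Pser h) Pser_nil ser1 h eqxx subrr.
Qed.

Lemma PinvE N a : (sumn a <= N)%N -> Pinv a = (\sum_(n < N.+1) (1 - (Pser R : sring R)) ^+ n) a.
Proof.
move=> h; rewrite ser_sum /Pinv -(big_mkord xpredT (fun n => ((1 - (Pser R : sring R)) ^+ n) a)).
rewrite -(big_mkord xpredT (fun n => ((1 - (Pser R : sring R)) ^+ n) a)).
rewrite [RHS](big_cat_nat (n := (sumn a).+1)) //= [X in _ = _ + X]big_nat_cond.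
rewrite [X in _ = _ + X]big1 ?addr0 // => n /andP[/andP[hn _] _].
exact: (order_geX order_ge_1P).
Qed.

Lemma PserK : Pinv * (Pser R : sring R) = 1.
Proof.
apply: funext => a; rewrite (@serM_ext _ (sumn a) _ (\sum_(n < (sumn a).+1) (1 - (Pser R : sring R)) ^+ n)) //.
  have -> : (\sum_(n < (sumn a).+1) (1 - (Pser R : sring R)) ^+ n) * (Pser R : sring R) =
    1 - (1 - (Pser R : sring R)) ^+ (sumn a).+1.
    rewrite -[RHS]opprB subrX1 mulrC -mulNr; congr (_ * _); ring.
  by rewrite serB (order_geX order_ge_1P) ?subr0.
by move=> b hb; apply: PinvE.
Qed.

Lemma is_sym_Pinv : is_sym Pinv.
Proof.
move=> a b h; rewrite /Pinv (sumn_filter_perm h); apply: eq_bigr => n _.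
by apply: (is_symX n) h; apply: is_symB; [exact: is_sym1 | exact: is_sym_Pser].
Qed.

(** [kappa] is chosen among the solutions of K P = prod p(x_i). [Pinv] supplies one, and the
    invertibility of P makes it unique. *)
Lemma kappaP p : (kappa p : sring R) * Pser R = pprod p.
Proof.
apply: (epsilon_spec (inhabits (@szero R)) (fun K => smul K (Pser R) = pprod p)).
exists ((pprod p : sring R) * Pinv : sring R).
by rewrite -[LHS]/((pprod p : sring R) * Pinv * Pser R : sring R) -mulrA PserK mulr1.
Qed.

Lemma kappaE p : (kappa p : sring R) = (pprod p : sring R) * Pinv.
Proof. by rewrite -kappaP -mulrA [_ * Pinv]mulrC PserK mulr1. Qed.

Lemma is_sym_kappa p : p 0%N = 1 -> is_sym (kappa p).
Proof.
by move=> hp; rewrite kappaE; apply: is_symM; [exact: is_sym_pprod | exact: is_sym_Pinv].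
Qed.

Lemma kappa_nil p : kappa p [::] = 1.
Proof.
rewrite kappaE serM_nil /pprod big_nil mul1r /Pinv /= big_ord1 expr0 ser1 //.
Qed.

Lemma spE mu : is_part mu -> sp R mu = perp_schur (Pser R) mu.
Proof. by move=> hm; apply: funext => b; rewrite /sp -hall_hprodM //; apply: is_sym_Pser. Qed.

(** Skewing by kappa_p followed by s_nu |-> P^perp s_nu is skewing by kappa_p P, in which the
    denominator of kappa_p cancels. *)
Lemma fp_schurE p lam : p 0%N = 1 -> is_part lam -> fp_schur p lam = perp_schur (pprod p) lam.
Proof.
move=> hp hl; apply: funext => b; rewrite -hall_hprodM //; last exact: is_sym_pprod.
rewrite -kappaP -mulrA -sum_perp_hall //; first exact: is_sym_kappa.
by apply: is_symM; [exact: is_sym_Pser | exact: is_sym_hprod].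
Qed.

End Kappa.

(** * Positivity of the Littlewood-Richardson coefficients *)

Section Alternant.
Variable R : realType.
Variable N : nat.
Implicit Types (g : seq int) (w : seq nat).

(** The sign of g as a permutation of 0, ..., N-1, and 0 if it is none: the coefficient of x^g in
    the Vandermonde determinant. Entries are integers because subtracting exponents may make them
    negative. *)
Definition eps g : R := \det (\matrix_(i < N, j < N) (nth 0 g i == j%:Z)%:R).

Lemma eps_swap g g' t (ht : (t.+1 < N)%N) :
  (forall i, nth 0 g' i = nth 0 g (if i == t then t.+1 else if i == t.+1 then t else i)) ->
  eps g' = - eps g.
Proof.
move=> h; pose i1 : 'I_N := Ordinal (ltnW ht); pose i2 : 'I_N := Ordinal ht.
have hne : i1 != i2 by apply/eqP => /(congr1 val) /=; lia.
rewrite /eps -[RHS]mulN1r.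
have -> : - 1 = (-1) ^+ (tperm i1 i2 : bool) :> R by rewrite odd_tperm hne expr1.
rewrite -det_perm -det_mulmx -row_permE; congr (\det _); apply/matrixP => i j; rewrite !mxE h.
congr (((nth 0 g _ == _))%:R); rewrite permE /= -!val_eqE /=.
by case: ifP => // _; case: ifP.
Qed.

Lemma inc_bounds g : size g = N -> (forall i, (i.+1 < N)%N -> nth 0 g i < nth 0 g i.+1) ->
  (forall i, (i < N)%N -> 0 <= nth 0 g i < N%:Z) -> g = mkseq Posz N.
Proof.
move=> hs hi hb; have lo i : (i < N)%N -> i%:Z <= nth 0 g i.
  elim: i => [|i IH] h; first by case/andP: (hb 0%N h).
  by have := IH (ltnW h); have := hi i h; lia.
have hid k i : (i + k < N)%N -> nth 0 g i + k%:Z <= nth 0 g (i + k)%N.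
  elim: k => [|k IH] h; first by rewrite addn0; lia.
  have := IH (_ : (i + k < N)%N); have := hi (i + k)%N; rewrite addnS in h *.
  by move=> /(_ h) h1 /(_ (ltnW h)); lia.
apply: (@eq_from_nth _ 0) => [|i]; rewrite ?size_mkseq // hs => h.
rewrite nth_mkseq //; apply/eqP; rewrite eq_le lo // andbT.
have := hid (N - i.+1)%N i; have := hb N.-1; have -> : (i + (N - i.+1))%N = N.-1 by lia.
by move=> /(_ ltac:(lia)) h1 /(_ ltac:(lia)); lia.
Qed.

Lemma eps_inc g : size g = N -> (forall i, (i.+1 < N)%N -> nth 0 g i < nth 0 g i.+1) ->
  eps g = (g == mkseq Posz N)%:R.
Proof.
move=> hs hi; have [->|hne] := eqVneq.
  rewrite /eps (_ : \matrix_(_, _) _ = 1%:M) ?det1 //.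
  by apply/matrixP => i j; rewrite !mxE nth_mkseq.
apply/eqP; apply: contraNT hne => hd.
have [s hs'] : exists s : 'S_N, \prod_i (\matrix_(i < N, j < N) (nth 0 g i == j%:Z)%:R) i (s i) != 0 :> R.
  apply: contrapT => hn; move/eqP: hd; apply; rewrite /eps /determinant big1 // => s _.
  have -> : \prod_i (\matrix_(i < N, j < N) (nth 0 g i == j%:Z)%:R) i (s i) = 0 :> R.
    by apply/eqP; apply: contrapT => /negP h; apply: hn; exists s.
  by rewrite mulr0.
apply/eqP; apply: inc_bounds => // i h.
move/prodf_neq0: hs' => /(_ (Ordinal h) isT); rewrite mxE pnatr_eq0 eqb0 negbK /= => /eqP ->.
by have := ltn_ord (s (Ordinal h)); lia.
Qed.

Definition gsub g w : seq int := mkseq (fun t => nth 0 g t - (nth 0%N w t)%:Z) N.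

Lemma nth_gsub g w t : (t < N)%N -> nth 0 (gsub g w) t = nth 0 g t - (nth 0%N w t)%:Z.
Proof. by move=> h; rewrite nth_mkseq. Qed.

End Alternant.

(** * Alternating sums over chains of strips, column by column *)

Section ColumnRecursion.
Variable R : realType.
Implicit Types (lam mu nu rho tau w : seq nat) (phi : seq nat -> R) (vs ss bs : seq nat) (g : seq int).

Definition downs lam := [seq [seq x <- r | (0 < x)%N] | r <- interl lam].

Lemma perm_downs lam k : strips lam k = [seq rho <- downs lam | (sumn rho + k)%N == sumn lam].
Proof.
rewrite /strips /downs filter_map; congr map; apply: eq_filter => r /=.
by rewrite sumn_filter_pos.
Qed.

Lemma mem_downs lam rho : is_part lam -> (rho \in downs lam) = is_part rho && hs lam rho.
Proof.
move=> hl; apply/idP/andP => [h|[hr hh]].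
  have hle : (sumn rho <= sumn lam)%N.
    case/mapP: h => r hr ->; rewrite sumn_filter_pos.
    have := interl_nth hr hl; move: hr; rewrite mem_interl // => /andP[/eqP hsz _] hn.
    rewrite (sumn_nth (leqnn _)) (@sumn_nth lam (size r)) ?hsz //.
    by apply: leq_sum => i _; case/andP: (hn i).
  have : rho \in strips lam (sumn lam - sumn rho) by rewrite perm_downs mem_filter h andbT; lia.
  by rewrite mem_strips // => /and3P[].
have : rho \in strips lam (sumn lam - sumn rho).
  by rewrite mem_strips // hr hh /=; have := hs_sumn hh; lia.
by rewrite perm_downs mem_filter => /andP[].
Qed.

Lemma uniq_downs lam : is_part lam -> uniq (downs lam).
Proof.
move=> hl; rewrite map_inj_in_uniq ?uniq_interl // => r1 r2 h1 h2 heq.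
have hanti r : r \in interl lam -> forall i, (nth 0 r i.+1 <= nth 0 r i)%N.
  move=> hr i; have := interl_nth hr hl i; have := interl_nth hr hl i.+1; lia.
have hsz r : r \in interl lam -> size r = size lam by rewrite mem_interl // => /andP[/eqP].
apply: (@eq_from_nth _ 0%N); first by rewrite !hsz.
by move=> i _; rewrite -(nth_filter_pos i (hanti _ h1)) heq nth_filter_pos //; apply: hanti.
Qed.

(** The sum over chains of horizontal strips from lam down to mu, weighted by [phi] of the strip
    sizes, in which the successive partitions have at most vs_0, vs_1, ... rows. Removing the first
    column from every partition of a chain turns the heights of that column into the new row bounds,
    so the class of these sums is closed under this recursion. *)
Fixpoint Z vs lam mu phi : R :=
  match vs with
  | [::] => if lam == mu then phi [::] else 0
  | v :: vs' => \sum_(rho <- downs lam | (size rho <= v)%N)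
       Z vs' rho mu (fun w => phi ((sumn lam - sumn rho)%N :: w))
  end.

Lemma Z_ext vs lam mu phi phi' : (forall w, size w = size vs -> phi w = phi' w) ->
  Z vs lam mu phi = Z vs lam mu phi'.
Proof.
elim: vs lam phi phi' => [|v vs IH] lam phi phi' h /=; first by rewrite h.
by apply: eq_bigr => rho _; apply: IH => w hw; apply: h; rewrite /= hw.
Qed.

Lemma hs_size lam rho : is_part lam -> is_part rho -> hs lam rho ->
  (size rho <= size lam <= (size rho).+1)%N.
Proof.
move=> hl hr /hsP h; apply/andP; split; rewrite leqNgt -part_size //.
  by apply/negP => h1; have := h (size lam); rewrite [X in (_ <= _ <= X)%N]nth_default //; lia.
by apply/negP => h1; have := h (size rho); rewrite [X in (_ <= X <= _)%N]nth_default //; lia.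
Qed.

(* Reflecting the middle partition of [lam, rho, tau] exchanges two consecutive
   letters; the bound on [size rho] follows from the one on [size tau]. *)
Lemma Z_swap0 t vs lam mu phi : is_part lam -> (t.+1 < size vs)%N ->
  nth 0%N vs t = (nth 0%N vs t.+1).+1 ->
  (forall w1 x y w2, size w1 = t -> size (w1 ++ x :: y :: w2) = size vs ->
     phi (w1 ++ x :: y :: w2) = - phi (w1 ++ y :: x :: w2)) ->
  Z vs lam mu phi = 0.
Proof.
elim: t vs lam phi => [|t IH] [|v vs] lam phi //= hl; last first.
  move=> ht hv h; rewrite big1_seq // => rho /andP[_]; rewrite mem_downs // => /andP[hr _].
  apply: IH => // w1 x y w2 hw1 hw2; rewrite -!cat_cons h //=; first by rewrite hw1.
  by rewrite hw2.
case: vs => [|v' vs] // _ /= -> h.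
set S := (X in X = 0); suff : S = - S by lra.
pose f (p : seq nat * seq nat) := Z vs p.2 mu (fun w => phi [:: sumn lam - sumn p.1, sumn p.1 - sumn p.2 & w]%N).
pose L := [seq (x, y) | x <- downs lam, y <- [seq tau <- downs x | (size tau <= v')%N]].
have SE : S = \sum_(p <- L) f p.
  rewrite /L (big_allpairs_dep (h := fun x y : seq nat => (x, y))) /S [LHS]big_mkcond /=.
  apply: eq_big_seq => rho; rewrite mem_downs // => /andP[hr hh].
  case: leqP => hv; first by rewrite big_filter.
  rewrite big_filter big1_seq // => tau /andP[htau]; rewrite mem_downs // => /andP[ht hh'].
  by have := hs_size hr ht hh'; lia.
have uL : uniq L.
  apply: allpairs_uniq_dep; first exact: uniq_downs.
    by move=> x; rewrite mem_downs // => /andP[hx _]; rewrite filter_uniq // uniq_downs.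
  by move=> [x1 y1] [x2 y2] _ _ [-> ->].
pose F (p : seq nat * seq nat) := (refl lam p.2 p.1, p.2).
have memL p : p \in L -> [/\ is_part p.1, is_part p.2, hs lam p.1, hs p.1 p.2 & (size p.2 <= v')%N].
  move=> /allpairsPdep [x [y [hx hy ->]]] /=; move: hx hy.
  by rewrite mem_downs // mem_filter => /andP[hx1 hx2] /andP[hy]; rewrite mem_downs // => /andP[].
have hF p : p \in L -> F p \in L /\ F (F p) = p.
  move=> /memL; case: p => rho tau /= [hr ht h1 h2 h3].
  have [h4 h5] := refl_hs hl ht h1 h2; have h6 := refl_part hl ht h1 h2.
  split; last by rewrite /F /= reflK.
  apply/allpairsPdep; exists (refl lam tau rho), tau; split => //; first by rewrite mem_downs // h6.
  by rewrite mem_filter h3 mem_downs // ht.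
rewrite {1}SE -(perm_big _ (perm_map_bij uL uL hF hF)) big_map SE -sumrN.
apply: eq_big_seq => p /memL; case: p => rho tau /= [hr ht h1 h2 h3].
rewrite /f /=; have hsum := refl_sumn hl ht h1 h2.
have hle1 := hs_sumn h1; have hle2 := hs_sumn h2.
have -> : (sumn lam - sumn (refl lam tau rho) = sumn rho - sumn tau)%N by lia.
have -> : (sumn (refl lam tau rho) - sumn tau = sumn lam - sumn rho)%N by lia.
move: (_ - _)%N (_ - _)%N => x y.
have ZN vs0 lam0 (q : seq nat -> R) : Z vs0 lam0 mu (fun w => - q w) = - Z vs0 lam0 mu q.
  elim: vs0 lam0 q => [|v0 vs0 IHv] lam0 q /=; first by case: ifP; rewrite ?oppr0.
  by rewrite -sumrN; apply: eq_bigr => r _; rewrite IHv.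
rewrite -ZN; apply: Z_ext => w hw; by rewrite (h [::]) //= hw.
Qed.

Definition dcol lam := [seq x <- [seq y.-1 | y <- lam] | (0 < x)%N].
Definition addcol n rho := mkp (fun i => if (i < n)%N then (nth 0%N rho i).+1 else 0%N) n.

Lemma nth_dcol lam i : is_part lam -> nth 0%N (dcol lam) i = (nth 0%N lam i).-1.
Proof.
move=> hl; have hm k : nth 0%N [seq y.-1 | y <- lam] k = (nth 0%N lam k).-1.
  by case: (ltnP k (size lam)) => h; [rewrite (nth_map 0%N) | rewrite !nth_default ?size_map].
rewrite nth_filter_pos // => k; rewrite !hm; have := part_anti hl (leqnSn k); lia.
Qed.

Lemma dcol_part lam : is_part lam -> is_part (dcol lam).
Proof.
move=> hl; have hm k : nth 0%N [seq y.-1 | y <- lam] k = (nth 0%N lam k).-1.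
  by case: (ltnP k (size lam)) => h; [rewrite (nth_map 0%N) | rewrite !nth_default ?size_map].
by apply: filter_pos_part => k; rewrite !hm; have := part_anti hl (leqnSn k); lia.
Qed.

Lemma sumn_dcol lam : is_part lam -> (sumn (dcol lam) + size lam = sumn lam)%N.
Proof.
move=> /andP[_]; rewrite /dcol sumn_filter_pos; elim: lam => //= x lam IH /andP[hx hl].
by have := IH hl; lia.
Qed.

Lemma size_dcol lam : (size (dcol lam) <= size lam)%N.
Proof. by rewrite /dcol size_filter; apply: leq_trans (count_size _ _) _; rewrite size_map. Qed.

Lemma nth_addcol n rho i : is_part rho -> nth 0%N (addcol n rho) i = if (i < n)%N then (nth 0%N rho i).+1 else 0%N.
Proof.
move=> hr; apply: nth_mkp => {}i; last by rewrite ltnNge => ->.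
case: ifP; case: ifP => //; have := part_anti hr (leqnSn i); lia.
Qed.

Lemma addcol_part n rho : is_part rho -> is_part (addcol n rho).
Proof.
move=> hr; apply: mkp_part => i; last by rewrite ltnNge => ->.
case: ifP; case: ifP => //; have := part_anti hr (leqnSn i); lia.
Qed.

Lemma size_addcol n rho : is_part rho -> size (addcol n rho) = n.
Proof.
move=> hr; have h i : (i < size (addcol n rho))%N = (i < n)%N.
  by rewrite -part_size ?nth_addcol ?addcol_part //; case: ifP.
by have := h n; have := h (size (addcol n rho)); rewrite !ltnn; lia.
Qed.

Lemma dcol_addcol n rho : is_part rho -> (size rho <= n)%N -> dcol (addcol n rho) = rho.
Proof.
move=> hr hn; apply: part_ext => // [|i]; first exact/dcol_part/addcol_part.
rewrite nth_dcol ?addcol_part // nth_addcol //; case: ltnP => //= h.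
by rewrite nth_default //; apply: leq_trans h.
Qed.

Lemma addcol_dcol rho : is_part rho -> addcol (size rho) (dcol rho) = rho.
Proof.
move=> hr; apply: part_ext => // [|i]; first exact/addcol_part/dcol_part.
rewrite nth_addcol ?dcol_part // nth_dcol //; case: ltnP => //= h; last by rewrite nth_default.
by rewrite prednK // part_size.
Qed.

(** A horizontal strip takes b = 0 or 1 cell from the first column; in the other columns it is a
    horizontal strip whose result must not be taller than the new first column. *)
Lemma sum_downs_col (F : seq nat -> R) lam : is_part lam ->
  \sum_(rho <- downs lam) F rho =
  \sum_(b <- [:: 0; 1]%N | (b <= size lam)%N)
    \sum_(rho <- downs (dcol lam) | (size rho <= size lam - b)%N) F (addcol (size lam - b) rho).
Proof.
move=> hl; rewrite -[RHS]big_filter; under [RHS]eq_bigr do rewrite -big_filter.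
rewrite -(big_allpairs_dep (h := fun (x : nat) (y : seq nat) => (x, y))
  (F := fun p => F (addcol (size lam - p.1) p.2))).
set s2 := [seq (x, y) | x <- _, y <- _].
have hd := dcol_part hl.
have u2 : uniq s2.
  apply: allpairs_uniq_dep; first by rewrite filter_uniq.
    by move=> x _; rewrite filter_uniq // uniq_downs.
  by move=> [x1 y1] [x2 y2] _ _ [-> ->].
pose f (p : nat * seq nat) := addcol (size lam - p.1) p.2.
pose g rho := ((size lam - size rho)%N, dcol rho).
rewrite -[RHS](big_map f xpredT F); apply: perm_big; rewrite perm_sym.
apply: (perm_map_bij (g := g)) => //; first exact: uniq_downs.
  move=> p /allpairsPdep [b [rho [hb hr ->]]]; move: hb hr.
  rewrite !mem_filter !inE mem_downs // => /andP[hb1 hb2] /andP[hr1 /andP[hr2 /hsP hr3]].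
  rewrite /f /g /= dcol_addcol // size_addcol // mem_downs // addcol_part //=; split; last by congr pair; lia.
  apply/hsP => i; rewrite nth_addcol //; have := hr3 i; rewrite !nth_dcol //.
  have h1 := part_size i hl; have h2 := part_size i.+1 hl.
  case: ltnP => h3; last by move=> _; rewrite leq0n andbT leqn0 -leqn0 leqNgt h2 -leqNgt; move: hb2 => /orP[] /eqP e; lia.
  by move: h1 h2; have := part_anti hl (leqnSn i); case: (ltnP i (size lam)) => h4; case: (ltnP i.+1 (size lam)) => h5; lia.
move=> rho; rewrite mem_downs // => /andP[hr hh]; have hsz := hs_size hl hr hh.
rewrite /f /g /= subKn; last by case/andP: hsz.
split; last exact: addcol_dcol.
apply/allpairsPdep; eexists; eexists; split; last by reflexivity.
  by rewrite mem_filter !inE; move: hsz; lia.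
rewrite mem_filter subKn; last by case/andP: hsz.
rewrite size_dcol mem_downs // dcol_part //=; apply/hsP => i; rewrite !nth_dcol //.
by move/hsP: hh => /(_ i); lia.
Qed.

Fixpoint addl (u v : seq nat) : seq nat :=
  match u, v with x :: u', y :: v' => (x + y)%N :: addl u' v' | _, _ => [::] end.

Fixpoint bits n : seq (seq nat) :=
  if n is n'.+1 then [seq b :: bs | b <- [:: 0; 1]%N, bs <- bits n'] else [:: [::]].

Fixpoint sizes n bs : seq nat :=
  if bs is b :: bs' then (n - b)%N :: sizes (n - b)%N bs' else [::].

(** [n] is the current height of the first column and [n0] its final one; a bit 1 means that the
    strip takes a cell of that column. The heights must respect the old row bounds. *)
Fixpoint colok vs n n0 bs : bool :=
  match vs, bs with
  | v :: vs', b :: bs' => [&& (b <= n)%N, (n - b <= v)%N & colok vs' (n - b)%N n0 bs']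
  | [::], [::] => n == n0
  | _, _ => false
  end.

Lemma Z_col vs lam mu phi : is_part lam -> is_part mu ->
  Z vs lam mu phi = \sum_(bs <- bits (size vs) | colok vs (size lam) (size mu) bs)
     Z (sizes (size lam) bs) (dcol lam) (dcol mu) (fun w => phi (addl bs w)).
Proof.
move=> hl hm; elim: vs lam phi hl => [|v vs IH] lam phi hl.
  rewrite /= big_mkcond big_seq1 /=.
  have -> : (lam == mu) = (size lam == size mu) && (dcol lam == dcol mu).
    apply/eqP/andP => [->//|[/eqP h1 /eqP h2]].
    by rewrite -[lam]addcol_dcol // h1 h2 addcol_dcol.
  by case: eqP.
rewrite [LHS]/= big_mkcond sum_downs_col //.
rewrite -[bits _]/([seq b :: bs | b <- [:: 0; 1]%N, bs <- bits (size vs)]) [LHS]big_mkcond [RHS]big_mkcond.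
rewrite (big_allpairs_dep (h := fun (x : nat) (y : seq nat) => x :: y)).
apply: eq_bigr => b _ /=; case: (leqP b (size lam)) => hb /=; last by rewrite big1.
have hd := dcol_part hl.
case: (leqP (size lam - b)%N v) => hv /=; last first.
  rewrite [RHS]big1 // big1_seq // => rho; rewrite mem_downs // => /andP[_ /andP[hr _]].
  by rewrite size_addcol // leqNgt hv.
rewrite -[RHS]big_mkcond /= exchange_big /= big_seq_cond [RHS]big_seq_cond.
apply: eq_bigr => rho; rewrite mem_downs // => /andP[/andP[hr hh] hsz].
rewrite size_addcol // hv IH ?addcol_part // size_addcol // dcol_addcol //.
apply: eq_bigr => bs _; apply: Z_ext => w _ /=; congr (phi (_ :: _)).
have := sumn_dcol (addcol_part (size lam - b) hr); rewrite size_addcol // dcol_addcol // => <-.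
by rewrite -(sumn_dcol hl); have := hs_sumn hh; lia.
Qed.

Lemma bitsP n bs : bs \in bits n -> size bs = n /\ forall i, (nth 0%N bs i <= 1)%N.
Proof.
elim: n bs => [|n IH] bs; first by rewrite inE => /eqP ->; split => // i; rewrite nth_nil.
move=> /allpairsPdep [b [bs' [hb /IH [hs h] ->]]]; split; first by rewrite /= hs.
by case=> [|i] //=; move: hb; rewrite !inE => /orP[] /eqP->.
Qed.

Lemma uniq_bits n : uniq (bits n).
Proof.
elim: n => // n IH; apply: allpairs_uniq_dep => //.
by move=> [x1 y1] [x2 y2] _ _ [-> ->].
Qed.

Lemma mem_bits n bs : size bs = n -> (forall i, (nth 0%N bs i <= 1)%N) -> bs \in bits n.
Proof.
elim: n bs => [|n IH] [|b bs] // [hs] h; apply/allpairsPdep; exists b, bs; split => //.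
  by have := h 0%N; rewrite !inE /=; case: b {h} => [|[]].
by apply: IH => // i; apply: (h i.+1).
Qed.

Lemma size_sizes n bs : size (sizes n bs) = size bs.
Proof. by elim: bs n => //= b bs IH n; rewrite IH. Qed.

Lemma nth_sizesS vs n n0 bs t : colok vs n n0 bs -> (t.+1 < size bs)%N ->
  nth 0%N (sizes n bs) t = (nth 0%N (sizes n bs) t.+1 + nth 0%N bs t.+1)%N.
Proof.
elim: t n vs bs => [|t IH] n [|v vs] [|b [|b' bs]] //=.
  by case: vs => [|v' vs] /and3P[h1 h2 h3] _; move: h3 => //= /and3P[]; lia.
by move=> /and3P[_ _ h] ht; apply: (IH _ vs (b' :: bs)).
Qed.

Definition strict N g := forall i, (i.+1 < N)%N -> nth 0 g i < nth 0 g i.+1.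

Lemma nth_addl u v i : size u = size v -> nth 0%N (addl u v) i = (nth 0%N u i + nth 0%N v i)%N.
Proof. by elim: u v i => [|x u IH] [|y v] [|i] //= [h]; rewrite ?IH // nth_nil. Qed.

Lemma gsub_addl N g bs w : size bs = N -> size w = N ->
  gsub N g (addl bs w) = gsub N (gsub N g bs) w.
Proof.
move=> hb hw; apply: (@eq_from_nth _ 0) => [|i]; rewrite ?size_mkseq // => hi.
by rewrite !nth_gsub // nth_addl ?hw //; lia.
Qed.

(* After removing a column with entries [bs] from weight [g], either [g] stays
   strict or two of its consecutive entries agree, and the terms cancel. *)
Lemma Z_col_cancel vs n n0 lam mu g bs N : is_part lam -> size vs = N -> bs \in bits N ->
  colok vs n n0 bs -> size g = N -> strict N g ->
  strict N (gsub N g bs) \/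
  Z (sizes n bs) lam mu (fun w => eps R N (gsub N (gsub N g bs) w)) = 0.
Proof.
move=> hl hvs /bitsP [hsb hb] hc hg hst.
have [h|h] := pselect (strict N (gsub N g bs)); first by left.
right; have [t [ht hlt]] : exists t, (t.+1 < N)%N /\ nth 0 (gsub N g bs) t.+1 <= nth 0 (gsub N g bs) t.
  apply: contrapT => hn; apply: h => i hi; rewrite ltNge; apply/negP => h2.
  by apply: hn; exists i.
move: hlt; rewrite !nth_gsub ?(ltnW ht) // => hlt.
have hg1 := hst t ht; have hb1 := hb t; have hb2 := hb t.+1.
have [e1 e2] : nth 0%N bs t = 0%N /\ nth 0%N bs t.+1 = 1%N by split; lia.
have eg : nth 0 (gsub N g bs) t = nth 0 (gsub N g bs) t.+1.
  by rewrite !nth_gsub ?(ltnW ht) // e1 e2; move: hlt; rewrite e1 e2; lia.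
move: (gsub N g bs) eg => G eg.
apply: (@Z_swap0 t) => //; first by rewrite size_sizes hsb.
  by rewrite (nth_sizesS hc) ?hsb // e2 addn1.
move=> w1 x y w2 hw1 hw2; apply: (eps_swap _ ht) => i.
rewrite size_sizes hsb in hw2.
case: (ltnP i N) => hi; last first.
  rewrite [LHS]nth_default ?size_mkseq //.
  have -> : (i == t) = false by apply/eqP; lia.
  have -> : (i == t.+1) = false by apply/eqP; lia.
  by rewrite nth_default ?size_mkseq.
have [->|h1] := eqVneq i t.
  by rewrite !nth_gsub ?(ltnW ht) // eg !nth_cat hw1 ltnn ltnNge leqnSn subSnn subnn.
have [->|h2] := eqVneq i t.+1.
  by rewrite !nth_gsub ?(ltnW ht) // eg !nth_cat hw1 ltnn ltnNge leqnSn subSnn subnn.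
rewrite !nth_gsub // !nth_cat hw1; case: ltnP => // h3.
by have -> : (i - t = (i - t - 2).+2)%N by lia.
Qed.

Lemma Z_nil vs mu phi : Z vs [::] mu phi = if mu == [::] then phi (nseq (size vs) 0%N) else 0.
Proof.
elim: vs phi => [|v vs IH] phi /=; first by rewrite eq_sym.
by rewrite /downs /= big_mkcond big_seq1 /= IH.
Qed.

Lemma gsub0 N g : size g = N -> gsub N g (nseq N 0%N) = g.
Proof.
move=> hg; apply: (@eq_from_nth _ 0) => [|i]; rewrite ?size_mkseq // => hi.
by rewrite nth_gsub // nth_nseq hi subr0.
Qed.

Lemma dcol_head lam : is_part lam -> lam != [::] -> (head 0%N (dcol lam) < head 0%N lam)%N.
Proof.
move=> hl hn; rewrite -!nth0 nth_dcol //; case: lam hl hn => //= x lam.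
by rewrite is_part_cons => /and3P[]; lia.
Qed.

(** Induction on the number of columns of lam. First-column choices that keep the exponents strictly
    increasing contribute nonnegatively by induction, the others cancel by [Z_col_cancel], and the
    empty shape gives 0 or 1. *)
Lemma Z_ge0 vs lam mu g : is_part lam -> is_part mu -> size g = size vs -> strict (size vs) g ->
  0 <= Z vs lam mu (fun w => eps R (size vs) (gsub (size vs) g w)).
Proof.
have [n hn] := ubnP (head 0%N lam).
elim: n lam mu vs g hn => // n IH lam mu vs g hn hl hm hg hst.
have [e|ne] := eqVneq lam [::].
  rewrite e Z_nil; case: ifP => // _; by rewrite gsub0 // (eps_inc _ hg hst) ler0n.
rewrite Z_col // big_seq_cond; apply: sumr_ge0 => bs /andP[hbs hc].
have [hsb hb] := bitsP hbs.
rewrite (Z_ext _ _ (phi' := fun w => eps R (size vs) (gsub (size vs) (gsub (size vs) g bs) w))); last first.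
  by move=> w hw; rewrite gsub_addl // hw size_sizes.
have [hs|-> //] := @Z_col_cancel vs _ _ (dcol lam) (dcol mu) g bs _ (dcol_part hl) erefl hbs hc hg hst.
have e : size vs = size (sizes (size lam) bs) by rewrite size_sizes.
rewrite e in hs *; apply: IH => //; rewrite ?size_mkseq ?dcol_part //.
by have := dcol_head hl ne; lia.
Qed.

(** The exponents nu + delta in increasing order, matching the normalisation of [eps]. *)
Definition gam N nu : seq int := mkseq (fun t => (nth 0%N nu (N - 1 - t))%:Z + t%:Z) N.

Lemma gam_strict N nu : is_part nu -> strict N (gam N nu).
Proof.
move=> hn i hi; rewrite !nth_mkseq ?(ltnW hi) //.
have := part_anti hn (_ : (N - 1 - i.+1 <= N - 1 - i)%N); move=> /(_ ltac:(lia)); lia.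
Qed.

Lemma nth_sizes n bs t : sumn bs = n -> (t < size bs)%N ->
  nth 0%N (sizes n bs) t = sumn (drop t.+1 bs).
Proof.
elim: bs n t => // b bs IH n [|t] /= hs ht; first by rewrite drop0; lia.
by apply: IH => //; lia.
Qed.

Lemma colokP vs n bs : colok vs n 0 bs =
  [&& size bs == size vs, sumn bs == n &
   all (fun t => sumn (drop t.+1 bs) <= nth 0%N vs t)%N (iota 0 (size vs))].
Proof.
elim: vs n bs => [|v vs IH] n [|b bs] //=; first by rewrite andbT eq_sym.
rewrite -[1%N]addn0 iotaDl all_map /= drop0 IH eqSS.
rewrite (eq_all (a2 := fun t => sumn (drop t.+1 bs) <= nth 0%N vs t)%N) //.
case: (size bs == size vs) => /=; last by rewrite !andbF.
have [e|ne] := eqVneq (b + sumn bs)%N n; last first.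
  by case: (leqP b n) => //= h; rewrite [_ == (n - b)%N](_ : _ = false) ?andbF //; apply/negbTE; lia.
by rewrite -e leq_addr addKn eqxx.
Qed.

Lemma sumn_bits_le bs : (forall i, (nth 0%N bs i <= 1)%N) -> (sumn bs <= size bs)%N.
Proof.
elim: bs => //= b bs IH h; have := h 0%N; have := IH (fun i => h i.+1); move=> /=; lia.
Qed.

Lemma bits_full bs : (forall i, (nth 0%N bs i <= 1)%N) -> (size bs <= sumn bs)%N -> bs = nseq (size bs) 1%N.
Proof.
elim: bs => //= b bs IH h hs; have h0 := h 0%N; have h1 := sumn_bits_le (fun i => h i.+1).
rewrite /= in h0 h1; rewrite -IH => [||]; [|by move=> i; apply: (h i.+1)|lia].
by congr cons; lia.
Qed.

Lemma bits_mono bs : (forall i, (nth 0%N bs i <= 1)%N) ->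
  (forall i, (i.+1 < size bs)%N -> (nth 0%N bs i <= nth 0%N bs i.+1)%N) ->
  bs = nseq (size bs - sumn bs) 0%N ++ nseq (sumn bs) 1%N.
Proof.
elim: bs => //= b bs IH h hm; have h0 := h 0%N; have hb := fun i => h i.+1; rewrite /= in h0 hb.
have hm' i : (i.+1 < size bs)%N -> (nth 0%N bs i <= nth 0%N bs i.+1)%N by apply: (hm i.+1).
have e := IH hb hm'; have hle := sumn_bits_le hb.
case: b h h0 hm => [|[|//]] h h0 hm; first by rewrite add0n subSn //= -e.
have -> : bs = nseq (size bs) 1%N.
  apply: bits_full => //; case: bs hb hm {IH h hm' e hle h0} => //= b bs hb hm.
  have := hb 0%N; have := hm 0%N => /= /(_ isT); case: b hb hm => [|[|//]] // hb hm _ _.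
  have all1 : forall i, (i < size bs)%N -> nth 0%N bs i = 1%N.
    elim=> [|i IHi] hi; first by have := hm 1%N hi; have := hb 1%N => /=; lia.
    by have := hm i.+2 hi; have := hb i.+2; rewrite /= IHi ?(ltnW hi) //; lia.
  suff -> : sumn bs = size bs by lia.
  elim: bs all1 {hb hm} => //= b bs IHb all1; rewrite [b](all1 0%N) // IHb //.
  by move=> i hi; apply: (all1 i.+1).
by rewrite size_nseq sumn_nseq mul1n add1n subnn.
Qed.

(** Without row bounds this is the coefficient of x^g in s_tau times the Vandermonde determinant,
    that is, in the alternant with exponents tau + delta. The second condition says that the single
    surviving chain, whose partition after step t has min(N - 1 - t, [size tau]) rows, respects the
    bounds. *)
Lemma Z_straight vs tau g : is_part tau -> (size tau <= size vs)%N -> size g = size vs ->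
  strict (size vs) g ->
  Z vs tau [::] (fun w => eps R (size vs) (gsub (size vs) g w)) =
  ((g == gam (size vs) tau) &&
   all (fun t => minn (size vs - 1 - t) (size tau) <= nth 0%N vs t)%N (iota 0 (size vs)))%:R.
Proof.
have [n hn] := ubnP (head 0%N tau).
elim: n tau vs g hn => // n IH tau vs g hn ht hsz hg hst; set N := size vs.
have [e|ne] := eqVneq tau [::].
  rewrite e Z_nil eqxx gsub0 // (eps_inc _ hg hst).
  have -> : all (fun t => minn (N - 1 - t) (size (Nil nat)) <= nth 0%N vs t)%N (iota 0 N).
    by apply/allP => t _; rewrite minn0.
  rewrite andbT; congr ((_ == _)%:R); apply: eq_mkseq => t.
  by rewrite nth_nil add0r.
rewrite Z_col //.
(* The only surviving choice: the cells of the first column are taken by the last [size tau] strips,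
   one each. *)
pose b0 := nseq (N - size tau) 0%N ++ nseq (size tau) 1%N.
have hd := dcol_part ht; have hdl := size_dcol tau.
have hb0 : b0 \in bits N.
  apply: mem_bits => [|i]; first by rewrite size_cat !size_nseq subnK.
  by rewrite nth_cat !nth_nseq; case: ifP => _; case: ifP.
have drop0' t : (t < N)%N -> sumn (drop t.+1 b0) = minn (N - 1 - t) (size tau).
  move=> hi; rewrite drop_cat size_nseq; case: ltnP => h.
    by rewrite drop_nseq sumn_cat !sumn_nseq; lia.
  by rewrite drop_nseq sumn_nseq; lia.
have sb0 : size b0 = N by rewrite size_cat !size_nseq subnK.
have hs0 : sumn b0 = size tau by rewrite sumn_cat !sumn_nseq; lia.
have psiE bs : bs \in bits N -> colok vs (size tau) 0 bs ->
   Z (sizes (size tau) bs) (dcol tau) (dcol [::]) (fun w => eps R N (gsub N g (addl bs w))) =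
   ((gsub N g bs == gam N (dcol tau)) &&
     all (fun t => minn (N - 1 - t) (size (dcol tau)) <= sumn (drop t.+1 bs))%N (iota 0 N))%:R.
  move=> hbs hc; have [hsb hb] := bitsP hbs.
  have hsum : sumn bs = size tau by move: hc; rewrite colokP => /and3P[_ /eqP].
  rewrite (Z_ext _ _ (phi' := fun w => eps R N (gsub N (gsub N g bs) w))); last first.
    by move=> w hw; rewrite gsub_addl // hw size_sizes.
  have eN : N = size (sizes (size tau) bs) by rewrite size_sizes hsb.
  have [hs|hns] := pselect (strict N (gsub N g bs)).
    rewrite [in LHS]eN IH; rewrite -?eN //; last 3 first.
    - by have := dcol_head ht ne; lia.
    - exact: leq_trans hdl hsz.
    - by rewrite size_mkseq.
    congr ((_ && _)%:R); apply: eq_in_all => t; rewrite mem_iota => hi.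
    by rewrite nth_sizes // hsb.
  have [//|->] := @Z_col_cancel vs _ _ (dcol tau) (dcol [::]) g bs _ hd erefl hbs hc hg hst.
  have -> // : (gsub N g bs == gam N (dcol tau)) = false.
  by apply/negbTE/negP => /eqP e; apply: hns; rewrite e; apply: gam_strict.
rewrite big_mkcond (bigD1_seq b0) ?uniq_bits //= [X in _ + X]big1_seq ?addr0 => [|bs /andP[hne hbs]]; last first.
  case: ifP => // hc; rewrite psiE //; have [hsb hb] := bitsP hbs.
  have hsum : sumn bs = size tau by move: hc; rewrite colokP => /and3P[_ /eqP].
  case: eqP => //= e; case: allP => // hall; case/eqP: hne.
  rewrite [bs]bits_mono //; first by rewrite hsum hsb.
  move=> u; rewrite hsb => hu; have hb1 := hb u; have hb2 := hb u.+1.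
  (* Compatible bits are weakly increasing. Where both entries of [dcol tau] vanish, strictness of g
     forbids the descent 1, 0; elsewhere the row bound coming from the first column forces all later
     bits to be 1. *)
  have [h|h] := leqP (size (dcol tau)) (N - 2 - u).
    have := hst u hu; have e1 i : (i < N)%N -> nth 0 g i = (nth 0%N (dcol tau) (N - 1 - i))%:Z + i%:Z + (nth 0%N bs i)%:Z.
      move=> hi; have := congr1 (fun s => nth 0 s i) e; rewrite nth_gsub // nth_mkseq //; lia.
    by rewrite !e1 ?(ltnW hu) // !(nth_default _ (s := dcol tau)); lia.
  have := hall u; rewrite mem_iota => /(_ ltac:(lia)) h2.
  have hbd i : (nth 0 (drop u.+1 bs) i <= 1)%N by rewrite nth_drop.
  have hle : (size vs - u.+1 <= sumn (drop u.+1 bs))%N by apply: leq_trans h2; move: h; rewrite /N; clear; lia.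
  have := bits_full hbd; rewrite size_drop hsb => /(_ hle) hd1.
  have := congr1 (fun s => nth 0%N s 0) hd1; rewrite nth_drop addn0 nth_nseq.
  by rewrite ifT => [->|] //; rewrite subn_gt0.
have -> : colok vs (size tau) (size (Nil nat)) b0 =
   all (fun t => minn (N - 1 - t) (size tau) <= nth 0%N vs t)%N (iota 0 N).
  rewrite colokP sb0 hs0 !eqxx /=; apply: eq_in_all => t; rewrite mem_iota => hi.
  by rewrite drop0'.
case: ifP => hall; last by rewrite andbF.
rewrite andbT psiE //; last first.
  rewrite colokP sb0 hs0 !eqxx /=; apply/allP => t ht1; have h1 := allP hall t ht1.
  by rewrite drop0' //; move: ht1; rewrite mem_iota.
have -> : all (fun t => minn (N - 1 - t) (size (dcol tau)) <= sumn (drop t.+1 b0))%N (iota 0 N).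
  by apply/allP => t; rewrite mem_iota => hi; rewrite drop0' //; lia.
rewrite andbT; congr (_%:R : R); congr (nat_of_bool _).
have nb t : (t < N)%N -> (nth 0%N (dcol tau) (N - 1 - t) + nth 0%N b0 t = nth 0%N tau (N - 1 - t))%N.
  move=> h; rewrite nth_dcol // nth_cat size_nseq !nth_nseq.
  have := part_size (N - 1 - t) ht; case: (ltnP t (N - size tau)) => h1.
    by move=> _; rewrite nth_default //; lia.
  move=> h2; have h3 : (0 < nth 0%N tau (N - 1 - t))%N by rewrite h2; lia.
  by rewrite ifT; lia.
apply/eqP/eqP => e; apply: (@eq_from_nth _ 0); rewrite ?size_mkseq // ?hg // => t ht'.
  have := congr1 (fun s => nth 0 s t) e; rewrite nth_gsub // !nth_mkseq //.
  by have := nb t ht'; lia.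
by rewrite nth_gsub // e !nth_mkseq //; have := nb t ht'; lia.
Qed.

End ColumnRecursion.

(** * Littlewood-Richardson coefficients as alternating sums *)

Section LittlewoodRichardson.
Variable R : realType.
Implicit Types (lam mu nu tau w : seq nat).

Fixpoint wsum N M (phi : seq nat -> R) : R :=
  if N is N'.+1 then \sum_(k < M.+1) wsum N' M (fun w => phi (nat_of_ord k :: w)) else phi [::].

Lemma wsum_ext N M phi phi' : (forall w, size w = N -> phi w = phi' w) -> wsum N M phi = wsum N M phi'.
Proof.
elim: N phi phi' => [|N IH] phi phi' h /=; first by rewrite h.
by apply: eq_bigr => k _; apply: IH => w hw; apply: h; rewrite /= hw.
Qed.

Lemma wsum_sum N M (I : Type) (r : seq I) (P : pred I) (phi : I -> seq nat -> R) :
  wsum N M (fun w => \sum_(i <- r | P i) phi i w) = \sum_(i <- r | P i) wsum N M (phi i).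
Proof.
elim: N phi => //= N IH phi; rewrite [RHS]exchange_big /=.
by apply: eq_bigr => k _; rewrite IH.
Qed.

Lemma wsumZ N M c phi : wsum N M (fun w => c * phi w) = c * wsum N M phi.
Proof. by elim: N phi => //= N IH phi; rewrite mulr_sumr; apply: eq_bigr => k _; rewrite IH. Qed.

Lemma wsum_Z N M lam mu phi : is_part lam -> (sumn lam <= M)%N ->
  wsum N M (fun w => (skew_kostka_rev lam mu w)%:R * phi w) = Z (nseq N M) lam mu phi.
Proof.
elim: N lam phi => [|N IH] lam phi hl hM.
  by rewrite /=; case: eqP; rewrite ?mul1r ?mul0r.
rewrite [LHS]/= [RHS]/= [RHS](_ : _ = \sum_(rho <- downs lam) \sum_(k < M.+1 | (sumn rho + k)%N == sumn lam)
   Z (nseq N M) rho mu (fun w => phi (nat_of_ord k :: w))); last first.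
  rewrite big_mkcond; apply: eq_big_seq => rho; rewrite mem_downs // => /andP[hr hh].
  have hle := hs_sumn hh; have hk : (sumn lam - sumn rho < M.+1)%N by lia.
  rewrite (big_pred1 (Ordinal hk)) => [|k]; last first.
    by rewrite /= -[k == _]val_eqE /=; apply/eqP/eqP; move: hle; clear; lia.
  rewrite /= ifT //; apply: leq_trans (leq_trans hle hM).
  by rewrite -(sumn_dcol hr) leq_addl.
rewrite (exchange_big_dep xpredT) //=; apply: eq_bigr => k _.
rewrite -[RHS]big_filter -perm_downs.
rewrite (eq_big_seq (fun rho => wsum N M (fun w => (skew_kostka_rev rho mu w)%:R * phi (nat_of_ord k :: w)))).
  rewrite -wsum_sum; apply: wsum_ext => w _.
  by rewrite -/(skew_kostka_rev lam mu (nat_of_ord k :: w)) skew_kostka_cons natr_sum mulr_suml.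
move=> rho; rewrite mem_strips // => /and3P[hr hh _]; rewrite IH //.
by apply: leq_trans (hs_sumn hh) hM.
Qed.

Lemma size_part tau : is_part tau -> (size tau <= sumn tau)%N.
Proof. by move=> h; rewrite -(sumn_dcol h) leq_addl. Qed.

Lemma skew_rev lam mu a : is_part lam -> skew_schur R lam mu a = (skew_kostka_rev lam mu a)%:R.
Proof. by move=> hl; rewrite /skew_schur (@skew_kostka_sym _ _ _ a) // filter_rev perm_rev. Qed.

Lemma gam_inj N nu tau : is_part nu -> is_part tau -> (sumn nu <= N)%N -> (sumn tau <= N)%N ->
  gam N nu = gam N tau -> nu = tau.
Proof.
move=> hn ht sn st e; apply: part_ext => // i; case: (ltnP i N) => hi; last first.
  by rewrite !nth_default //; apply: leq_trans (size_part _) (leq_trans _ hi).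
have := congr1 (fun s => nth 0 s (N - 1 - i)%N) e; rewrite !nth_mkseq; try lia.
by have -> : (N - 1 - (N - 1 - i) = i)%N; lia.
Qed.

(** Multiplying s_{lam/mu} by the Vandermonde determinant and reading off x^{nu + delta} isolates
    the coefficient of s_nu, because s_tau contributes 1 for tau = nu and 0 otherwise. The same
    number is a sum [Z], hence nonnegative. *)
Theorem hall_skew_ge0 lam mu nu : is_part lam -> is_part mu -> is_part nu ->
  0 <= hall_schur (skew_schur R lam mu) nu.
Proof.
move=> hl hm hn; have [e|/eqP ne] := eqVneq (sumn nu + sumn mu)%N (sumn lam); last first.
  by rewrite hall_skew_deg.
(* N variables separate the partitions of |nu|. M bounds both the letters and the numbers of rows
   without excluding anything. *)
pose N := sumn nu; pose M := sumn lam; pose phi w := eps R N (gsub N (gam N nu) w).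
have hst : strict (size (nseq N M)) (gam N nu) by rewrite size_nseq; apply: gam_strict.
have hz lam' mu' : is_part lam' -> (sumn lam' <= M)%N ->
   wsum N M (fun w => skew_schur R lam' mu' w * phi w) = Z (nseq N M) lam' mu' phi.
  by move=> hl' hM; rewrite -wsum_Z //; apply: wsum_ext => w _; rewrite skew_rev.
suff -> : hall_schur (skew_schur R lam mu) nu = Z (nseq N M) lam mu phi.
  have := @Z_ge0 R (nseq N M) lam mu (gam N nu) hl hm; rewrite size_nseq.
  by apply; [rewrite size_mkseq | rewrite size_nseq in hst].
rewrite -hz // (wsum_ext _ (phi' := fun w => \sum_(tau <- parts N)
    hall_schur (skew_schur R lam mu) tau * (skew_schur R tau [::] w * phi w))); last first.
  move=> w hw; rewrite (hallE (is_sym_skew R mu hl)).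
  have [ew|/eqP new] := eqVneq (sumn w) N.
    by rewrite ew mulr_suml; apply: eq_bigr => tau _; rewrite mulrA.
  rewrite !big1_seq ?mul0r // => tau /andP[_ /partsP[ht hs]].
    rewrite [skew_schur R tau _ _](_ : _ = 0) ?mul0r ?mulr0 //.
    by apply: schur_deg => //; rewrite hs.
  by rewrite hall_skew_deg ?mul0r // hs -e => /addIn.
rewrite wsum_sum (bigD1_seq nu) ?uniq_parts //=; last by apply/partsP.
have hzt tau : tau \in parts N -> wsum N M (fun w => skew_schur R tau [::] w * phi w) = (tau == nu)%:R.
  move=> /partsP[ht hs]; rewrite hz //; last by rewrite hs -/N /M -e leq_addr.
  have := @Z_straight R (nseq N M) tau (gam N nu) ht; rewrite size_nseq.
  rewrite -{1}hs size_part // size_mkseq => /(_ isT erefl) ->; last by rewrite size_nseq in hst.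
  rewrite (_ : all _ _ = true) ?andbT; last first.
    apply/allP => t; rewrite mem_iota => hi; rewrite nth_nseq ifT //.
    by apply: leq_trans (geq_minl _ _) _; rewrite /M -e -/N; lia.
  congr (_%:R : R); congr (nat_of_bool _); apply/eqP/eqP => [h|->//].
  by apply/esym; apply: (gam_inj hn ht _ _ h); rewrite ?hs.
rewrite wsumZ hzt ?eqxx ?mulr1; last by apply/partsP.
rewrite big1_seq ?addr0 // => tau /andP[ht hin].
by rewrite wsumZ hzt // (negbTE ht) mulr0.
Qed.

End LittlewoodRichardson.

(** * Converse of (a) *)

Section Converse.
Variable R : realType.
Implicit Types (lam mu nu : seq nat) (m : seq nat -> seq nat -> R) (p : nat -> R) (F : sring R).

(** The complete coefficient matrix in the basis [sp], with the leading 1 and the zeros outside the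
    dominance order filled in, so that f s_lam is one sum over all partitions of size at most
    |lam|. *)
Definition mt m lam nu : R :=
  if nu == lam then 1 else if dom_lt nu lam then m lam nu else 0.

Definition sp_sum lam (x : seq nat -> R) : sring R :=
  fun b => \sum_(n < (sumn lam).+1) \sum_(nu <- parts n) x nu * sp R nu b.

Lemma eq_sp_sum lam x y : (forall nu, is_part nu -> (sumn nu <= sumn lam)%N -> x nu = y nu) ->
  sp_sum lam x = sp_sum lam y.
Proof.
move=> h; apply: funext => b; apply: eq_bigr => n _; apply: eq_big_seq => nu /partsP[hn hs].
by rewrite h // hs -ltnS.
Qed.

Lemma lower_spE m lam : is_part lam -> sadd (sp R lam) (lower_sp m lam) = sp_sum lam (mt m lam).
Proof.
move=> hl; apply: funext => b; rewrite /sadd /lower_sp /sp_sum.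
have -> : sp R lam b = \sum_(n < (sumn lam).+1) \sum_(nu <- parts n | nu == lam) sp R nu b.
  rewrite (bigD1 ord_max) //= [X in _ = _ + X]big1 ?addr0 => [|n hn]; last first.
    rewrite big1_seq // => nu /andP[/eqP -> /partsP[_ hs]].
    by case/eqP: hn; apply: val_inj; apply: esym hs.
  rewrite big_mkcond (bigD1_seq lam) ?uniq_parts //=; last exact/partsP.
  by rewrite eqxx big1 ?addr0 // => nu /negbTE ->.
rewrite -big_split /=; apply: eq_bigr => n _; rewrite [X in X + _]big_mkcond [X in _ + X]big_mkcond.
rewrite -big_split /=; apply: eq_bigr => nu _; rewrite /mt.
have [->|hne] := eqVneq nu lam; first by rewrite /dom_lt eqxx andbF addr0 mul1r.
by rewrite add0r; case: ifP; rewrite ?mul0r.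
Qed.

Lemma fp_schur_sum p lam : fp_schur p lam = sp_sum lam (hall_schur (perp_schur (kappa p) lam)).
Proof. by []. Qed.

Lemma hall_perp_kappa_ge0 p lam nu : p 0%N = 1 -> kappa_positive p -> is_part lam -> is_part nu ->
  0 <= hall_schur (perp_schur (kappa p) lam) nu.
Proof.
move=> hp hk hl hn; rewrite hall_perp //; last exact: is_sym_kappa.
rewrite hallM //; [|exact: is_sym_kappa|exact: is_sym_schur].
apply: sumr_ge0 => n _; rewrite big_seq_cond; apply: sumr_ge0 => mu /andP[/partsP[hm _] _].
by apply: mulr_ge0; [exact: hk | rewrite hall_schurM //; exact: hall_skew_ge0].
Qed.

Lemma hall_perp_contained F lam nu : is_sym F -> is_part lam -> is_part nu ->
  hall_schur (perp_schur F lam : sring R) nu != 0 -> contained nu lam.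
Proof. by move=> hF hl hn; rewrite hall_perp //; apply: hall_contained. Qed.

Lemma fp_schur_lower p : p 0%N = 1 -> kappa_positive p ->
  exists m : seq nat -> seq nat -> R,
    (forall lam mu, is_part lam -> is_part mu -> dom_lt mu lam -> 0 <= m lam mu) /\
    (forall lam, is_part lam -> fp_schur p lam = sadd (sp R lam) (lower_sp m lam)).
Proof.
move=> hp hk; have hs := is_sym_kappa hp.
exists (fun lam => hall_schur (perp_schur (kappa p) lam)); split.
  by move=> lam mu hl hm _; apply: hall_perp_kappa_ge0.
move=> lam hl; rewrite lower_spE // fp_schur_sum; apply: eq_sp_sum => nu hn _.
rewrite /mt; have [->|hne] := eqVneq nu lam; first by rewrite hall_perp_diag // kappa_nil.
(* Skewing yields only partitions contained in lam, and containment implies extended dominance; so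
   nothing outside the order occurs. *)
case: ifP => // hd; apply/eqP; apply: contraFT hd => /(hall_perp_contained hs hl hn) hc.
by rewrite /dom_lt hne andbT; apply: contained_dom.
Qed.

End Converse.

(** * Partitions with at most three columns *)

Section ThreeColumns.
Local Open Scope nat_scope.
Implicit Types (a b c i j t : nat) (rho lam : seq nat).

(* the partition with columns [a >= b >= c] *)
Definition mk3 a b c := nseq c 3 ++ nseq (b - c) 2 ++ nseq (a - b) 1.

Lemma nth_mk3 a b c i : c <= b <= a -> nth 0 (mk3 a b c) i = (i < a) + (i < b) + (i < c).
Proof.
move=> h; rewrite /mk3 !nth_cat !size_nseq !nth_nseq.
case: (ltnP i c) => h1; first by (have hb : i < b by lia); (have ha : i < a by lia); rewrite hb ha.
case: (ltnP i b) => h2; first by (have hb : i - c < b - c by lia); (have ha : i < a by lia); rewrite hb ha.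
have -> : (i - c < b - c) = false by lia.
have -> : (i - c - (b - c) < a - b) = (i < a) by lia.
by case: (i < a).
Qed.

Lemma mk3_part a b c : c <= b <= a -> is_part (mk3 a b c).
Proof.
move=> h; have -> : mk3 a b c = [seq x <- mk3 a b c | 0 < x].
  by rewrite /mk3 !filter_cat !filter_nseq /= !mul1n.
by apply: filter_pos_part => i; rewrite !nth_mk3 //; lia.
Qed.

Lemma sumn_mk3 a b c : c <= b <= a -> sumn (mk3 a b c) = a + b + c.
Proof. by move=> h; rewrite /mk3 !sumn_cat !sumn_nseq; lia. Qed.

Lemma size_mk3 a b c : c <= b <= a -> size (mk3 a b c) = a.
Proof. by move=> h; rewrite /mk3 !size_cat !size_nseq; lia. Qed.

Lemma mk3_col1 k : mk3 k 0 0 = nseq k 1.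
Proof. by rewrite /mk3 /= subn0. Qed.

Definition colh t rho := count (fun x => t <= x) rho.

Lemma colhP t rho i : is_part rho -> 0 < t -> (i < colh t rho) = (t <= nth 0 rho i).
Proof.
move=> hr ht; elim: rho hr i => [|x rho IH] hr i; first by rewrite /= nth_nil; lia.
have hr' : is_part rho by move: hr; rewrite is_part_cons => /and3P[].
rewrite /colh /= -/(colh t rho); case: (leqP t x) => h; first by case: i => [|i] /=; rewrite add1n ?ltn0Sn ?h // ltnS IH.
have h0 k : nth 0 (x :: rho) k < t by apply: leq_ltn_trans (part_anti hr (leq0n k)) h.
have -> : colh t rho = 0.
  by apply/eqP; rewrite -leqn0 leqNgt IH // -ltnNge; apply: (h0 1).
by rewrite [RHS]leqNgt h0.
Qed.

Lemma mk3_colh rho : is_part rho -> nth 0 rho 0 <= 3 ->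
  colh 3 rho <= colh 2 rho <= colh 1 rho /\ rho = mk3 (colh 1 rho) (colh 2 rho) (colh 3 rho).
Proof.
move=> hr h3; have hc : colh 3 rho <= colh 2 rho <= colh 1 rho.
  by apply/andP; split; apply: sub_count => x /=; lia.
split => //; apply: part_ext => // [|i]; first exact: mk3_part.
rewrite nth_mk3 // !colhP //; have := part_anti hr (leq0n i); lia.
Qed.

Lemma colh_mk3 a b c : c <= b <= a ->
  [/\ colh 1 (mk3 a b c) = a, colh 2 (mk3 a b c) = b & colh 3 (mk3 a b c) = c].
Proof.
by move=> h; split; rewrite /colh /mk3 !count_cat !count_nseq /=; lia.
Qed.

Lemma hs_mk3 a b c a' b' c' : c <= b <= a -> c' <= b' <= a' ->
  hs (mk3 a b c) (mk3 a' b' c') =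
  [&& a' <= a <= a'.+1, b' <= b <= b'.+1 & c' <= c <= c'.+1].
Proof.
move=> h h'; apply/hsP/and3P => [hh|[h1 h2 h3] i]; last by rewrite !nth_mk3 //; lia.
have [e1 e2 e3] := colh_mk3 h; have [e1' e2' e3'] := colh_mk3 h'.
have key t : 0 < t -> colh t (mk3 a' b' c') <= colh t (mk3 a b c) <= (colh t (mk3 a' b' c')).+1.
  move=> ht; have hl := mk3_part h; have hl' := mk3_part h'.
  apply/andP; split; rewrite leqNgt; apply/negP => hlt.
    have := hh (colh t (mk3 a b c)); move: hlt; rewrite colhP // => hlt /andP[_ hle].
    by have := leq_trans hlt hle; rewrite -colhP // ltnn.
  have := hh (colh t (mk3 a' b' c')); move: hlt; rewrite colhP // => hlt /andP[hle _].
  by have := leq_trans hlt hle; rewrite -colhP // ltnn.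
by have := key 1 isT; have := key 2 isT; have := key 3 isT; rewrite e1 e2 e3 e1' e2' e3'.
Qed.

(** The possible losses of cells per column: a horizontal strip takes at most one cell from each. *)
Definition eps3 : seq (nat * nat * nat) :=
  [:: (0,0,0); (1,0,0); (0,1,0); (0,0,1); (1,1,0); (1,0,1); (0,1,1); (1,1,1)].

Lemma perm_strips3 a b c j : c <= b <= a ->
  perm_eq (strips (mk3 a b c) j)
   [seq mk3 (a - e.1.1) (b - e.1.2) (c - e.2) | e <- eps3 &
     [&& e.1.1 + e.1.2 + e.2 == j, e.2 <= c, c - e.2 <= b - e.1.2, e.1.2 <= b,
         b - e.1.2 <= a - e.1.1 & e.1.1 <= a]].
Proof.
move=> h; have hl := mk3_part h.
apply: uniq_perm; first exact: uniq_strips.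
  rewrite map_inj_in_uniq ?filter_uniq // => -[[x1 y1] z1] [[x2 y2] z2].
  rewrite !mem_filter /= => /andP[/and5P[_ p1 p2 p3 /andP[p4 p5]] _].
  move=> /andP[/and5P[_ p1' p2' p3' /andP[p4' p5']] _] e.
  have h1 : c - z1 <= b - y1 <= a - x1 by apply/andP.
  have h2 : c - z2 <= b - y2 <= a - x2 by apply/andP.
  have [e1 e2 e3] := colh_mk3 h1; have [] := colh_mk3 h2; rewrite -e e1 e2 e3 => q1 q2 q3.
  by congr (_, _, _); lia.
move=> rho; rewrite mem_strips //; apply/idP/mapP => [/and3P[hr hh /eqP hs]|[[[x y] z]]].
  have h3 : nth 0 rho 0 <= 3.
    by move/hsP: hh => /(_ 0) /andP[_]; rewrite nth_mk3 //; lia.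
  have [hc e] := mk3_colh hr h3; move: hh hs; rewrite e hs_mk3 // !sumn_mk3 // => /and3P[p1 p2 p3] hs.
  exists (a - colh 1 rho, b - colh 2 rho, c - colh 3 rho); last by rewrite /= !subKn //; lia.
  have mem_eps x y z : x <= 1 -> y <= 1 -> z <= 1 -> (x, y, z) \in eps3.
    by case: x y z => [|[|//]] [|[|//]] [|[|//]].
  by rewrite mem_filter mem_eps /=; lia.
rewrite mem_filter /= => /andP[/and5P[/eqP p0 p1 p2 p3 /andP[p4 p5]] hin] ->.
have h' : c - z <= b - y <= a - x by apply/andP.
have hb : [&& x <= 1, y <= 1 & z <= 1] by move: hin; rewrite !inE => /or4P[|||/or4P[|||/orP[]]] /eqP [-> -> ->].
rewrite mk3_part // hs_mk3 // !sumn_mk3 //; lia.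
Qed.

End ThreeColumns.

(** * Dual Jacobi-Trudi identity for three columns *)

Section DualJacobiTrudi.
Variable R : realType.
Implicit Types (a b c d i j k : nat) (x y z : int) (A B C F G : sring R).

(* elementary and complete symmetric functions, zero in negative degree *)
Definition eS (z : int) : sring R := if z is Posz k then schur R (nseq k 1%N) else 0.
Definition hS (z : int) : sring R := if z is Posz k then hser R k else 0.
Arguments eS : simpl never.
Arguments hS : simpl never.

Lemma eS_neg z : z < 0 -> eS z = 0. Proof. by case: z. Qed.

Lemma hS_neg z : z < 0 -> hS z = 0. Proof. by case: z. Qed.

Lemma T_schur3 a b c j : (c <= b <= a)%N ->
  (T j (schur R (mk3 a b c)) : sring R) =
  \sum_(e <- eps3 | [&& e.1.1 + e.1.2 + e.2 == j, e.2 <= c, c - e.2 <= b - e.1.2, e.1.2 <= b,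
         b - e.1.2 <= a - e.1.1 & e.1.1 <= a]%N)
    (schur R (mk3 (a - e.1.1) (b - e.1.2) (c - e.2)) : sring R).
Proof.
move=> h; rewrite T_schur ?mk3_part // (perm_big _ (perm_strips3 j h)) big_map big_filter.
by apply: eq_bigr.
Qed.

Lemma is_part_nseq1 k : is_part (nseq k 1%N).
Proof. by rewrite -mk3_col1; apply: mk3_part. Qed.

Lemma is_sym_eS z : is_sym (eS z).
Proof. by case: z => k //; apply: is_sym_schur; apply: is_part_nseq1. Qed.

Lemma is_sym_hS z : is_sym (hS z).
Proof. by case: z => k //; apply: is_sym_hser. Qed.

Lemma T0_eS z : (T 0 (eS z) : sring R) = eS z.
Proof. by apply: is_sym_0; apply: is_sym_eS. Qed.

Lemma T1_eS z : (T 1 (eS z) : sring R) = eS (z - 1).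
Proof.
case: z => k //; rewrite [eS k]/eS -mk3_col1 T_schur3 // /eps3 !big_cons big_nil.
case: k => [|k] /=; rewrite ?addr0 //.
have -> : k.+1%:Z - 1 = k%:Z by lia.
by rewrite subn1 mk3_col1.
Qed.

Lemma T2_eS z j : (T j.+2 (eS z) : sring R) = 0.
Proof.
case: z => k //; rewrite [eS k]/eS -mk3_col1 T_schur3 // /eps3 !big_cons big_nil /= ?andbF //.
Qed.

Lemma T_hS z j : (T j (hS z) : sring R) = hS (z - j%:Z).
Proof.
case: z => k; last by case: j.
rewrite [hS k]/hS T_hser; case: leqP => h; first by rewrite (_ : k%:Z - j%:Z = (k - j)%N) //; lia.
by rewrite (_ : k%:Z - j%:Z = Negz (j - k).-1) //; lia.
Qed.

Lemma eS_nil z : eS z [::] = (z == 0)%:R.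
Proof. by case: z => [[|k]|k]. Qed.

Lemma hS_nil z : hS z [::] = (z == 0)%:R.
Proof. by case: z => [[|k]|k]. Qed.

Lemma eS0 : eS 0 = 1. Proof. exact: schur_nil. Qed.

Lemma T0_M F G : (T 0 (F * G) : sring R) = (T 0 F : sring R) * T 0 G.
Proof. by rewrite T_mul big_ord1. Qed.
Lemma T1_M F G : (T 1 (F * G) : sring R) = (T 0 F : sring R) * T 1 G + (T 1 F : sring R) * T 0 G.
Proof. by rewrite T_mul !big_ord_recr big_ord0 /= add0r. Qed.
Lemma T2_M F G : (T 2 (F * G) : sring R) =
  (T 0 F : sring R) * T 2 G + (T 1 F : sring R) * T 1 G + (T 2 F : sring R) * T 0 G.
Proof. by rewrite T_mul !big_ord_recr big_ord0 /= add0r. Qed.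
Lemma T3_M F G : (T 3 (F * G) : sring R) =
  (T 0 F : sring R) * T 3 G + (T 1 F : sring R) * T 2 G + (T 2 F : sring R) * T 1 G
  + (T 3 F : sring R) * T 0 G.
Proof. by rewrite T_mul !big_ord_recr big_ord0 /= add0r. Qed.

Definition TE := (T0_M, T1_M, T2_M, T3_M, T0_eS, T1_eS, T2_eS).

Lemma T_ee j x y : (T j.+3 (eS x * eS y) : sring R) = 0.
Proof.
rewrite T_mul big1 // => -[i hi] _ /=; case: i hi => [|[|i]] hi; by rewrite ?T2_eS ?mul0r ?mulr0.
Qed.

Lemma T_eee j x y z : (T j.+4 (eS x * eS y * eS z) : sring R) = 0.
Proof.
rewrite T_mul big1 // => -[i hi] _ /=; case: i hi => [|[|[|i]]] hi; by rewrite ?T_ee ?T2_eS ?mul0r ?mulr0.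
Qed.

(** The determinant with rows (e_x, e_{x+1}, e_{x+2}), (e_{y-1}, e_y, e_{y+1}), (e_{z-2}, e_{z-1},
    e_z), written out for [ring]. *)
Definition D3 x y z : sring R :=
  eS x * eS y * eS z - eS x * eS (y + 1) * eS (z - 1) - eS (x + 1) * eS (y - 1) * eS z
  + eS (x + 1) * eS (y + 1) * eS (z - 2) + eS (x + 2) * eS (y - 1) * eS (z - 1)
  - eS (x + 2) * eS y * eS (z - 2).

(** In the first variable e_k = T_0 e_k + x_1 T_1 e_k with T_0 e_k = e_k and T_1 e_k = e_{k-1}, so
    each row of the determinant is lowered independently by 0 or 1. *)
Lemma T_D3 j x y z : (T j (D3 x y z) : sring R) =
  \sum_(e <- eps3 | (e.1.1 + e.1.2 + e.2 == j)%N) D3 (x - e.1.1%:Z) (y - e.1.2%:Z) (z - e.2%:Z).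
Proof.
have e1 (u v : int) : u - 1 + v = u + v - 1 by rewrite addrAC.
rewrite /eps3 !big_cons big_nil /D3 /= !(T_add, T_opp) !subr0.
case: j => [|[|[|[|j]]]] /=; rewrite ?addr0 ?TE ?T_eee ?e1; ring.
Qed.

Lemma D3_eq12 y z : D3 (y - 1) y z = 0.
Proof.
have e1 : y - 1 + 1 = y by lia.
have e2 : y - 1 + 2 = y + 1 by lia.
rewrite /D3 e1 e2; move: (eS (y - 1)) (eS y) (eS (y + 1)) (eS z) (eS (z - 1)) (eS (z - 2)).
by move=> a b c d e f; ring.
Qed.

Lemma D3_eq23 x z : D3 x (z - 1) z = 0.
Proof.
have e1 : z - 1 + 1 = z by lia.
have e2 : z - 1 - 1 = z - 2 by lia.
rewrite /D3 e1 e2; move: (eS x) (eS (x + 1)) (eS (x + 2)) (eS z) (eS (z - 1)) (eS (z - 2)).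
by move=> a b c d e f; ring.
Qed.

Lemma D3_neg x y z : z < 0 -> D3 x y z = 0.
Proof.
move=> h; rewrite /D3 (eS_neg h) (@eS_neg (z - 1)) ?(@eS_neg (z - 2)); [|lia|lia].
by rewrite !mulr0 !(subr0, addr0).
Qed.

(** Both sides satisfy the same recursion in the first variable. Those terms of the determinant
    recursion whose indices form no partition have two equal rows or a zero row. *)
Lemma jacobi_trudi3 a b c : (c <= b <= a)%N -> (schur R (mk3 a b c) : sring R) = D3 a b c.
Proof.
move=> h; apply: funext => s; elim: s a b c h => [|j s IH] a b c h.
  rewrite /schur /skew_schur /rev /=.
  have -> : (mk3 a b c == [::]) = (a == 0%N) by rewrite -size_eq0 size_mk3.
  rewrite /D3 !(serD, serN, serM_nil) !eS_nil.
  have -> : (a%:Z + 1 == 0) = false by lia.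
  have -> : (a%:Z + 2 == 0) = false by lia.
  rewrite !mul0r !(subr0, addr0); case: a h => [|a] h /=; last by rewrite !mul0r subr0.
  have -> : b = 0%N by lia. have -> : c = 0%N by lia.
  by rewrite /= !mul1r mulr0 subr0.
have -> : D3 a b c (j :: s) = (T j (D3 a b c) : sring R) s by [].
have -> : schur R (mk3 a b c) (j :: s) = (T j (schur R (mk3 a b c)) : sring R) s by [].
rewrite T_schur3 // T_D3 !ser_sum big_mkcond [RHS]big_mkcond /=; apply: eq_big_seq => -[[e1 e2] e3] hin /=.
have hb : [&& e1 <= 1, e2 <= 1 & e3 <= 1]%N by move: hin; rewrite !inE => /or4P[|||/or4P[|||/orP[]]] /eqP [-> -> ->].
case: eqP => //= _; case: ifP => hc.
  rewrite IH; last by lia.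
  have subzE m n : (n <= m)%N -> (m - n)%N%:Z = m%:Z - n%:Z by lia.
  by rewrite !subzE //; lia.
case/and3P: hb => hb1 hb2 hb3.
have [h3|h3] := leqP e3 c; last first.
  by rewrite D3_neg ?ser0 //; lia.
have [h2|h2] := boolP (c%:Z - e3%:Z <= b%:Z - e2%:Z); last first.
  have -> : b%:Z - e2%:Z = c%:Z - e3%:Z - 1 by lia.
  by rewrite D3_eq23.
have -> : a%:Z - e1%:Z = b%:Z - e2%:Z - 1 by lia.
by rewrite D3_eq12.
Qed.

End DualJacobiTrudi.

Section EHRelation.
Variable R : realType.
Implicit Types (a b c d i j k : nat) (x y z : int) (A B C F G : sring R).
Variables E H : int -> sring R.
Hypotheses (E_neg : forall z, z < 0 -> E z = 0) (H_neg : forall z, z < 0 -> H z = 0)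
  (is_sym_E : forall z, is_sym (E z)) (is_sym_H : forall z, is_sym (H z))
  (T1_E : forall z, (T 1 (E z) : sring R) = E (z - 1))
  (T2_E : forall z j, (T j.+2 (E z) : sring R) = 0)
  (T_H : forall z j, (T j (H z) : sring R) = H (z - j%:Z))
  (EH_nil : forall K z, z < K%:Z ->
     \sum_(i < K) (-1) ^+ i * E i [::] * H (z - i%:Z) [::] = (z == 0)%:R).

Let T0_E z : (T 0 (E z) : sring R) = E z.
Proof. exact: is_sym_0. Qed.

(** T_{j+1} of the sum telescopes to 0, so the sum equals its constant term. [E] and [H] are
    abstract because the argument serves both e, h and their images under f_p. *)
Lemma eh_partial K z : z < K%:Z -> \sum_(i < K) (-1) ^+ i * E i * H (z - i%:Z) = (z == 0)%:R.
Proof.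
have hT j y : y < K%:Z -> (T j.+1 (\sum_(i < K) (-1) ^+ i * E i * H (y - i%:Z)) : sring R) = 0.
  have hc : ((- 1) : sring R) = sC (- 1) * 1.
    by apply: funext => a; rewrite serCM serN mulN1r.
  have hs i : (- 1 : sring R) ^+ i = sC ((-1) ^+ i).
    elim: i => [|i IH]; apply: funext => a; first by rewrite expr0 /sC /sscale mul1r.
    by rewrite exprS IH hc mulr1 serCM /sC /sscale exprS mulrA.
  move=> hy; rewrite T_sum.
  have e (i : 'I_K) : (T j.+1 ((-1) ^+ i * E i * H (y - i%:Z)) : sring R) =
     (-1) ^+ i * E i * H (y - i%:Z - j.+1%:Z) + (-1) ^+ i * E (i%:Z - 1) * H (y - i%:Z - j%:Z).
    rewrite -mulrA hs T_C -hs T_mul big_ord_recl big_ord_recl [X in _ * (_ + (_ + X))]big1 => [|k _].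
      rewrite addr0 T0_E T1_E !T_H /= mulrDr !mulrA subn0.
      by congr (_ + _ * H _); rewrite /bump /=; lia.
    have -> : nat_of_ord (lift ord0 (lift ord0 k)) = k.+2 by [].
    by rewrite T2_E mul0r.
  under eq_bigr do rewrite e.
  rewrite big_split /=.
  case: K {e} hy => [|K] hy; first by rewrite !big_ord0 addr0.
  rewrite big_ord_recr [X in _ + X]big_ord_recl /= (@E_neg (0%N%:Z - 1)) // mulr0 mul0r add0r.
  rewrite (@H_neg (y - K%:Z - j.+1%:Z)); last by lia.
  rewrite mulr0 addr0 -big_split /=; apply: big1 => i _.
  have -> : (bump 0 i)%:Z - 1 = i by rewrite /bump; lia.
  have -> : y - (bump 0 i)%:Z - j%:Z = y - i%:Z - j.+1%:Z by rewrite /bump; lia.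
  rewrite /bump /= add1n.
  by rewrite exprS mulN1r !mulNr subrr.
move=> hz; apply: funext => a; elim: a => [|j a IH].
  rewrite ser_sum; have -> : ((z == 0)%:R : sring R) [::] = (z == 0)%:R by case: eqP.
  rewrite -(EH_nil hz); apply: eq_bigr => i _; rewrite !serM_nil; congr (_ * _ * _).
  by elim: (nat_of_ord i) => [|k IH] //; rewrite !exprS serM_nil IH serN.
have hsym : is_sym (\sum_(i < K) (-1) ^+ i * E i * H (z - i%:Z)).
  apply: is_sym_sum => i _ _; apply: is_symM; last exact: is_sym_H.
  by apply: is_symM; [apply: is_symX; apply: is_symN; exact: is_sym1 | exact: is_sym_E].
case: j => [|j].
  rewrite -[LHS]/((T 0 (\sum_(i < K) (-1) ^+ i * E i * H (z - i%:Z)) : sring R) a) is_sym_0 // IH.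
  by case: eqP.
by rewrite -[LHS]/((T j.+1 (\sum_(i < K) (-1) ^+ i * E i * H (z - i%:Z)) : sring R) a) hT //; case: eqP.
Qed.

Lemma eh_recE d : H 0 = 1 -> E d.+1 = \sum_(i < d.+1) (-1) ^+ i * H i.+1%:Z * E (d - i)%N.
Proof.
move=> H0; have := @eh_partial d.+2 d.+1%:Z (ltac:(lia)); rewrite big_ord_recr /= subrr H0.
rewrite mulr1 => /eqP; rewrite addrC addr_eq0 => /eqP h.
have -> : E d.+1 = (-1) ^+ d.+1 * ((-1) ^+ d.+1 * E d.+1 : sring R) :> sring R.
  by rewrite mulrA -expr2 sqrr_sign mul1r.
have hsgn m i : (- 1 : sring R) ^+ (m + i).+1 * (- 1) ^+ m = - (- 1) ^+ i.
  by rewrite exprS exprD mulN1r mulNr mulrAC -expr2 sqrr_sign mul1r.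
rewrite h mulrN mulr_sumr -sumrN (reindex_inj rev_ord_inj) /=.
apply: eq_bigr => i _; have hi := ltn_ord i.
rewrite subSS; have -> : d.+1%:Z - (d - i)%N%:Z = i.+1%:Z by lia.
have hd : ((d - i) + i)%N = d by lia.
rewrite !mulrA -{1}hd hsgn !mulNr opprK -!mulrA; congr (_ * _); exact: mulrC.
Qed.

Lemma eh_recH d : E 0 = 1 -> H d.+1 = \sum_(i < d.+1) (-1) ^+ i * E i.+1%:Z * H (d - i)%N.
Proof.
move=> E0; have := @eh_partial d.+2 d.+1%:Z (ltac:(lia)); rewrite big_ord_recl /= E0 expr0 !mul1r subr0.
move=> /eqP; rewrite addr_eq0 => /eqP ->; rewrite -sumrN; apply: eq_bigr => i _; have hi := ltn_ord i.
have -> : d.+1%:Z - (bump 0 i)%:Z = (d - i)%N by rewrite /bump; lia.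
by rewrite /bump add1n exprS mulN1r !mulNr opprK.
Qed.

End EHRelation.

Section ElementaryRecursion.
Variable R : realType.
Implicit Types (d k : nat) (z : int).

Lemma eh_nil K z : z < K%:Z ->
  \sum_(i < K) (-1) ^+ i * eS R i [::] * hS R (z - i%:Z) [::] = (z == 0)%:R.
Proof.
case: K => [|K] hz; first by rewrite big_ord0; case: z hz => // k; rewrite ltz_nat.
rewrite big_ord_recl big1 => [|i _]; last by rewrite eS_nil /= mulr0 mul0r.
by rewrite expr0 mul1r eS_nil hS_nil /= subr0 mul1r addr0.
Qed.

Lemma hS0 : hS R 0 = 1. Proof. by apply: funext => a. Qed.

Lemma eS_rec d : eS R d.+1 = \sum_(i < d.+1) (-1) ^+ i * hS R i.+1%:Z * eS R (d - i)%N.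
Proof.
exact: (eh_recE (@eS_neg R) (@hS_neg R) (@is_sym_eS R) (@is_sym_hS R) (@T1_eS R) (@T2_eS R)
  (@T_hS R) eh_nil d hS0).
Qed.

Lemma hS_rec d : hS R d.+1 = \sum_(i < d.+1) (-1) ^+ i * eS R i.+1%:Z * hS R (d - i)%N.
Proof.
exact: (eh_recH (@eS_neg R) (@hS_neg R) (@is_sym_eS R) (@is_sym_hS R) (@T1_eS R) (@T2_eS R)
  (@T_hS R) eh_nil d (@eS0 R)).
Qed.

End ElementaryRecursion.

(** * Pairings with products of elementary functions *)

Section Pairing.
Variable R : realType.
Implicit Types (a b c d i j k : nat) (x y z : int) (F G X : sring R).
Arguments eS : simpl never.
Arguments hS : simpl never.
Notation eS := (@eS R).
Notation hS := (@hS R).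

Lemma exchange_strips (V : nmodType) (G : seq nat -> seq nat -> V) n j :
  \sum_(mu <- parts n) \sum_(lam <- ups mu j) G lam mu =
  \sum_(lam <- parts (n + j)) \sum_(mu <- strips lam j) G lam mu.
Proof.
transitivity (\sum_(mu <- parts n) \sum_(lam <- parts (n + j) | hs lam mu) G lam mu).
  apply: eq_big_seq => mu /partsP [pmu smu]; rewrite -[RHS]big_filter; apply: perm_big.
  apply: uniq_perm; rewrite ?filter_uniq ?uniq_ups ?uniq_parts // => lam.
  by rewrite mem_ups mem_filter mem_parts smu [sumn lam == _]eq_sym andbCA.
rewrite (exchange_big_dep xpredT) //=; apply: eq_big_seq => lam /partsP [pl sl].
rewrite -[LHS]big_filter; apply: perm_big.
apply: uniq_perm; rewrite ?filter_uniq ?uniq_strips ?uniq_parts // => mu.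
by rewrite mem_strips // mem_filter mem_parts sl eqn_add2r andbCA.
Qed.

Lemma hall_T j F mu : is_sym F -> is_part mu ->
  hall_schur (T j F) mu = \sum_(lam <- ups mu j) hall_schur F lam.
Proof.
move=> sF pmu.
apply: (@hall_eq R (T j F : sring R) (fun mu => \sum_(lam <- ups mu j) hall_schur F lam) (sumn mu)).
- exact: is_sym_T.
- move=> a ha; rewrite /T (hallE sF) /= ha.
  under [RHS]eq_bigr do rewrite mulr_suml.
  rewrite (exchange_strips (fun lam nu => hall_schur F lam * schur R nu a)) addnC.
  apply: eq_big_seq => lam /partsP [pl sl].
  by rewrite -[schur R lam _]/((T j (schur R lam) : sring R) a) T_schur // ser_sum mulr_sumr.
- by apply/partsP.
Qed.

Lemma hall_hserM j X lam : is_sym X -> is_part lam ->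
  hall_schur ((hser R j : sring R) * X) lam = \sum_(rho <- strips lam j) hall_schur X rho.
Proof.
move=> sX pl; rewrite mulrC hallM //; last exact: is_sym_hser.
transitivity (\sum_(n < (sumn lam).+1) \sum_(mu <- parts n)
    (if mu \in strips lam j then hall_schur X mu else 0)).
  apply: eq_bigr => n _; apply: eq_big_seq => mu /partsP [pmu _].
  rewrite [_ * (hser R j : sring R)]mulrC pieri //.
  have -> : \sum_(nu <- ups mu j) (schur R nu : sring R) =
            \sum_(nu <- ups mu j) sC (1 : R) * (schur R nu : sring R).
    by apply: eq_bigr => nu _; apply: funext => a; rewrite serCM mul1r.
  rewrite hall_sum // => [|nu]; last by rewrite mem_ups => /and3P [h _ _]; apply: is_sym_schur.
  rewrite mem_strips // pmu /=.
  rewrite (eq_big_seq (fun nu => (nu == lam)%:R)) => [|nu]; last first.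
    by rewrite mem_ups => /and3P [h _ _]; rewrite hall_schurE // mul1r.
  have -> : \sum_(nu <- ups mu j) (nu == lam)%:R = (lam \in ups mu j)%:R :> R.
    have := uniq_ups mu j; elim: (ups mu j) => [|nu s IH]; first by rewrite big_nil.
    rewrite cons_uniq big_cons in_cons => /andP [h1 /IH ->]; rewrite [lam == _]eq_sym.
    by case: eqP h1 => [->|_] h1 /=; rewrite ?add0r // (negbTE h1) addr0.
  by rewrite mem_ups pl /=; case: ifP; rewrite ?mulr1 ?mulr0.
have hle mu : mu \in strips lam j -> (sumn mu <= sumn lam)%N.
  by rewrite mem_strips // => /and3P [_ _ /eqP <-]; apply: leq_addr.
under eq_bigr do rewrite -big_mkcond /=.
have hj (n : nat) : \sum_(mu <- parts n | mu \in strips lam j) hall_schur X mu =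
   \sum_(mu <- strips lam j | sumn mu == n) hall_schur X mu.
  rewrite -[LHS]big_filter -[RHS]big_filter; apply: perm_big.
  apply: uniq_perm; rewrite ?filter_uniq ?uniq_strips ?uniq_parts // => mu.
  rewrite !mem_filter mem_parts; case: (boolP (mu \in _)); rewrite ?andbF ?andbT //.
  by rewrite mem_strips // => /andP [-> _].
under eq_bigr do rewrite hj.
rewrite (exchange_big_dep xpredT) //=; apply: eq_big_seq => mu hmu.
have hm : (sumn mu < (sumn lam).+1)%N by rewrite ltnS hle.
by rewrite (big_pred1 (Ordinal hm)) // => i; rewrite /= eq_sym.
Qed.

Definition pr (N : nat) F G : R := \sum_(lam <- parts N) hall_schur F lam * hall_schur G lam.

Lemma prT N j F X : is_sym F -> is_sym X ->
  pr N (T j F) X = pr (N + j) F ((hser R j : sring R) * X).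
Proof.
move=> sF sX; rewrite /pr.
transitivity (\sum_(mu <- parts N) \sum_(lam <- ups mu j) hall_schur F lam * hall_schur X mu).
  by apply: eq_big_seq => mu /partsP [pmu _]; rewrite hall_T // mulr_suml.
rewrite (exchange_strips (fun lam mu => hall_schur F lam * hall_schur X mu)).
by apply: eq_big_seq => lam /partsP [pl _]; rewrite hall_hserM // mulr_sumr.
Qed.

Lemma pr_schur N F mu : mu \in parts N -> pr N F (schur R mu) = hall_schur F mu.
Proof.
move=> hmu; have /partsP [pmu _] := hmu.
rewrite /pr (bigD1_seq mu) ?uniq_parts //= hall_schurE // eqxx mulr1 big_seq_cond big1 ?addr0 //.
move=> lam /andP [/partsP [pl _] hl]; rewrite hall_schurE // eq_sym (negbTE hl) mulr0 //.
Qed.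

Lemma prDr N F X Y : is_sym X -> is_sym Y -> pr N F (X + Y : sring R) = pr N F X + pr N F Y.
Proof.
move=> sX sY; rewrite /pr -big_split /=; apply: eq_big_seq => lam /partsP [pl _].
by rewrite hallD // mulrDr.
Qed.

Lemma prDl N F G X : is_sym F -> is_sym G -> pr N (F + G : sring R) X = pr N F X + pr N G X.
Proof.
move=> sX sY; rewrite /pr -big_split /=; apply: eq_big_seq => lam /partsP [pl _].
by rewrite hallD // mulrDl.
Qed.

Lemma prNr N F X : is_sym X -> pr N F (- X : sring R) = - pr N F X.
Proof.
move=> sX; rewrite /pr -sumrN; apply: eq_big_seq => lam /partsP [pl _].
by rewrite hallN // mulrN.
Qed.

Lemma pr0 N X : pr N 0 X = 0.
Proof. by rewrite /pr big_seq big1 // => lam /partsP [pl _]; rewrite hall0 // mul0r. Qed.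

Lemma pr_signr N F i X : is_sym X -> pr N F ((-1) ^+ i * X : sring R) = (-1) ^+ i * pr N F X.
Proof.
move=> sX; elim: i => [|i IH]; first by rewrite !mul1r.
rewrite !exprS -!mulrA !mulN1r prNr ?IH //.
by apply: is_symM => //; apply: is_symX; apply: is_symN; apply: is_sym1.
Qed.

End Pairing.

Section ElementaryPairing.
Variable R : realType.
Implicit Types (a b c d i j k : nat) (x y z : int) (F G X : sring R).
Arguments eS : simpl never.
Arguments hS : simpl never.
Notation eS := (@eS R).
Notation hS := (@hS R).

Lemma pr_sum N F (I : Type) (r : seq I) (P : pred I) (X : I -> sring R) :
  (forall i : I, P i -> is_sym (X i)) ->
  pr N F (\sum_(i <- r | P i) X i) = \sum_(i <- r | P i) pr N F (X i).
Proof.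
move=> sX.
have : is_sym (\sum_(i <- r | P i) X i) /\ pr N F (\sum_(i <- r | P i) X i) = \sum_(i <- r | P i) pr N F (X i).
  apply: (big_ind2 (fun (G : sring R) u => is_sym G /\ pr N F G = u)).
  - split; first by move=> a b _; rewrite !ser0.
    by rewrite /pr big_seq big1 // => lam /partsP [pl _]; rewrite hall0 // mulr0.
  - by move=> G1 u1 G2 u2 [s1 <-] [s2 <-]; split; [apply: is_symD | rewrite prDr].
  - by move=> i hi; split=> //; apply: sX.
by case.
Qed.

(** T_i is the adjoint of h_i; the recursion expressing e_{d+1} through the h_{i+1} transfers
    pairings with e_{d+1} to these adjoints. *)
Lemma pr_eS_step d N F X : is_sym F -> is_sym X ->
  pr (N + d.+1) F (eS d.+1 * X) =
  \sum_(i < d.+1) (-1) ^+ i * pr (N + (d - i)) (T i.+1 F) (eS (d - i)%N * X).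
Proof.
move=> sF sX; rewrite eS_rec mulr_suml pr_sum => [|i _]; last first.
  apply: is_symM => //; apply: is_symM; last exact: is_sym_eS.
  by apply: is_symM; [apply: is_symX; apply: is_symN; exact: is_sym1 | exact: is_sym_hS].
apply: eq_bigr => i _; have hi := ltn_ord i.
have sY : is_sym (eS (d - i)%N * X) by apply: is_symM => //; apply: is_sym_eS.
rewrite -!mulrA pr_signr; last by apply: is_symM => //; exact: is_sym_hS.
rewrite prT //; congr (_ * pr _ _ _); lia.
Qed.

(** The generating polynomial of the ways to lower e_z: the adjoint of e_d maps e_x e_y e_z to the
    sum of the e_{x-i} e_{y-j} e_{z-k} over i + j + k = d. *)
Definition Gp z : {poly R} := if z is Posz k then \poly_(i < k.+1) 1 else 0.
Arguments Gp : simpl never.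

Lemma Gp_rec z : Gp z - 'X * Gp (z - 1) = ((0 <= z)%R)%:R%:P.
Proof.
case: z => [[|k]|k].
- by rewrite /Gp /= mulr0 subr0; apply/polyP => i; rewrite coef_poly coefC; case: i.
- have -> : k.+1%:Z - 1 = k by lia.
  apply/polyP => -[|i]; rewrite /Gp coefB coefXM !coef_poly coefC /= ?subr0 //.
  by rewrite ltnS subrr.
- have -> : Negz k - 1 = Negz k.+1 by lia.
  by rewrite /Gp mulr0 subr0.
Qed.

(** All terms e_{x-i} e_{y-j} e_{z-k} with nonnegative indices pair with X to the same w, so only
    their number matters. In the induction on d, the terms T_1, T_2, T_3 of a product of three e's
    match the expansion of the product of three instances of [Gp_rec]. *)
Lemma pr_eee_gen X N w : is_sym X ->
  (forall x y z, x + y + z = N%:Z -> pr N (eS x * eS y * eS z) X = w * ([&& 0 <= x, 0 <= y & 0 <= z]%R)%:R) ->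
  forall d x y z, x + y + z = (N + d)%N%:Z ->
    pr (N + d) (eS x * eS y * eS z) (eS d * X) = w * (Gp x * Gp y * Gp z)`_d.
Proof.
move=> sX h0; elim/ltn_ind=> -[|d] IH x y z hs.
  rewrite addn0 in hs *; rewrite eS0 mul1r h0 //.
  have e u : (Gp u)`_0 = ((0 <= u)%R)%:R by case: u => [u|u]; rewrite /Gp ?coef_poly ?coef0.
  by rewrite !coef0M !e -!natrM !mulnb andbA.
have sE u v t : is_sym (eS u * eS v * eS t) by do 2?apply: is_symM; apply: is_sym_eS.
have T1 : (T 1 (eS x * eS y * eS z) : sring R) =
    eS (x - 1) * eS y * eS z + eS x * eS (y - 1) * eS z + eS x * eS y * eS (z - 1).
  by rewrite !TE; ring.
have T2 : (T 2 (eS x * eS y * eS z) : sring R) =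
    eS (x - 1) * eS (y - 1) * eS z + eS (x - 1) * eS y * eS (z - 1) + eS x * eS (y - 1) * eS (z - 1).
  by rewrite !TE; ring.
have T3 : (T 3 (eS x * eS y * eS z) : sring R) = eS (x - 1) * eS (y - 1) * eS (z - 1).
  by rewrite !TE; ring.
have sD u v t u' v' t' u'' v'' t'' : is_sym (eS u * eS v * eS t + eS u' * eS v' * eS t' + eS u'' * eS v'' * eS t'').
  by apply: is_symD; first apply: is_symD.
have p1 : pr (N + d) (T 1 (eS x * eS y * eS z) : sring R) (eS d * X) =
    w * (Gp (x - 1) * Gp y * Gp z + Gp x * Gp (y - 1) * Gp z + Gp x * Gp y * Gp (z - 1))`_d.
  by rewrite T1 !prDl ?IH ?coefD ?mulrDr //; [lia..|apply: is_symD].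
have p2 : (1 <= d)%N -> pr (N + d.-1) (T 2 (eS x * eS y * eS z) : sring R) (eS d.-1 * X) =
    w * (Gp (x - 1) * Gp (y - 1) * Gp z + Gp (x - 1) * Gp y * Gp (z - 1) + Gp x * Gp (y - 1) * Gp (z - 1))`_d.-1.
  by move=> hd; rewrite T2 !prDl ?IH ?coefD ?mulrDr //; [lia..|apply: is_symD].
have p3 : (2 <= d)%N -> pr (N + d.-2) (T 3 (eS x * eS y * eS z) : sring R) (eS d.-2 * X) =
    w * (Gp (x - 1) * Gp (y - 1) * Gp (z - 1))`_d.-2.
  by move=> hd; rewrite T3 IH //; lia.
have ex := Gp_rec x; have ey := Gp_rec y; have ez := Gp_rec z.
have eG : Gp x * Gp y * Gp z = (0 <= x)%R%:R%:P * (0 <= y)%R%:R%:P * (0 <= z)%R%:R%:P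
  + 'X * ((Gp (x - 1) * Gp y * Gp z + Gp x * Gp (y - 1) * Gp z + Gp x * Gp y * Gp (z - 1))
  - 'X * ((Gp (x - 1) * Gp (y - 1) * Gp z + Gp (x - 1) * Gp y * Gp (z - 1) + Gp x * Gp (y - 1) * Gp (z - 1))
  - 'X * (Gp (x - 1) * Gp (y - 1) * Gp (z - 1)))).
  rewrite -ex -ey -ez; ring.
rewrite eG -!polyCM coefD coefC /= add0r coefXM /= coefB coefXM coefB coefXM.
rewrite pr_eS_step // big_ord_recl expr0 mul1r subn0 p1 mulrBr; congr (_ + _).
case: d IH {hs} p2 p3 {p1} => [|d] IH p2 p3; first by rewrite big_ord0 /= mulr0 oppr0.
rewrite big_ord_recl /= /bump /= expr1 mulN1r subSS subn0 (p2 isT) /= !mulrBr opprB addrC; congr (_ - _).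
case: d IH {p2} p3 => [|d] IH p3; first by rewrite big_ord0 /= mulr0.
rewrite big_ord_recl /= /bump /= big1 => [|i _]; last by rewrite T_eee pr0 mulr0.
by rewrite addr0 !subSS subn0 (p3 isT) sqrrN expr1n mul1r.
Qed.

End ElementaryPairing.

Section ElementaryCoefficients.
Variable R : realType.
Implicit Types (a b c d i j k : nat) (x y z : int) (F G X : sring R).
Arguments eS : simpl never.
Arguments Gp : simpl never.
Notation eS := (@eS R).
Notation Gp := (@Gp R).

Lemma Gp_lead k : lead_coef (Gp k) = 1 /\ size (Gp k) = k.+1.
Proof. by rewrite /Gp lead_coef_poly ?size_poly_eq ?oner_eq0. Qed.

(** The case X = 1, in which c is the full degree of the product of the [Gp], so the coefficient is
    the leading one. *)
Lemma pr_e_top c x y z : x + y + z = c%:Z ->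
  pr c (eS x * eS y * eS z) (eS c) = 1 * ([&& 0 <= x, 0 <= y & 0 <= z]%R)%:R.
Proof.
move=> h; have := @pr_eee_gen R 1 0 1 (@is_sym1 R) _ c x y z; rewrite add0n mulr1 => -> //; last first.
  move=> u v t hs; rewrite -schur_nil pr_schur // hall_nil; last first.
    by do 2?apply: is_symM; apply: is_sym_eS.
  rewrite !serM_nil !eS_nil mul1r -!natrM !mulnb; congr (_%:R); congr nat_of_bool; lia.
rewrite !mul1r; case: x y z h => [x|x] [y|y] [z|z] h; rewrite ?[Gp (Negz _)]/Gp ?mul0r ?mulr0 ?mul0r ?coef0 //.
have [lx sx] := Gp_lead x; have [ly sy] := Gp_lead y; have [lz sz] := Gp_lead z.
have nx : Gp x != 0 by rewrite -size_poly_eq0 sx.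
have ny : Gp y != 0 by rewrite -size_poly_eq0 sy.
have nz : Gp z != 0 by rewrite -size_poly_eq0 sz.
have -> : c = (size (Gp x * Gp y * Gp z)).-1.
  by rewrite !size_mul ?mulf_neq0 // sx sy sz; lia.
by rewrite -lead_coefE !lead_coefM lx ly lz !mulr1.
Qed.

Lemma pr_eee c d x y z : x + y + z = (c + d)%N%:Z ->
  pr (c + d) (eS x * eS y * eS z) (eS d * eS c) = (Gp x * Gp y * Gp z)`_d.
Proof.
move=> h; rewrite (@pr_eee_gen R (eS c) c 1) ?mul1r //; first exact: is_sym_eS.
by move=> u v w; apply: pr_e_top.
Qed.

(* for [e = d.+1], the number of pairs [i <= y], [j <= z] with [i + j = d]; 0 for [e = 0] *)
Definition k2 (y z e : nat) : nat := (minn e y.+1 - (e - z.+1))%N.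

Lemma coef_GpM (y z d : nat) : (Gp y * Gp z)`_d = (k2 y z d.+1)%:R.
Proof.
have GpE k : Gp k = \poly_(i < k.+1) 1 by [].
elim: y => [|y IH].
  have -> : Gp 0%N = 1 by apply/polyP => i; rewrite GpE coef_poly coef1; case: i.
  rewrite mul1r GpE coef_poly /k2.
  have ifE (u : bool) : (if u then 1 else 0) = (u : nat)%:R :> R by case: u.
  by rewrite ifE; congr _%:R; lia.
have -> : Gp y.+1 = Gp y + 'X^(y.+1).
  apply/polyP => i; rewrite !GpE coefD !coef_poly coefXn [in LHS]ltnS leq_eqVlt ltnS [(i <= y)%N]leqNgt.
  by case: (ltngtP i y.+1) => h; rewrite /= ?addr0 ?add0r //; case: ltnP => //; lia.
rewrite mulrDl coefD IH coefXnM GpE coef_poly /k2.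
case: ltnP => h; first by rewrite addr0; congr _%:R; lia.
have ifE (u : bool) : (if u then 1 else 0) = (u : nat)%:R :> R by case: u.
by rewrite ifE -natrD; congr _%:R; lia.
Qed.

(** With two columns Jacobi-Trudi reads e_d e_c - e_{d-1} e_{c+1}, so the coefficient is that of X^d
    in (1 - X) Gp_x Gp_y Gp_z, where (1 - X) Gp_x = 1 - X^{x+1}. *)
Lemma hall_eee (x y z c d : nat) : (d <= c)%N -> (x + y + z = c + d)%N ->
  hall_schur (eS x * eS y * eS z) (mk3 c d 0) = (k2 y z d.+1)%:R - (k2 y z (d - x))%:R.
Proof.
move=> hdc hs; have hs' : x%:Z + y%:Z + z%:Z = (c + d)%N%:Z by lia.
rewrite -(@pr_schur R (c + d)); last by apply/partsP; split; rewrite ?mk3_part ?sumn_mk3 //; lia.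
have sE u v : is_sym (eS u * eS v) by apply: is_symM; apply: is_sym_eS.
have -> : (schur R (mk3 c d 0) : sring R) = eS d * eS c - eS (d%:Z - 1) * eS (c.+1).
  rewrite jacobi_trudi3 // /D3 (_ : (0%N%:Z - 1) = -1) // (_ : 0%N%:Z - 2 = -2) // !(@eS_neg R (- _)) // !mulr0.
  rewrite !subr0 !addr0 eS0 !mulr1; have -> : c%:Z + 1 = c.+1 by lia.
  by rewrite mulrC [eS _ * _]mulrC.
rewrite prDr //; last by apply: is_symN.
rewrite prNr // pr_eee //.
have -> : pr (c + d) (eS x * eS y * eS z) (eS (d%:Z - 1) * eS c.+1) = ('X * (Gp x * Gp y * Gp z))`_d.
  case: d hdc hs hs' => [|d] hdc hs hs'.
    by rewrite (@eS_neg R (0%N%:Z - 1)) // mul0r coefXM /= /pr big_seq big1 // => lam /partsP [pl _]; rewrite hall0 // mulr0.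
  have -> : d.+1%:Z - 1 = d by lia.
  have hN : (c + d.+1 = c.+1 + d)%N by lia.
  by rewrite coefXM /= hN pr_eee // -hN.
rewrite -coefB -[X in X - _]mul1r -mulrBl -mulrA.
have hx : (1 - 'X) * Gp x = 1 - 'X^(x.+1) :> {poly R}.
  apply/polyP => i; rewrite mulrBl mul1r !coefB coefXM coef1 coefXn /Gp !coef_poly.
  by case: i => [|i] /=; rewrite ?subr0 // sub0r eqSS !ltnS; case: (ltngtP i x) => h; rewrite ?subrr ?subr0 ?sub0r ?oppr0.
have -> : (1 - 'X) * (Gp x * (Gp y * Gp z)) = Gp y * Gp z - 'X^(x.+1) * (Gp y * Gp z).
  by rewrite [LHS]mulrA hx mulrBl mul1r.
rewrite coefB coefXnM !coef_GpM; congr (_ - _); case: ltnP => h.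
  by have -> : (d - x = 0)%N by lia; rewrite /k2 min0n sub0n.
by have -> : ((d - x.+1).+1 = d - x)%N by lia.
Qed.

End ElementaryCoefficients.

(** * The homomorphism f_p on elementary and complete functions *)

Section Homomorphism.
Variable R : realType.
Implicit Types (a b : seq nat) (c d i j k : nat) (x y z : int) (A B C F G X : sring R).
Implicit Types (p q : nat -> R).
Notation eS := (@eS R).
Notation hS := (@hS R).

(** The bound covers all integers z: for families [g] vanishing in negative degree the omitted terms
    are 0, and for negative z so are all terms kept. *)
Definition conv (g : int -> sring R) q z : sring R := \sum_(j < `|z|.+1) sC (q j) * g (z - j%:Z).

Section Conv.
Variable g : int -> sring R.
Hypotheses (g_neg : forall z, z < 0 -> g z = 0) (is_sym_g : forall z, is_sym (g z))
  (g_nil : forall z, g z [::] = (z == 0)%:R).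

Lemma conv_widen q z M : z < M%:Z -> conv g q z = \sum_(j < M) sC (q j) * g (z - j%:Z).
Proof.
have h0 (m n : nat) : z < n%:Z -> (n <= m)%N ->
    \sum_(j < m) sC (q j) * g (z - j%:Z) = \sum_(j < n) sC (q j) * g (z - j%:Z).
  move=> hz hmn; rewrite (big_ord_widen m (fun j : nat => sC (q j) * g (z - j%:Z)) hmn) [RHS]big_mkcond /=.
  apply: eq_bigr => j _; case: ltnP => // hj; rewrite g_neg ?mulr0 //; lia.
move=> hz; rewrite /conv; case: (leqP `|z|.+1 M) => h; first by rewrite -(h0 M `|z|.+1) //; lia.
by rewrite (h0 _ M) //; lia.
Qed.

Lemma conv_neg q z : z < 0 -> conv g q z = 0.
Proof. by move=> h; rewrite (@conv_widen _ _ 0) // big_ord0. Qed.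

Lemma is_sym_conv q z : is_sym (conv g q z).
Proof. by apply: is_sym_sum => i _ _; apply: is_symM; [apply: is_symC | apply: is_sym_g]. Qed.

Lemma T_conv q z j k : (forall y, (T j (g y) : sring R) = g (y - k%:Z)) ->
  (T j (conv g q z) : sring R) = conv g q (z - k%:Z).
Proof.
move=> hT; rewrite (@conv_widen _ (z - k%:Z) `|z|.+1); last by lia.
by rewrite T_sum; apply: eq_bigr => i _; rewrite T_C hT addrAC.
Qed.

Lemma conv_nil q (k : nat) : conv g q k [::] = q k.
Proof.
rewrite (@conv_widen _ _ k.+1) ?big_ord_recr //=; last by lia.
rewrite serD ser_sum big1 => [|i _]; last first.
  rewrite serCM g_nil; have -> : (k%:Z - i%:Z == 0) = false by have := ltn_ord i; lia.
  by rewrite mulr0.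
by rewrite serCM subrr g_nil mulr1 add0r.
Qed.

Lemma conv0 q : q 0%N = 1 -> conv g q 0 = g 0.
Proof.
move=> q0; rewrite (@conv_widen _ _ 1) // big_ord1 subr0 q0.
by apply: funext => a; rewrite serCM mul1r.
Qed.

End Conv.

Definition EE := conv eS.
Definition HH := conv hS.
Lemma EE_neg q z : z < 0 -> EE q z = 0. Proof. exact: conv_neg (@eS_neg R) q z. Qed.
Lemma HH_neg p z : z < 0 -> HH p z = 0. Proof. exact: conv_neg (@hS_neg R) p z. Qed.
Lemma is_sym_EE q z : is_sym (EE q z). Proof. exact: is_sym_conv (@is_sym_eS R) q z. Qed.
Lemma is_sym_HH p z : is_sym (HH p z). Proof. exact: is_sym_conv (@is_sym_hS R) p z. Qed.
Lemma EE_nil q k : EE q k [::] = q k. Proof. exact: conv_nil (@eS_neg R) (@eS_nil R) q k. Qed.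
Lemma HH_nil p k : HH p k [::] = p k. Proof. exact: conv_nil (@hS_neg R) (@hS_nil R) p k. Qed.

Lemma T1_EE q z : (T 1 (EE q z) : sring R) = EE q (z - 1).
Proof. by apply: (T_conv (@eS_neg R)) => y; rewrite T1_eS. Qed.

Lemma T2_EE q z j : (T j.+2 (EE q z) : sring R) = 0.
Proof. by rewrite T_sum big1 // => i _; rewrite T_C T2_eS mulr0. Qed.

Lemma T_HH p z j : (T j (HH p z) : sring R) = HH p (z - j%:Z).
Proof. by apply: (T_conv (@hS_neg R)) => y; rewrite T_hS. Qed.

Lemma EE0 q : q 0%N = 1 -> EE q 0 = 1.
Proof. by move=> q0; rewrite -eS0; apply: (conv0 (@eS_neg R)). Qed.

Lemma HH0 p : p 0%N = 1 -> HH p 0 = 1.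
Proof. by move=> p0; rewrite -hS0; apply: (conv0 (@hS_neg R)). Qed.

(* q(t) p(-t) = 1 *)
Definition inv_sign q p := forall k, \sum_(i < k.+1) (-1) ^+ i * q i * p (k - i)%N = (k == 0)%N%:R.

Lemma inv_sign_exists q : q 0%N = 1 -> exists p, p 0%N = 1 /\ inv_sign q p.
Proof.
move=> q0.
(* Each p_k depends on all earlier ones, so the whole initial segment is carried along as a list. *)
pose nx (s : seq R) := \sum_(i < size s) (-1) ^+ i * q i.+1 * nth 0 s (size s - i.+1).
pose pl k := iter k (fun s => rcons s (nx s)) [:: 1].
have spl k : size (pl k) = k.+1 by elim: k => //= k IH; rewrite size_rcons IH.
pose p k := nth 0 (pl k) k.
have plE k i : (i <= k)%N -> nth 0 (pl k) i = p i.
  elim: k => [|k IH]; first by case: i.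
  rewrite leq_eqVlt => /orP [/eqP -> //|hi]; rewrite [pl _]/= nth_rcons spl hi IH //.
have p0 : p 0%N = 1 by [].
have pS k : p k.+1 = \sum_(i < k.+1) (-1) ^+ i * q i.+1 * p (k - i)%N.
  rewrite {1}/p [pl _]/= nth_rcons spl ltnn eqxx /nx spl.
  by apply: eq_bigr => i _; rewrite subSS plE ?leq_subr.
exists p; split=> // -[|k]; first by rewrite big_ord1 expr0 q0 p0 !mul1r.
rewrite big_ord_recl q0 expr0 !mul1r subn0 pS -big_split /=; apply: big1 => i _.
by rewrite /bump add1n subSS exprS mulN1r !mulNr subrr.
Qed.

Lemma EEHH_nil q p : inv_sign q p -> forall K z, z < K%:Z ->
  \sum_(i < K) (-1) ^+ i * EE q i [::] * HH p (z - i%:Z) [::] = (z == 0)%:R.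
Proof.
move=> hqp K [k|k] hz; last first.
  by rewrite big1 // => i _; rewrite HH_neg ?ser0 ?mulr0 //; lia.
have hk : (k.+1 <= K)%N by lia.
rewrite -[RHS](hqp k) (big_ord_widen K (fun i : nat => (-1) ^+ i * q i * p (k - i)%N) hk) [RHS]big_mkcond /=.
apply: eq_bigr => i _; rewrite EE_nil; case: ltnP => hi; last by rewrite HH_neg ?ser0 ?mulr0 //; lia.
have -> : k%:Z - i%:Z = (k - i)%N by lia.
by rewrite HH_nil.
Qed.

Lemma EE_rec q p d : p 0%N = 1 -> inv_sign q p ->
  EE q d.+1 = \sum_(i < d.+1) (-1) ^+ i * HH p i.+1%:Z * EE q (d - i)%N.
Proof.
move=> p0 h; exact: (eh_recE (@EE_neg q) (@HH_neg p) (@is_sym_EE q) (@is_sym_HH p) (@T1_EE q) (@T2_EE q)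
  (@T_HH p) (EEHH_nil h) d (HH0 p0)).
Qed.

Lemma HH_rec q p d : q 0%N = 1 -> inv_sign q p ->
  HH p d.+1 = \sum_(i < d.+1) (-1) ^+ i * EE q i.+1%:Z * HH p (d - i)%N.
Proof.
move=> p0 h; exact: (eh_recH (@EE_neg q) (@HH_neg p) (@is_sym_EE q) (@is_sym_HH p) (@T1_EE q) (@T2_EE q)
  (@T_HH p) (EEHH_nil h) d (EE0 p0)).
Qed.

End Homomorphism.

(** * Multiplicativity of f_p *)

Section Representation.
Variable R : realType.
Implicit Types (a b : seq nat) (c d i j k : nat) (x y z : int) (F G X : sring R).
Implicit Types (p q : nat -> R).
Notation eS := (@eS R).
Notation hS := (@hS R).

Lemma serM_def F G a : (F * G) a = \sum_(b <- subexps a) F b * G (sdiffexp a b).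
Proof. by []. Qed.

Lemma T_hprod i b :
  (T i (hprod R b) : sring R) = \sum_(c <- subexps b | sumn c == i) (hprod R (sdiffexp b c) : sring R).
Proof.
apply: funext => a; rewrite ser_sum /T hprodC -[LHS]/(((hser R i : sring R) * hprod R a) b).
rewrite serM_def [RHS]big_mkcond; apply: eq_bigr => c _.
by rewrite /hser [hprod R a _]hprodC; case: eqP => _; rewrite ?mul1r ?mul0r.
Qed.

Definition gh p a : sring R := foldr (fun k G => HH p k * G) 1 a.

Lemma gh_cat p a b : gh p (a ++ b) = gh p a * gh p b.
Proof. by elim: a => [|k a IH] /=; rewrite ?mul1r // IH mulrA. Qed.

Lemma hprod_cat a b : (hprod R (a ++ b) : sring R) = (hprod R a : sring R) * hprod R b.
Proof.
elim: a => [|k a IH]; first by rewrite mul1r.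
by rewrite -[LHS]/((hser R k : sring R) * hprod R (a ++ b)) IH mulrA.
Qed.

(** Two readings of prod p(x_i) / prod (1 - x_i y_j): the coefficient of y^b is prod p(x_i) h_b(x),
    and the factor belonging to x_i is sum_k x_i^k sum_j p_j h_{k-j}(y). *)
Lemma pprod_hprod p a b : ((pprod p : sring R) * hprod R b) a = gh p a b.
Proof.
elim: a b => [|k a IH] b.
  rewrite serM_nil /pprod big_nil mul1r hprodC /=; by [].
have TQ j : (T j (pprod p) : sring R) = sC (p j) * pprod p.
  by apply: funext => c; rewrite serCM /T /pprod big_cons.
rewrite -[LHS]/((T k ((pprod p : sring R) * hprod R b) : sring R) a) T_mul /= ser_sum.
rewrite /HH (@conv_widen R hS (@hS_neg R) p k k.+1) ?mulr_suml ?ser_sum //; last by lia.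
apply: eq_bigr => -[j hj] _ /=; rewrite TQ -!mulrA !serCM; congr (_ * _).
have -> : k%:Z - j%:Z = (k - j)%N by lia.
rewrite T_hprod mulr_sumr ser_sum serM_def big_mkcond; apply: eq_bigr => c _.
by rewrite /hS /hser; case: eqP => _; rewrite ?mul1r ?mul0r // IH.
Qed.

(* [F'] is the image of [F] under the homomorphism h_k |-> sum_j p_j h_{k-j},
   which is f_p by [rep_perp] *)
Definition rep p F F' := exists s : seq (R * seq nat),
  F = \sum_(t <- s) sC t.1 * (hprod R t.2 : sring R) /\ F' = \sum_(t <- s) sC t.1 * gh p t.2.

Lemma sC1 : sC 1 = 1 :> sring R.
Proof. by apply: funext => a; rewrite -[LHS]mulr1 -[sC 1 a * 1]/(_) /sC /sscale mulr1 mul1r. Qed.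

Lemma sC_M (u v : R) : sC (u * v) = sC u * sC v :> sring R.
Proof. by apply: funext => a; rewrite serCM /sC /sscale mulrA. Qed.

Lemma sC_N (u : R) : sC (- u) = - sC u :> sring R.
Proof. by apply: funext => a; rewrite serN /sC /sscale mulNr. Qed.

Lemma rep_hprod p a : rep p (hprod R a) (gh p a).
Proof. by exists [:: (1, a)]; rewrite !big_seq1 /= sC1 !mul1r. Qed.

Lemma rep0 p : rep p 0 0.
Proof. by exists [::]; rewrite !big_nil. Qed.

Lemma rep1 p : rep p 1 1.
Proof. exact: (rep_hprod p [::]). Qed.

Lemma repD p F F' G G' : rep p F F' -> rep p G G' -> rep p (F + G) (F' + G').
Proof. by move=> [s [-> ->]] [t [-> ->]]; exists (s ++ t); rewrite !big_cat. Qed.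

Lemma repC p u F F' : rep p F F' -> rep p (sC u * F) (sC u * F').
Proof.
move=> [s [-> ->]]; exists [seq (u * t.1, t.2) | t <- s].
by rewrite !big_map !mulr_sumr; split; apply: eq_bigr => t _; rewrite sC_M mulrA.
Qed.

Lemma repN p F F' : rep p F F' -> rep p (- F) (- F').
Proof. by move/(repC (-1)); rewrite !sC_N !sC1 !mulN1r. Qed.

Lemma rep_sum p (I : Type) (r : seq I) (P : pred I) (FF GG : I -> sring R) :
  (forall i : I, P i -> rep p (FF i) (GG i)) ->
  rep p (\sum_(i <- r | P i) FF i) (\sum_(i <- r | P i) GG i).
Proof. by move=> h; apply: (big_ind2 (rep p)) => //; [apply: rep0 | move=> *; apply: repD]. Qed.

Lemma repM p F F' G G' : rep p F F' -> rep p G G' -> rep p (F * G) (F' * G').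
Proof.
move=> [s [-> ->]] [t [-> ->]]; rewrite !mulr_suml; apply: rep_sum => u _.
rewrite !mulr_sumr; apply: rep_sum => v _; rewrite -!mulrA; apply: repC.
by rewrite !mulrA ![_ * sC v.1]mulrC -!mulrA -gh_cat -hprod_cat; apply: repC; apply: rep_hprod.
Qed.

Lemma rep_sign p i F F' : rep p F F' -> rep p ((-1) ^+ i * F) ((-1) ^+ i * F').
Proof. by move=> h; elim: i => [|i IH]; rewrite ?mul1r // !exprS !mulN1r !mulNr; apply: repN. Qed.

Lemma rep_hS p z : rep p (hS z) (HH p z).
Proof.
case: z => k; last by rewrite hS_neg // HH_neg //; apply: rep0.
by have := rep_hprod p [:: k]; rewrite -[hprod R _]/((hser R k : sring R) * 1) /gh /= !mulr1.
Qed.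

Lemma rep_eS q p z : q 0%N = 1 -> p 0%N = 1 -> inv_sign q p -> rep p (eS z) (EE q z).
Proof.
move=> q0 p0 h; case: z => k; last by rewrite eS_neg // EE_neg //; apply: rep0.
elim/ltn_ind: k => -[|k] IH; first by rewrite eS0 EE0 //; apply: rep1.
rewrite eS_rec (EE_rec _ p0 h); apply: rep_sum => i _; rewrite -!mulrA; apply: rep_sign; apply: repM.
  exact: rep_hS.
by apply: IH; rewrite ltnS leq_subr.
Qed.

Lemma hall_hprod a lam : is_part lam -> hall_schur (hprod R a) lam = schur R lam a.
Proof.
by move=> pl; have := @hall_schur_hprod R [::] a lam isT pl; rewrite schur_nil mul1r.
Qed.

(** Along any expression of s_lam through the h_a, the functional on symmetric series that sums t_1
    Y[t_2] is the pairing with s_lam. So the image does not depend on the expression, and the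
    relation [rep] can replace a map on all of Lambda. *)
Lemma rep_perp p F' lam : p 0%N = 1 -> is_part lam -> rep p (schur R lam) F' -> F' = perp_schur (pprod p) lam.
Proof.
move=> p0 pl [s [eF eF']]; apply: funext => b.
have sQ : is_sym (pprod p) := is_sym_pprod p0.
rewrite -hall_hprodM //; set Y : sring R := (pprod p : sring R) * _.
have sY : is_sym Y by apply: is_symM => //; apply: is_sym_hprod.
(* The expression need not be homogeneous, so N exceeds every degree that occurs in it. *)
pose N := (sumn lam + \sum_(t <- s) sumn t.2).+1.
have hN t : t \in s -> (sumn t.2 < N)%N.
  move=> ht; rewrite ltnS; apply: leq_trans (leq_addl _ _).
  by rewrite (big_rem t ht) leq_addr.
have eY (a : seq nat) : (sumn a < N)%N -> Y a = \sum_(n < N) \sum_(tau <- parts n) hall_schur Y tau * schur R tau a.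
  move=> ha; rewrite (bigD1 (Ordinal ha)) //= [X in _ + X]big1 ?addr0 ?(hallE sY) // => n hn.
  rewrite big_seq big1 // => tau /partsP [pt st]; rewrite schur_deg ?mulr0 // st => e.
  by move/eqP: hn; apply; apply: val_inj.
have hx tau : is_part tau -> \sum_(t <- s) t.1 * schur R tau t.2 = (lam == tau)%:R.
  move=> pt; rewrite -hall_schurE // eF hall_sum // => [|t _]; last exact: is_sym_hprod.
  by apply: eq_bigr => t _; rewrite hall_hprod.
transitivity (\sum_(t <- s) t.1 * Y t.2).
  by rewrite eF' ser_sum; apply: eq_bigr => t _; rewrite serCM -pprod_hprod.
transitivity (\sum_(n < N) \sum_(tau <- parts n) hall_schur Y tau * (lam == tau)%:R).
  under eq_big_seq => t /hN ht do rewrite eY // mulr_sumr.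
  rewrite exchange_big /=; apply: eq_bigr => n _.
  under eq_bigr do rewrite mulr_sumr.
  rewrite exchange_big /=; apply: eq_big_seq => tau /partsP [pt _]; rewrite -hx // mulr_sumr.
  by apply: eq_bigr => t _; rewrite mulrCA.
have hl : (sumn lam < N)%N by rewrite ltnS leq_addr.
rewrite (bigD1 (Ordinal hl)) //= [X in _ + X]big1 ?addr0 => [|n hn].
  rewrite (bigD1_seq lam) ?uniq_parts //=; last by apply/partsP.
  rewrite eqxx mulr1 big1 ?addr0 // => tau ht; by rewrite eq_sym (negbTE ht) mulr0.
rewrite big_seq big1 // => tau /partsP [pt st]; case: eqP => [e|_]; rewrite ?mulr0 //.
by case/eqP: hn; apply: val_inj; rewrite /= e st.
Qed.

Section LambdaHom.

Lemma in_Lambda_0 : in_Lambda (0 : sring R).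
Proof. by split; [move=> a b _; rewrite !ser0 | exists 0%N]. Qed.

Lemma in_Lambda_D F G : in_Lambda F -> in_Lambda G -> in_Lambda (F + G).
Proof.
move=> [s1 [d hd]] [s2 [d' hd']]; split; first exact: is_symD.
by exists (maxn d d') => a; rewrite gtn_max => /andP [h1 h2]; rewrite serD hd // hd' // addr0.
Qed.

Lemma in_Lambda_M F G : in_Lambda F -> in_Lambda G -> in_Lambda (F * G).
Proof.
move=> [s1 [d hd]] [s2 [d' hd']]; split; first exact: is_symM.
exists (d + d')%N => a ha; rewrite serM_def big_seq big1 // => b hb.
have := mem_subexps_sum hb; case: (leqP (sumn b) d) => h1 h2; last by rewrite hd // mul0r.
by rewrite hd' ?mulr0 //; lia.
Qed.

Lemma in_Lambda_1 : in_Lambda (1 : sring R).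
Proof. by split; [exact: is_sym1 | exists 0%N => a; rewrite lt0n => /negbTE h; rewrite -[LHS]/((sumn a == 0%N)%:R) h]. Qed.

Lemma in_Lambda_C u F : in_Lambda F -> in_Lambda (sC u * F).
Proof.
move=> [s1 [d hd]]; split; first by apply: is_symM => //; apply: is_symC.
by exists d => a ha; rewrite serCM hd // mulr0.
Qed.

Lemma in_Lambda_N F : in_Lambda F -> in_Lambda (- F).
Proof. by move/(in_Lambda_C (-1)); rewrite sC_N sC1 mulN1r. Qed.

Lemma in_Lambda_sign i F : in_Lambda F -> in_Lambda ((-1) ^+ i * F).
Proof. by move=> h; apply: in_Lambda_M => //; elim: i => [|i IH]; [exact: in_Lambda_1 | rewrite exprS mulN1r; apply: in_Lambda_N]. Qed.

Lemma in_Lambda_hprod a : in_Lambda (hprod R a).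
Proof.
split; first exact: is_sym_hprod.
by exists (sumn a) => b hb; apply: hprod_deg => e; rewrite e ltnn in hb.
Qed.

Lemma in_Lambda_schur lam : is_part lam -> in_Lambda (schur R lam).
Proof.
move=> pl; split; first exact: is_sym_schur.
by exists (sumn lam) => b hb; apply: schur_deg => // e; rewrite e ltnn in hb.
Qed.

Lemma in_Lambda_eS z : in_Lambda (eS z).
Proof. by case: z => k; [apply: in_Lambda_schur; apply: is_part_nseq1 | exact: in_Lambda_0]. Qed.

Lemma in_Lambda_hS z : in_Lambda (hS z).
Proof.
case: z => k; last exact: in_Lambda_0.
by split; [exact: is_sym_hS | exists k => b hb; rewrite /hS /hser gtn_eqF].
Qed.

Variable f : sring R -> sring R.
Hypothesis hf : lin_ring_hom (f : series R -> series R).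

Lemma homD F G : in_Lambda F -> in_Lambda G -> f (F + G) = f F + f G.
Proof. by case: hf => _ h _ _ _; apply: h. Qed.

Lemma homM F G : in_Lambda F -> in_Lambda G -> f (F * G) = f F * f G.
Proof. by case: hf => _ _ _ h _; apply: h. Qed.

Lemma homC u F : in_Lambda F -> f (sC u * F) = sC u * f F.
Proof. by case: hf => _ _ h _ _ LF; rewrite -!sscaleE; apply: h. Qed.

Lemma hom1 : f 1 = 1.
Proof. by case: hf. Qed.

Lemma homN F : in_Lambda F -> f (- F) = - f F.
Proof. by move/(homC (-1)); rewrite !sC_N !sC1 !mulN1r. Qed.

Lemma hom0 : f 0 = 0.
Proof.
by have := homC 0 in_Lambda_0; rewrite mulr0 => ->; apply: funext => a; rewrite serCM mul0r.
Qed.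

Lemma hom_sum (I : Type) (r : seq I) (P : pred I) (FF : I -> sring R) :
  (forall i : I, P i -> in_Lambda (FF i)) -> f (\sum_(i <- r | P i) FF i) = \sum_(i <- r | P i) f (FF i).
Proof.
move=> h.
have : in_Lambda (\sum_(i <- r | P i) FF i) /\ f (\sum_(i <- r | P i) FF i) = \sum_(i <- r | P i) f (FF i).
  apply: (big_ind2 (fun F G => in_Lambda F /\ f F = G)).
  - by split; [exact: in_Lambda_0 | exact: hom0].
  - by move=> G1 u1 G2 u2 [s1 <-] [s2 <-]; split; [apply: in_Lambda_D | rewrite homD].
  - by move=> i hi; split=> //; apply: h.
by case.
Qed.

Lemma hom_sign i F : in_Lambda F -> f ((-1) ^+ i * F) = (-1) ^+ i * f F.
Proof.
move=> h; elim: i => [|i IH]; first by rewrite !mul1r.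
by rewrite !exprS -!mulrA !mulN1r homN ?IH //; apply: in_Lambda_sign.
Qed.

Variable p : nat -> R.
Hypotheses (p0 : p 0%N = 1) (hfh : forall k, f (hS k) = HH p k).

Lemma hom_hprod a : f (hprod R a) = gh p a.
Proof.
elim: a => [|k a IH]; first exact: hom1.
by rewrite [LHS](homM (in_Lambda_hS k) (in_Lambda_hprod a)) IH hfh.
Qed.

Lemma hom_schur lam : is_part lam -> f (schur R lam) = perp_schur (pprod p) lam.
Proof.
move=> pl; have [x [e _]] := @schur_hprod R lam pl.
apply: rep_perp => //; exists [seq (x b, b) | b <- parts (sumn lam)]; rewrite !big_map /=; split=> //.
rewrite e hom_sum => [|b _]; last by apply: in_Lambda_C; apply: in_Lambda_hprod.
by apply: eq_bigr => b _; rewrite homC ?hom_hprod //; apply: in_Lambda_hprod.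
Qed.

End LambdaHom.

End Representation.

(** * Leading forms *)

Section LeadingForms.
Variable R : realType.
Implicit Types (a b : seq nat) (c d i j k n : nat) (x y z s t : int) (F G X : sring R).
Notation eS := (@eS R).

Lemma perp_top F lam b : is_sym F -> is_part lam -> (sumn lam <= sumn b)%N ->
  perp_schur F lam b = F [::] * schur R lam b.
Proof.
move=> sF pl hb; rewrite perp_schurE ser_sum big_ord_recl [X in _ + X]big1 ?addr0 => [|i _]; last first.
  rewrite ser_sum big_seq big1 // => th /partsP [pt st]; rewrite serCM.
  case: (eqVneq (skew_schur R lam th b) 0) => [->|/(skew_deg pl)]; first by rewrite mulr0.
  have -> : sumn th = i.+1 by rewrite st.
  by lia.
by rewrite /= big_seq1 serCM hall_nil.
Qed.

Lemma sp_top mu b : is_part mu -> (sumn mu <= sumn b)%N -> sp R mu b = schur R mu b.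
Proof.
by move=> pm h; rewrite spE // perp_top ?Pser_nil ?mul1r //; exact: is_sym_Pser.
Qed.

(** sp_nu is s_nu plus terms of lower degree, so the top degree of a combination of the sp_nu is
    read off in the Schur basis. *)
Lemma sp_sum_at lam (x : seq nat -> R) k b : (forall nu, is_part nu -> (k < sumn nu <= sumn lam)%N -> x nu = 0) ->
  (k <= sumn lam)%N -> sumn b = k -> sp_sum lam x b = \sum_(nu <- parts k) x nu * schur R nu b.
Proof.
move=> h0 hk hb; have hk' : (k < (sumn lam).+1)%N by [].
rewrite /sp_sum (bigD1 (Ordinal hk')) //= [X in _ + X]big1 ?addr0 => [|n hn].
  by apply: eq_big_seq => nu /partsP [pn sn]; rewrite sp_top // sn hb.
rewrite big_seq big1 // => nu /partsP [pn sn].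
have nk : (n : nat) != k by apply: contra hn => /eqP e; apply/eqP/val_inj.
case: (ltngtP n k) nk => // hnk _; last by rewrite h0 ?mul0r // sn hnk -ltnS ltn_ord.
by rewrite sp_top ?schur_deg ?mulr0 //; [rewrite sn hb; lia | rewrite sn hb; lia].
Qed.

Lemma sp_sum_high lam (x : seq nat -> R) N : (forall b, (N < sumn b)%N -> sp_sum lam x b = 0) ->
  forall nu, is_part nu -> (N < sumn nu <= sumn lam)%N -> x nu = 0.
Proof.
move=> h nu pn; have [m hm] : {m | m = (sumn lam - sumn nu)%N} by exists (sumn lam - sumn nu)%N.
elim/ltn_ind: m nu pn hm => m IH nu pn hm /andP [h1 h2].
apply: (@kostka_inj R (sumn nu) x); last by apply/partsP.
move=> mu /partsP [pm sm]; rewrite -(@sp_sum_at lam x (sumn nu) mu) ?h ?sm // => nu' pn' /andP [h3 h4].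
by apply: (IH (sumn lam - sumn nu')%N) => //; lia.
Qed.

(* [F] has degree at most [s], and [F'] is its component of degree [s] *)
Definition lead s F F' := forall b,
  (s < (sumn b)%:Z -> F b = 0) /\ F' b = (if s == (sumn b)%:Z then F b else 0).

Lemma leadD s F F' G G' : lead s F F' -> lead s G G' -> lead s (F + G) (F' + G').
Proof.
move=> h1 h2 b; have [h3 h4] := h1 b; have [h5 h6] := h2 b; split.
  by move=> h; rewrite serD h3 // h5 // addr0.
by rewrite !serD h4 h6; case: ifP; rewrite ?addr0.
Qed.

Lemma leadN s F F' : lead s F F' -> lead s (- F) (- F').
Proof.
move=> h1 b; have [h3 h4] := h1 b; split; first by move=> h; rewrite serN h3 // oppr0.
by rewrite !serN h4; case: ifP; rewrite ?oppr0.
Qed.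

Lemma leadC s u F F' : lead s F F' -> lead s (sC u * F) (sC u * F').
Proof.
move=> h1 b; have [h3 h4] := h1 b; split; first by move=> h; rewrite serCM h3 // mulr0.
by rewrite !serCM h4; case: ifP; rewrite ?mulr0.
Qed.

Lemma leadM s t F F' G G' : lead s F F' -> lead t G G' -> lead (s + t) (F * G) (F' * G').
Proof.
move=> h1 h2 b; split.
  move=> h; rewrite serM_def big_seq big1 // => c hc.
  have hs := mem_subexps_sum hc; have [h3 _] := h1 c; have [h5 _] := h2 (sdiffexp b c).
  by case: (ltP s (sumn c)%:Z) => hh; [rewrite h3 // mul0r | rewrite h5 ?mulr0 //; lia].
rewrite !serM_def; case: eqP => hst; last first.
  rewrite big_seq big1 // => c hc.
  have hs := mem_subexps_sum hc; have [h3 h4] := h1 c; have [h5 h6] := h2 (sdiffexp b c).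
  by rewrite h4 h6; case: eqP => e1; case: eqP => e2; rewrite ?mul0r ?mulr0 //; lia.
apply: eq_big_seq => c hc.
have hs := mem_subexps_sum hc; have [h3 h4] := h1 c; have [h5 h6] := h2 (sdiffexp b c).
rewrite h4 h6; case: eqP => e1; case: eqP => e2 //; first by lia.
  by lia.
by rewrite mul0r; case: (ltP s (sumn c)%:Z) => hh; [rewrite h3 // mul0r | rewrite h5 ?mulr0 //; lia].
Qed.

Lemma lead0 s : lead s 0 0.
Proof. by move=> b; split; rewrite ?ser0 //; case: ifP. Qed.

Lemma lead_widen s t F F' : lead s F F' -> s < t -> lead t F 0.
Proof.
move=> h hst b; have [h3 h4] := h b; split; first by move=> h'; apply: h3; lia.
by case: eqP => // e; rewrite h3 ?ser0 //; lia.
Qed.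

Lemma lead_eS z : lead z (eS z) (eS z).
Proof.
move=> b; case: z => k; last by split=> // ; case: ifP.
have h : k%:Z <> sumn b -> eS k b = 0.
  move=> e; apply: schur_deg; rewrite ?is_part_nseq1 // sumn_nseq mul1n => e'; by apply: e; rewrite e'.
by split=> [h1|]; [apply: h => e; rewrite e ltxx in h1 | case: eqP => // /h].
Qed.

Lemma lead_conv (g : int -> sring R) (g' : int -> sring R) q z : q 0%N = 1 ->
  (forall z, lead z (g z) (g' z)) -> lead z (conv g q z) (g' z).
Proof.
move=> q0 hg; rewrite /conv big_ord_recl subr0 q0 sC1 mul1r -[g' z]addr0; apply: leadD => //.
apply: (big_ind (fun F => lead z F 0)); first exact: lead0.
  by move=> F G hF hG; rewrite -[0]addr0; apply: leadD.
move=> i _; rewrite -[0](mulr0 (sC (q (bump 0 i)))); apply: leadC; apply: lead_widen (hg _) _.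
have -> : (lift ord0 i : nat) = i.+1 by [].
by lia.
Qed.

(** Used with N = |lam| - n to extract coefficients from the leading form of f - f_p. *)
Lemma lead_hall lam (x y : seq nat -> R) N F' mu : is_sym F' -> mu \in parts N -> (N <= sumn lam)%N ->
  lead N (sp_sum lam x - sp_sum lam y) F' -> x mu - y mu = hall_schur F' mu.
Proof.
move=> sF' hmu hN hl; pose w nu := x nu - y nu.
have ew b : (sp_sum lam x - sp_sum lam y) b = sp_sum lam w b.
  rewrite serD serN /sp_sum -sumrB; apply: eq_bigr => n _; rewrite -sumrB; apply: eq_bigr => nu _.
  by rewrite -mulrBl.
have w0 nu : is_part nu -> (N < sumn nu <= sumn lam)%N -> w nu = 0.
  by apply: sp_sum_high => b hb; rewrite -ew; have [-> //] := hl b; lia.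
rewrite -[LHS]/(w mu); apply/esym; apply: (@hall_eq R F' w N) => // a ha.
have [_ ->] := hl a; rewrite ha eqxx ew; exact: sp_sum_at.
Qed.

End LeadingForms.

(** * Common rows and images of elementary functions *)

Section ElementarySpan.
Variable R : realType.
Implicit Types (a b : seq nat) (d i j k n : nat) (x y z s t : int) (F G X : sring R).
Notation eS := (@eS R).

Lemma skew_same (x : nat) (lam mu : seq nat) : is_part (x :: lam) -> is_part (x :: mu) ->
  skew_schur R (x :: lam) (x :: mu) = skew_schur R lam mu.
Proof.
move=> pl pm; apply: funext => a; elim: a lam pl => [|k a IH] lam pl.
  by rewrite /skew_schur /= eqseq_cons eqxx.
have := pl; rewrite is_part_cons => /and3P [x0 hx pl'].
rewrite -[LHS]/((T k (skew_schur R (x :: lam) (x :: mu)) : sring R) a).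
rewrite -[RHS]/((T k (skew_schur R lam mu) : sring R) a) !T_skew // !ser_sum.
rewrite (bigID (fun rho => head 0%N rho == x)) /= [X in _ + X]big_seq_cond [X in _ + X]big1 ?addr0.
  rewrite -big_filter (perm_big [seq x :: rho | rho <- strips lam k]).
    rewrite big_map; apply: eq_big_seq => rho; rewrite mem_strips // => /and3P [pr hs _].
    rewrite IH // is_part_cons x0 pr andbT /=; apply: leq_trans hx.
    by have /hsP /(_ 0%N) /andP [_] := hs; rewrite !nth0.
  apply: uniq_perm; first by rewrite filter_uniq ?uniq_strips.
    by rewrite map_inj_uniq ?uniq_strips // => u v [].
  have key rho : (x :: rho \in strips (x :: lam) k) = (rho \in strips lam k).
    rewrite !mem_strips // is_part_cons x0 /=.
    have -> : (x + sumn rho + k == x + sumn lam)%N = (sumn rho + k == sumn lam)%N by rewrite -addnA eqn_add2l.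
    case: (boolP (is_part rho)) => pr; rewrite ?andbF // andbT /=.
    have -> : hs (x :: lam) (x :: rho) = hs lam rho.
      apply/hsP/hsP => h i; first exact: (h i.+1).
      by case: i => [|i] /=; rewrite ?leqnn ?andbT ?nth0.
    case: (boolP (hs lam rho)) => [/hsP /(_ 0%N)|_]; rewrite ?andbF // !nth0 => /andP [_ h].
    by rewrite (leq_trans h hx).
  move=> rho; rewrite mem_filter; apply/andP/mapP => [[/eqP h1 h2]|[r hr ->]]; last by rewrite key.
  case: rho h1 h2 => [h1|y rho h1 h2]; first by move: x0; rewrite -h1.
  have e : y = x := h1; move: h2; rewrite e => h2.
  by exists rho => //; rewrite -key.
move=> rho /andP [hr hh]; apply/eqP; move: hr; rewrite mem_strips // => /and3P [pr hs _].
apply: contraR hh => /(skew_contained pr) /(_ 0%N); rewrite /= nth0 => h.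
by have /hsP /(_ 0%N) /andP [_] := hs; rewrite !nth0 /= eqn_leq h => ->.
Qed.

Lemma hall_perp_skew F lam mu : is_sym F -> is_part lam -> is_part mu -> (sumn mu <= sumn lam)%N ->
  hall_schur (perp_schur F lam) mu =
  \sum_(th <- parts (sumn lam - sumn mu)) hall_schur F th * hall_schur (skew_schur R lam mu) th.
Proof.
move=> sF pl pm hle.
have e n th : th \in parts n -> hall_schur ((schur R th : sring R) * schur R mu) lam = hall_schur (skew_schur R lam mu) th.
  by move=> /partsP [pt _]; rewrite mulrC hall_schurM.
rewrite hall_perp // hallM //; last exact: is_sym_schur.
have hd : (sumn lam - sumn mu < (sumn lam).+1)%N by rewrite ltnS leq_subr.
rewrite (bigD1 (Ordinal hd)) //= [X in _ + X]big1 ?addr0 => [|n hn].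
  by apply: eq_big_seq => th /e ->.
rewrite big_seq big1 // => th /[dup] ht /e ->; have /partsP [pt st] := ht.
rewrite hall_skew_deg ?mulr0 // => h; case/eqP: hn; apply: val_inj => /=.
by rewrite -st -h addnK.
Qed.

(** This keeps the contribution of f_p constant along the families of shapes from which the bounds
    on u are derived. *)
Lemma hall_perp_same F (x : nat) lam mu : is_sym F -> is_part (x :: lam) -> is_part (x :: mu) ->
  (sumn mu <= sumn lam)%N ->
  hall_schur (perp_schur F (x :: lam)) (x :: mu) = hall_schur (perp_schur F lam) mu.
Proof.
move=> sF pl pm hle; have := pl; have := pm; rewrite !is_part_cons => /and3P [_ _ pm'] /and3P [_ _ pl'].
rewrite !hall_perp_skew //= ?leq_add2l // subnDl; apply: eq_bigr => th _; by rewrite skew_same.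
Qed.

Lemma skew_nseq1 n i : (i <= n)%N -> skew_schur R (nseq n 1%N) (nseq i 1%N) = eS (n - i)%N.
Proof.
elim: i n => [|i IH] [|n] //= h; rewrite skew_same ?IH //;
  by apply: (is_part_nseq1 _.+1).
Qed.

Lemma contained_nseq1 th n : is_part th -> contained th (nseq n 1%N) -> th = nseq (sumn th) 1%N /\ (sumn th <= n)%N.
Proof.
elim: th n => [|x th IH] n; first by [].
rewrite is_part_cons => /and3P [x0 hx pt] hc; have := hc 0%N; case: n hc => [|n] hc /=; first by rewrite leqn0 => /eqP xz; rewrite xz in x0.
move=> x1; have ex : x = 1%N by lia.
by have [|e1 e2] := IH n pt; [move=> i; have := hc i.+1 | rewrite ex /= -e1; split; rewrite // add1n ltnS].
Qed.

Lemma perp_nseq1 F n : is_sym F -> perp_schur F (nseq n 1%N) = conv eS (fun i => hall_schur F (nseq i 1%N)) n.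
Proof.
move=> sF; rewrite perp_schurE sumn_nseq mul1n (@conv_widen _ _ (@eS_neg R) _ n n.+1); last by lia.
apply: eq_bigr => i _; have hi := ltn_ord i.
have hp : nseq i 1%N \in parts i by apply/partsP; split; rewrite ?is_part_nseq1 // sumn_nseq mul1n.
rewrite (bigD1_seq _ hp) ?uniq_parts //= big_seq_cond big1 ?addr0 => [|th /andP [/partsP [pt st] hth]].
  by rewrite skew_nseq1 //; have -> : n%:Z - i%:Z = (n - i)%N by lia.
have -> : skew_schur R (nseq n 1%N) th = (0 : sring R).
  apply: funext => b; apply/eqP; apply: contraNT hth => /(skew_contained (is_part_nseq1 n)).
  by move/(contained_nseq1 pt) => [-> _]; rewrite st.
by rewrite mulr0.
Qed.

(** The first partial sum forces all parts to be 1, and the last one bounds their number. *)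
Lemma dom_lt_nseq1 nu k : is_part nu -> dom_lt nu (nseq k 1%N) -> nu = nseq (sumn nu) 1%N /\ (sumn nu <= k)%N.
Proof.
move=> pn /andP [/allP h _]; apply: contained_nseq1 => // i.
have [hi|hi] := ltnP i (size nu); last by rewrite nth_default.
have h0 : (head 0%N nu <= 1)%N.
  have := h 1%N; rewrite mem_iota /=; case: nu {pn} h hi => //= x nu h _ /(_ isT).
  by rewrite take0 addn0; case: (k) => [|k'] /=; rewrite ?take0 //; lia.
have hn : (nth 0%N nu i <= 1)%N by apply: leq_trans h0; rewrite -nth0; apply: part_anti.
have hik : (i < k)%N.
  have := h (size nu); rewrite mem_iota take_size.
  have hs : (size nu <= sumn nu)%N by apply: size_part.
  move=> /(_ ltac:(lia)) hh.
  have : (sumn (take (size nu) (nseq k 1%N)) <= sumn (nseq k 1%N))%N.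
    by rewrite -[X in (_ <= sumn X)%N](cat_take_drop (size nu)) sumn_cat; apply: leq_addr.
  by rewrite sumn_nseq mul1n; lia.
by rewrite nth_nseq hik.
Qed.

Definition espan k F := exists c : nat -> R, F = conv eS c k.

Lemma espan0 k : espan k 0.
Proof.
exists (fun _ => 0); rewrite /conv big1 // => i _.
by apply: funext => b; rewrite serCM mul0r.
Qed.

Lemma espanD k F G : espan k F -> espan k G -> espan k (F + G).
Proof.
move=> [c ->] [c' ->]; exists (fun i => c i + c' i); rewrite /conv -big_split /=; apply: eq_bigr => i _.
by apply: funext => b; rewrite serD !serCM mulrDl.
Qed.

Lemma espanC k u F : espan k F -> espan k (sC u * F).
Proof.
move=> [c ->]; exists (fun i => u * c i); rewrite /conv mulr_sumr; apply: eq_bigr => i _.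
by rewrite sC_M mulrA.
Qed.

Lemma espan_le k n F : (n <= k)%N -> espan n F -> espan k F.
Proof.
move=> hnk [c ->]; exists (fun i => if (k - n <= i)%N then c (i - (k - n))%N else 0).
have e : k.+1 = ((k - n) + n.+1)%N by lia.
rewrite (@conv_widen _ _ (@eS_neg R) c n n.+1); last by lia.
rewrite (@conv_widen _ _ (@eS_neg R) _ k k.+1); last by lia.
rewrite e big_split_ord /= [X in _ = X + _]big1 ?add0r => [|i _].
  apply: eq_bigr => i _; rewrite leq_addr addnC addnK; have hi := ltn_ord i.
  by have -> : n%:Z - i%:Z = k%:Z - (i + (k - n))%N%:Z by lia.
rewrite leqNgt ltn_ord /=; by apply: funext => b; rewrite serCM mul0r.
Qed.

Variables (f : sring R -> sring R) (m : seq nat -> seq nat -> R).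
Hypothesis fm : forall lam, is_part lam -> f (schur R lam) = sp_sum lam (mt m lam).

(** Only columns lie below a column, and sp of a column is a combination of e's. The coefficient of
    x_1 ... x_k gives c_0 = 1. *)
Lemma hom_eS k : exists c : nat -> R, c 0%N = 1 /\ f (eS k) = EE c k.
Proof.
have p1 := is_part_nseq1 k; have s1 : sumn (nseq k 1%N) = k by rewrite sumn_nseq mul1n.
have [c hc] : espan k (f (eS k)).
  rewrite fm // /sp_sum s1.
  have -> : (fun b => \sum_(n < k.+1) \sum_(nu <- parts n) mt m (nseq k 1%N) nu * sp R nu b) =
     \sum_(n < k.+1) \sum_(nu <- parts n) sC (mt m (nseq k 1%N) nu) * sp R nu.
    apply: funext => b; rewrite ser_sum; apply: eq_bigr => n _; rewrite ser_sum.
    by apply: eq_bigr => nu _; rewrite serCM.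
  apply: (big_ind (espan k)); [exact: espan0 | by move=> *; apply: espanD |].
  move=> n _; rewrite big_seq; apply: (big_ind (espan k)); [exact: espan0 | by move=> *; apply: espanD |].
  move=> nu /partsP [pn sn]; case: (eqVneq (mt m (nseq k 1%N) nu) 0) => [->|hne].
    have -> : sC 0 * sp R nu = 0 by apply: funext => b; rewrite serCM mul0r.
    exact: espan0.
  apply: espanC; apply: (@espan_le k (sumn nu)); first by rewrite sn -ltnS ltn_ord.
  have -> : nu = nseq (sumn nu) 1%N.
    move: hne; rewrite /mt; case: (nu =P nseq k 1%N) => [-> _|_]; first by rewrite s1.
    by case: ifP => [/(dom_lt_nseq1 pn) [e _] _|_]; rewrite ?eqxx.
  rewrite sumn_nseq mul1n spE ?is_part_nseq1 // perp_nseq1; last exact: is_sym_Pser.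
  by eexists.
exists c; split=> //.
have ev : f (eS k) (nseq k 1%N) = 1.
  rewrite fm // (@sp_sum_at _ _ _ k) ?s1 // => [|nu pn]; last by lia.
  have hp : nseq k 1%N \in parts k by apply/partsP.
  rewrite (bigD1_seq _ hp) ?uniq_parts //= big_seq_cond big1 ?addr0 => [|nu /andP [/partsP [pn sn] hn]].
    by rewrite /mt eqxx mul1r schur_rev // kostka_diag.
  rewrite /mt (negbTE hn); case: ifP => [/(dom_lt_nseq1 pn) [e _]|_]; last by rewrite mul0r.
  by case/eqP: hn; rewrite e sn.
rewrite -ev hc (@conv_widen _ _ (@eS_neg R) _ k k.+1); last by lia.
rewrite ser_sum big_ord_recl big1 ?addr0 => [|i _].
  by rewrite serCM ?subr0 -[eS k]/(schur R (nseq k 1%N)) schur_rev // kostka_diag // mulr1.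
have hi := ltn_ord i; have -> : k%:Z - (lift ord0 i : nat)%:Z = (k - i.+1)%N.
  have -> : (lift ord0 i : nat) = i.+1 by []. lia.
rewrite serCM /eS schur_deg ?mulr0 ?is_part_nseq1 //.
by rewrite s1 sumn_nseq mul1n; lia.
Qed.

End ElementarySpan.

(** * The coefficients c_{k,i} *)

Section InductionStep.
Variable R : realType.
Implicit Types (d i j k : nat) (x y z s t : int) (F G X : sring R).
Notation eS := (@eS R).
Variables (f : sring R -> sring R) (m : seq nat -> seq nat -> R).
Hypothesis hf : lin_ring_hom (f : series R -> series R).
Hypothesis fm : forall lam, is_part lam -> f (schur R lam) = sp_sum lam (mt m lam).
Hypothesis m_ge0 : forall lam mu, is_part lam -> is_part mu -> dom_lt mu lam -> 0 <= m lam mu.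
Variable C : nat -> nat -> R.
Hypotheses (C0 : forall k, C k 0%N = 1) (fC : forall k, f (eS k) = EE (C k) k).
Let q n := C n n.
Variable n : nat.
Hypotheses (IHn : forall i k, (i < n)%N -> (i <= k)%N -> C k i = q i).
Variable p : nat -> R.
Hypotheses (p0 : p 0%N = 1) (pq : inv_sign q p).

Lemma mt_ge0 lam mu : is_part lam -> is_part mu -> 0 <= mt m lam mu.
Proof. by move=> pl pm; rewrite /mt; case: ifP => // _; case: ifP => // h; apply: m_ge0. Qed.

(** The numbers u_k. For k < n the coefficient C_{k,n} multiplies e_{k-n} = 0 and carries no
    information, whence the value 0. *)
Definition defect k := if (n <= k)%N then C k n - q n else 0.
Definition defectz z := if z is Posz k then defect k else 0.

Lemma defect_n : defect n = 0. Proof. by rewrite /defect leqnn subrr. Qed.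

Lemma lead_conv_gt (c : nat -> R) z : (forall i, (i < n)%N -> (i%:Z <= z) -> c i = 0) ->
  lead (z - n%:Z) (conv eS c z) (sC (c n) * eS (z - n%:Z)).
Proof.
move=> hc; case: z hc => k hc; last first.
  by rewrite (conv_neg (@eS_neg R)) // (@eS_neg R (Negz k - n%:Z)) ?mulr0; [exact: lead0 | lia].
have -> : sC (c n) * eS (k%:Z - n%:Z) = \sum_(i < k.+1) (if (i : nat) == n then sC (c n) * eS (k%:Z - n%:Z) else 0).
  rewrite -big_mkcond /=; case: (leqP n k) => h.
    have h' : (n < k.+1)%N by []. by rewrite (big_pred1 (Ordinal h')) // => i.
  rewrite big_pred0 => [|i]; first by rewrite eS_neg ?mulr0 //; lia.
  by have := ltn_ord i; lia.
rewrite (@conv_widen _ _ (@eS_neg R) _ k k.+1); last by lia.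
apply: (big_ind2 (lead (k%:Z - n%:Z))); [exact: lead0 | by move=> *; apply: leadD |].
move=> i _; have hi := ltn_ord i; case: (ltngtP i n) => h.
- have -> : c i = 0 by apply: hc; lia.
  by have -> : sC 0 * eS (k%:Z - i%:Z) = 0 by [apply: funext => b; rewrite serCM mul0r]; exact: lead0.
- rewrite -[0](mulr0 (sC (c i))); apply: leadC; apply: lead_widen (lead_eS R _) _; lia.
- by rewrite h; apply: leadC; apply: lead_eS.
Qed.

Lemma fneg z : z < 0 -> f (eS z) = 0.
Proof. by move=> h; rewrite eS_neg // (hom0 hf). Qed.

(** By the induction hypothesis the coefficients with index below n cancel, so the first difference
    appears n degrees below e_z. *)
Lemma lead_diff z : lead (z - n%:Z) (f (eS z) - EE q z) (sC (defectz z) * eS (z - n%:Z)).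
Proof.
case: z => k; last first.
  rewrite fneg // EE_neg // subrr (@eS_neg R (Negz k - n%:Z)) ?mulr0; [exact: lead0 | lia].
have -> : f (eS k) - EE q k = conv eS (fun i => C k i - q i) k.
  rewrite fC /EE /conv -sumrB; apply: eq_bigr => i _.
  by apply: funext => b; rewrite serD serN !serCM mulrBl.
have -> : sC (defectz k) * eS (k%:Z - n%:Z) = sC (C k n - q n) * eS (k%:Z - n%:Z).
  rewrite /defectz /defect; case: leqP => // h; by rewrite (@eS_neg R (k%:Z - n%:Z)) ?mulr0 //; lia.
apply: lead_conv_gt => i hi hik; rewrite IHn ?subrr //.
Qed.

Lemma q0 : q 0%N = 1. Proof. exact: C0. Qed.

Lemma lead_EE z : lead z (EE q z) (eS z).
Proof. exact: (@lead_conv R _ _ q z q0 (@lead_eS R)). Qed.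

Lemma lead_feS z : lead z (f (eS z)) (eS z).
Proof.
case: z => k; first by rewrite fC; exact: (@lead_conv R _ _ (C k) k (C0 k) (@lead_eS R)).
by rewrite fneg // eS_neg //; apply: lead0.
Qed.

(* image of e_x e_y e_z under the derivation e_k |-> u_k e_{k-n} *)
Definition defect_form x y z : sring R :=
  sC (defectz x) * eS (x - n%:Z) * eS y * eS z + eS x * (sC (defectz y) * eS (y - n%:Z)) * eS z
  + eS x * eS y * (sC (defectz z) * eS (z - n%:Z)).

(** The difference of two triple products telescopes; f e_k and f_p e_k both have leading form e_k,
    and the Leibniz rule results. *)
Lemma lead_prod x y z s : s = x + y + z - n%:Z ->
  lead s (f (eS x) * f (eS y) * f (eS z) - EE q x * EE q y * EE q z) (defect_form x y z).
Proof.
move=> ->.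
have -> : f (eS x) * f (eS y) * f (eS z) - EE q x * EE q y * EE q z =
  (f (eS x) - EE q x) * f (eS y) * f (eS z) + EE q x * (f (eS y) - EE q y) * f (eS z)
   + EE q x * EE q y * (f (eS z) - EE q z) by ring.
have e1 : x + y + z - n%:Z = (x - n%:Z) + y + z by ring.
have e2 : x + y + z - n%:Z = x + (y - n%:Z) + z by ring.
have e3 : x + y + z - n%:Z = x + y + (z - n%:Z) by ring.
apply: leadD; first apply: leadD.
- rewrite e1; apply: leadM; first apply: leadM; [exact: lead_diff|exact: lead_feS..].
- rewrite e2; apply: leadM; first apply: leadM; [exact: lead_EE|exact: lead_diff|exact: lead_feS].
- rewrite e3; apply: leadM; first apply: leadM; [exact: lead_EE..|exact: lead_diff].
Qed.

(** The signed index pattern of the determinant as a linear operation on W, so that it commutes with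
    f, with leading forms and with taking coefficients. *)
Definition D3g (V : zmodType) (W : int -> int -> int -> V) x y z : V :=
  W x y z - W x (y + 1) (z - 1) - W (x + 1) (y - 1) z
  + W (x + 1) (y + 1) (z - 2) + W (x + 2) (y - 1) (z - 1) - W (x + 2) y (z - 2).

Lemma lead_D3g (W W' : int -> int -> int -> sring R) x y z s :
  (forall x' y' z', x' + y' + z' = x + y + z -> lead s (W x' y' z') (W' x' y' z')) ->
  lead s (D3g W x y z) (D3g W' x y z).
Proof. by move=> h; rewrite /D3g; repeat (apply: leadD || apply: leadN); apply: h; lia. Qed.

Lemma is_sym_D3g (W : int -> int -> int -> sring R) x y z :
  (forall x y z, is_sym (W x y z)) -> is_sym (D3g W x y z).
Proof. by move=> h; rewrite /D3g; repeat (apply: is_symD || apply: is_symN); apply: h. Qed.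

Lemma hall_D3g (W : int -> int -> int -> sring R) x y z mu : is_part mu ->
  (forall x y z, is_sym (W x y z)) ->
  hall_schur (D3g W x y z) mu = D3g (fun x y z => hall_schur (W x y z) mu) x y z.
Proof.
move=> pm h; rewrite /D3g !hallD ?hallN //; repeat (apply: is_symD || apply: is_symN); exact: h.
Qed.

Lemma f_schur3 a b c : (c <= b <= a)%N ->
  f (schur R (mk3 a b c)) = D3g (fun x y z => f (eS x) * f (eS y) * f (eS z)) a b c.
Proof.
move=> h; rewrite jacobi_trudi3 //.
have L x y z : in_Lambda (eS x * eS y * eS z) by apply: in_Lambda_M; [apply: in_Lambda_M|]; apply: in_Lambda_eS.
have fL x y z : f (eS x * eS y * eS z) = f (eS x) * f (eS y) * f (eS z).
  by rewrite !(homM hf) //; try exact: in_Lambda_eS; apply: in_Lambda_M; apply: in_Lambda_eS.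
have LN x y z : in_Lambda (- (eS x * eS y * eS z)) by apply: in_Lambda_N.
by rewrite /D3 /D3g !(homD hf) ?(homN hf) ?fL //; do ?[apply: in_Lambda_D => //].
Qed.

Lemma fp_schur3 a b c : (c <= b <= a)%N ->
  fp_schur p (mk3 a b c) = D3g (fun x y z => EE q x * EE q y * EE q z) a b c.
Proof.
move=> h; have pm := mk3_part h; rewrite fp_schurE //; apply/esym; apply: rep_perp => //.
rewrite jacobi_trudi3 //.
have hr x y z : rep p (eS x * eS y * eS z) (EE q x * EE q y * EE q z).
  by apply: repM; [apply: repM|]; apply: rep_eS => //; apply: q0.
have hN x y z : rep p (- (eS x * eS y * eS z)) (- (EE q x * EE q y * EE q z)) by apply: repN.
by rewrite /D3 /D3g; do ?[apply: repD => //].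
Qed.

Lemma lead3 a b c : (c <= b <= a)%N ->
  lead ((a + b + c)%N%:Z - n%:Z) (f (schur R (mk3 a b c)) - (fp_schur p (mk3 a b c) : sring R)) (D3g defect_form a b c).
Proof.
move=> h; rewrite f_schur3 // fp_schur3 //.
pose W x y z := f (eS x) * f (eS y) * f (eS z) - EE q x * EE q y * EE q z.
have -> : D3g (fun x y z => f (eS x) * f (eS y) * f (eS z)) a b c
    - D3g (fun x y z => EE q x * EE q y * EE q z) a b c = D3g W a b c.
  rewrite /D3g /W; move: (f (eS _)) (EE q) => *; ring.
by apply: lead_D3g => x y z e; apply: lead_prod; lia.
Qed.

Lemma is_sym_M3 x y z : is_sym (defect_form x y z).
Proof.
have hC v : is_sym (sC v) by apply: is_symC.
have hE v : is_sym (eS v) by apply: is_sym_eS.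
by rewrite /defect_form; repeat (apply: is_symD || apply: is_symM).
Qed.

(** The source of the inequalities from shapes: the first term is nonnegative, the second is 0 or
    constant for well-chosen shapes, and the right side is linear in the u_k. *)
Lemma mt_diff a b c mu : (c <= b <= a)%N -> is_part mu -> (sumn mu + n = a + b + c)%N ->
  mt m (mk3 a b c) mu - hall_schur (perp_schur (kappa p) (mk3 a b c)) mu =
  D3g (fun x y z => hall_schur (defect_form x y z) mu) a b c.
Proof.
move=> h pm hs; have p3 := mk3_part h; have s3 := sumn_mk3 h.
have l3 := lead3 h; rewrite fm // fp_schur_sum in l3.
have eN : (a + b + c)%N%:Z - n%:Z = sumn mu by lia.
rewrite eN in l3; rewrite (lead_hall _ _ _ l3); last by rewrite s3; lia.
- by apply: hall_D3g => //; exact: is_sym_M3.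
- by apply: is_sym_D3g; exact: is_sym_M3.
- by apply/partsP.
Qed.

End InductionStep.

(** * Inequalities for the u_k *)

Section Inequalities.
Variable R : realType.
Implicit Types (a b c d i j k : nat) (x y z s t : int) (F G X : sring R).
Notation eS := (@eS R).
Variables (C : nat -> nat -> R) (n : nat) (m : seq nat -> seq nat -> R) (K : sring R).
Hypotheses (n_gt0 : (0 < n)%N) (sK : is_sym K).
Notation u := (defect C n).
Notation M3 := (defect_form C n).
Notation kk lam mu := (hall_schur (perp_schur K lam) mu).
Hypothesis mt0 : forall lam mu, is_part lam -> is_part mu -> 0 <= mt m lam mu.
Hypothesis mtd : forall a b c mu, (c <= b <= a)%N -> is_part mu -> (sumn mu + n = a + b + c)%N ->
  mt m (mk3 a b c) mu - kk (mk3 a b c) mu =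
  D3g (fun x y z => hall_schur (M3 x y z) mu) a b c.

(** The multiplicity of s_mu in e_x e_y e_z from [hall_eee], where d is the second column of mu;
    kept in [int] so that [lia] can evaluate it. *)
Definition kz (x y z d : nat) : int := (k2 y z d.+1)%:Z - (k2 y z (d - x))%:Z.

Lemma u_lt k : (k < n)%N -> u k = 0.
Proof. by move=> h; rewrite /defect leqNgt h. Qed.

Lemma hall_M3 (x y z c d : nat) : (d <= c)%N -> (x + y + z = c + d + n)%N ->
  hall_schur (M3 x y z) (mk3 c d 0) =
    u x * (kz (x - n) y z d)%:~R + u y * (kz x (y - n) z d)%:~R + u z * (kz x y (z - n) d)%:~R.
Proof.
move=> hd hs; have pm : is_part (mk3 c d 0) by apply: mk3_part.
have hE v : is_sym (eS v) by apply: is_sym_eS.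
have hC v : is_sym (sC v : sring R) by apply: is_symC.
have sE v w t : is_sym (eS v * eS w * eS t) by do 2?apply: is_symM.
have e (v w t i : nat) (r : R) : ((v + w + t)%N = (c + d)%N) ->
    hall_schur (eS v * eS w * eS t) (mk3 c d 0) = (kz v w t d)%:~R.
  by move=> h; rewrite hall_eee // /kz rmorphB.
have eM : M3 x y z = sC (u x) * (eS (x%:Z - n%:Z) * eS y * eS z) +
     sC (u y) * (eS x * eS (y%:Z - n%:Z) * eS z) + sC (u z) * (eS x * eS y * eS (z%:Z - n%:Z)).
  by rewrite /defect_form /defectz; ring.
have st v w t r : is_sym (sC r * (eS v * eS w * eS t)) by apply: is_symM.
rewrite eM !hallD ?hallC //; last by apply: is_symD.
congr (_ + _ + _).
- have [h|h] := leqP n x; last by rewrite u_lt // !mul0r.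
  have -> : x%:Z - n%:Z = (x - n)%N by lia. by rewrite (e _ _ _ 0%N 0) //; lia.
- have [h|h] := leqP n y; last by rewrite u_lt // !mul0r.
  have -> : y%:Z - n%:Z = (y - n)%N by lia. by rewrite (e _ _ _ 0%N 0) //; lia.
- have [h|h] := leqP n z; last by rewrite u_lt // !mul0r.
  have -> : z%:Z - n%:Z = (z - n)%N by lia. by rewrite (e _ _ _ 0%N 0) //; lia.
Qed.

Lemma kz_eq1 (x y z d : nat) : (x <= d)%N -> (y <= d)%N -> (z <= d)%N -> (x + y + z = d + d)%N ->
  kz x y z d = 1.
Proof. by rewrite /kz /k2; lia. Qed.

Lemma kz_eq0 (x y z d : nat) : (d < x)%N -> (x + y + z = d + d)%N -> kz x y z d = 0.
Proof. by rewrite /kz /k2; lia. Qed.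

Lemma hall_M3_neg x y z mu : is_part mu -> z < 0 -> hall_schur (M3 x y z) mu = 0.
Proof.
move=> pm hz; have -> : M3 x y z = 0; last exact: hall0.
rewrite /defect_form (eS_neg R hz) (@eS_neg R (z - n%:Z)); last by lia.
by rewrite !mulr0 !addr0.
Qed.

Lemma mtd2 b c d : (0 < b)%N -> (d <= c)%N -> (c + d + n = b + b)%N ->
  mt m (mk3 b b 0) (mk3 c d 0) - kk (mk3 b b 0) (mk3 c d 0) =
  hall_schur (M3 b b 0%N) (mk3 c d 0) - hall_schur (M3 b.+1 b.-1 0%N) (mk3 c d 0).
Proof.
move=> b0 hd hs; have pm : is_part (mk3 c d 0) by apply: mk3_part.
rewrite mtd ?sumn_mk3 //; [|lia|lia].
rewrite /D3g !(@hall_M3_neg _ _ (0%N%:Z - _)) // !(subr0, addr0).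
have -> : b%:Z + 1 = b.+1 by lia. have -> : b%:Z - 1 = b.-1 by lia. by [].
Qed.

(** All four products involved contain s_mu exactly once, and mu is not inside lam because its first
    column has b + 1 cells. *)
Lemma ineq0 b : (n < b)%N -> u b.+1 + u b.-1 <= u b + u b.
Proof.
move=> hb; pose mu := mk3 b.+1 (b.-1 - n) 0.
have pm : is_part mu by apply: mk3_part; lia.
have pl : is_part (mk3 b b 0) by apply: mk3_part; lia.
have hk : kk (mk3 b b 0) mu = 0.
  apply/eqP; apply: contraT => /(hall_perp_contained sK pl pm) /(_ b).
  by rewrite /mu !nth_mk3; lia.
have := mt0 pl pm; rewrite -(subr0 (mt _ _ _)) -hk mtd2 //; [|lia..].
rewrite !hall_M3; try lia.
have k1 : kz (b - n) b 0 (b.-1 - n) = 1 by rewrite /kz /k2; lia.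
have k2' : kz b (b - n) 0 (b.-1 - n) = 1 by rewrite /kz /k2; lia.
have k3 : kz (b.+1 - n) b.-1 0 (b.-1 - n) = 1 by rewrite /kz /k2; lia.
have k4 : kz b.+1 (b.-1 - n) 0 (b.-1 - n) = 1 by rewrite /kz /k2; lia.
rewrite k1 k2' k3 k4 !mulr1 (u_lt n_gt0); lra.
Qed.

(** In column lengths lam = [j+n, j+n] and mu = [j+n-1, j+1]. A product containing e_{j+n} or
    e_{j+n+1} has only constituents with a longer first column than mu, so just the term u_{j+n+1}
    e_{j+1} e_{j+n-1} survives. That mu is a partition requires n >= 2. *)
Lemma ineq3 : (1 < n)%N -> exists B, forall k, (n < k)%N -> u k <= B.
Proof.
move=> n1; pose lam k := mk3 k k 0; pose mu k := mk3 k.-1 (k.+1 - n) 0.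
exists (kk (lam n) (mu n)) => k hk; have -> : k = (k.-1 - n + n).+1 by lia.
move: (k.-1 - n)%N => j {k hk}.
have pm : is_part (mu (j + n)%N) by apply: mk3_part; lia.
have pl : is_part (lam (j + n)%N) by apply: mk3_part; lia.
have hkk : kk (lam (j + n)%N) (mu (j + n)%N) = kk (lam n) (mu n).
  elim: j {pm pl} => [|j IH] //; rewrite -IH.
  have e1 : lam (j.+1 + n)%N = 2%N :: lam (j + n)%N.
    by rewrite /lam /mk3 !subnn !subn0.
  have e2 : mu (j.+1 + n)%N = 2%N :: mu (j + n)%N.
    rewrite /mu /mk3 /= !subn0.
    have -> : ((j.+1 + n).+1 - n = ((j + n).+1 - n).+1)%N by lia.
    have -> : ((j.+1 + n).-1 - ((j + n).+1 - n).+1 = (j + n).-1 - ((j + n).+1 - n))%N by lia.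
    by [].
  rewrite e1 e2 hall_perp_same -?e1 -?e2 //; try (apply: mk3_part; lia).
  by rewrite /lam /mu !sumn_mk3; lia.
have := mt0 pl pm; rewrite -(subrK (kk (lam (j + n)%N) (mu (j + n)%N)) (mt _ _ _)) mtd2; [|lia..].
rewrite hkk !hall_M3; try lia.
have k1 : kz (j + n - n) (j + n) 0 ((j + n).+1 - n) = 0 by rewrite /kz /k2; lia.
have k2' : kz (j + n) (j + n - n) 0 ((j + n).+1 - n) = 0 by rewrite /kz /k2; lia.
have k3 : kz ((j + n).+1 - n) (j + n).-1 0 ((j + n).+1 - n) = 1 by rewrite /kz /k2; lia.
have k4 : kz (j + n).+1 ((j + n).-1 - n) 0 ((j + n).+1 - n) = 0 by rewrite /kz /k2; lia.
rewrite k1 k2' k3 k4 !mulr1 !mulr0 (u_lt n_gt0); lra.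
Qed.

(** Each step adds a row of length 1 to both columns, so the contribution of f_p is always that of
    the pair [n] -> []. *)
Lemma ineq4 : exists B, forall k, (n <= k)%N -> B <= u k.
Proof.
exists (- kk (nseq n 1%N) [::]) => k hk; have -> : k = (k - n + n)%N by lia.
move: (k - n)%N => j {k hk}.
have pm := is_part_nseq1 j; have pl := is_part_nseq1 (j + n).
have hkk : kk (nseq (j + n) 1%N) (nseq j 1%N) = kk (nseq n 1%N) [::].
  elim: j {pm pl} => [|j IH] //; rewrite -IH [nseq (j.+1 + n) _]/= [nseq j.+1 _]/= hall_perp_same //.
  - exact: (is_part_nseq1 (j + n).+1).
  - exact: (is_part_nseq1 j.+1).
  - by rewrite !sumn_nseq; lia.
have := mt0 pl pm; rewrite -(subrK (kk (nseq (j + n) 1%N) (nseq j 1%N)) (mt _ _ _)) hkk.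
rewrite -hkk -!mk3_col1 mtd; [|lia|by apply: mk3_part|by rewrite sumn_mk3 //; lia].
rewrite !mk3_col1 hkk -(mk3_col1 j).
have pm' : is_part (mk3 j 0 0) by apply: mk3_part.
rewrite /D3g !(@hall_M3_neg _ _ (0%N%:Z - _)) // !(subr0, addr0).
have -> : hall_schur (M3 ((j + n)%N%:Z + 1) (0%N%:Z - 1) 0%N) (mk3 j 0 0) = 0.
  have -> : M3 ((j + n)%N%:Z + 1) (0%N%:Z - 1) 0%N = 0; last exact: hall0.
  rewrite /defect_form (@eS_neg R (0%N%:Z - 1)) // (@eS_neg R (0%N%:Z - 1 - n%:Z)); last by lia.
  by rewrite !(mulr0, mul0r, addr0).
rewrite hall_M3; try lia.
have k1 : kz (j + n - n) 0 0 0 = 1 by rewrite /kz /k2; lia.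
rewrite k1 !(u_lt n_gt0) mulr1; lra.
Qed.

(** Products with all indices at most b + 1 contain s_mu once, those retaining e_{b+2} not at all.
    In the alternating sum u_{n+2}, u_{b+1} and u_{b+2} cancel, leaving u_b - u_{b-1} - u_{n+1} +
    u_n. *)
Lemma ineq2 b : (n.+2 <= b)%N -> u b.-1 + u n.+1 <= u b + u n.
Proof.
move=> hb; pose mu := mk3 b.+1 b.+1 0.
have pm : is_part mu by apply: mk3_part; lia.
have pl : is_part (mk3 b b n.+2) by apply: mk3_part; lia.
have hk : kk (mk3 b b n.+2) mu = 0.
  apply/eqP; apply: contraT => /(hall_perp_contained sK pl pm) /(_ b).
  by rewrite /mu !nth_mk3; lia.
have := mt0 pl pm; rewrite -(subr0 (mt _ _ _)) -hk mtd ?sumn_mk3; [|lia|by []|lia|lia].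
rewrite /D3g.
have -> : b%:Z + 1 = b.+1 by lia. have -> : b%:Z + 2 = b.+2 by lia. have -> : b%:Z - 1 = b.-1 by lia.
have -> : n.+2%:Z - 1 = n.+1 by lia. have -> : n.+2%:Z - 2 = n by lia.
rewrite !hall_M3; try lia.
rewrite !(@kz_eq0 b.+2) //; try lia.
rewrite !kz_eq1; try lia.
by rewrite !mulr1 !mulr0; lra.
Qed.

End Inequalities.

(** * Linearity of u and evaluation in one variable *)

Section Slopes.
Variable R : realType.
Implicit Types (a b c d i j k n : nat) (x y z s t : int) (F G X : sring R).
Notation eS := (@eS R).
Notation hS := (@hS R).

Lemma archi_le0 (s B : R) : (forall j, j%:R * s <= B) -> s <= 0.
Proof.
move=> h; rewrite leNgt; apply/negP => s0.
have hB : 0 <= B by have := h 0%N; rewrite mul0r.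
have := h (Num.bound (B / s)); rewrite leNgt => /negP; apply.
by rewrite -ltr_pdivrMr //; apply: archi_boundP; apply: divr_ge0 => //; apply: ltW.
Qed.

(** Concavity bounds every step of u above by the first one, which is u_{n+1}; the three-column
    inequality bounds it below by the same number. *)
Lemma linear_of_ineqs n (u : nat -> R) : u n = 0 ->
  (forall b, (n < b)%N -> u b.+1 + u b.-1 <= u b + u b) ->
  (forall b, (n.+2 <= b)%N -> u b.-1 + u n.+1 <= u b + u n) ->
  forall j, u (n + j)%N = j%:R * u n.+1.
Proof.
move=> un h0 h2.
have step j : u (n + j).+1 - u (n + j)%N <= u n.+1.
  elim: j => [|j IH]; first by rewrite addn0 un subr0.
  have := h0 (n + j).+1 ltac:(lia); rewrite addnS /= => h; lra.
elim=> [|j IH]; first by rewrite addn0 un mul0r.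
apply/eqP; rewrite eq_le addnS; apply/andP; split.
  by have := step j; rewrite IH -natr1; lra.
case: j IH step => [|j] IH step; first by rewrite addn0 mul1r.
have := h2 (n + j.+1).+1 ltac:(lia); rewrite /= IH un -!natr1; lra.
Qed.

Lemma mul_row1 F G j : (F * G) [:: j] = \sum_(y < j.+1) F [:: y : nat] * G [:: (j - y)%N].
Proof.
rewrite -[LHS]/((T j (F * G) : sring R) [::]) T_mul ser_sum; apply: eq_bigr => y _.
by rewrite serM_nil.
Qed.

Lemma EE_row (q : nat -> R) (i y : nat) :
  EE q i [:: y] = if y == 0%N then q i else if (y == 1%N) && (0 < i)%N then q i.-1 else 0.
Proof.
case: y => [|[|y]] /=.
- by rewrite -[LHS]/((T 0 (EE q i) : sring R) [::]) is_sym_0 ?EE_nil //; apply: is_sym_EE.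
- rewrite -[LHS]/((T 1 (EE q i) : sring R) [::]) T1_EE; case: i => [|i] /=; first by rewrite EE_neg.
  have -> : i.+1%:Z - 1 = i by lia.
  exact: EE_nil.
- by rewrite -[LHS]/((T y.+2 (EE q i) : sring R) [::]) T2_EE.
Qed.

Lemma Pser_row1 : Pser R [:: 1%N] = 0.
Proof.
rewrite /Pser big_pred0 // => E; apply/negP => /andP [/forallP h1 /forallP /(_ ord0)] /=.
rewrite (_ : [set _ in _ | _] = set0) ?cards0 //; apply/setP => e; rewrite !inE.
apply/negP => /andP [he _]; have := h1 e; rewrite he /=.
by case: e {he} => [[[|?] ?] [[|?] ?]].
Qed.

Lemma parts1 : parts 1 = [:: [:: 1%N]]. Proof. by []. Qed.

(** For |nu| <= k the value is one of s_nu; for |nu| = k + 1 it is the correction one degree below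
    the top, which is 0 because P has no term of degree 1. *)
Lemma sp_row_ge0 nu k : is_part nu -> (sumn nu <= k.+1)%N -> 0 <= sp R nu [:: k].
Proof.
move=> pn; rewrite leq_eqVlt => /orP [/eqP h|h]; last first.
  by rewrite sp_top //= ?addn0 // /schur /skew_schur ler0n.
rewrite spE // perp_schurE ser_sum h big_ord_recl [X in X + _]/= big_seq1 serCM.
have -> : skew_schur R nu [::] [:: k] = 0 by apply: (@schur_deg R nu); rewrite /= ?addn0 ?h //; lia.
rewrite mulr0 add0r.
apply: sumr_ge0 => i _; rewrite ser_sum big_seq.
apply: sumr_ge0 => th /partsP [pt st]; rewrite serCM.
case: (eqVneq (skew_schur R nu th [:: k]) 0) => [->|/(skew_deg pn)]; first by rewrite mulr0.
rewrite h /= addn0 => e.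
have t1 : th \in parts 1 by apply/partsP; split=> //; lia.
rewrite parts1 inE in t1; move/eqP: t1 => ->.
have := hallE (@is_sym_Pser R) [:: 1%N]; rewrite Pser_row1 [parts _]/= big_seq1 schur_rev // kostka_diag // mulr1.
by move=> <-; rewrite mul0r.
Qed.

Lemma ups_nil k : perm_eq (ups [::] k.+1) [:: [:: k.+1]].
Proof.
apply: uniq_perm; rewrite ?uniq_ups // => lam; rewrite mem_ups inE /= add0n.
apply/and3P/eqP => [[pl /hsP hh /eqP sl]|->]; last by split; rewrite /= ?addn0.
case: lam pl hh sl => [|x [|y lam]] // pl hh sl; first by rewrite sl /= addn0.
by have := hh 0%N; rewrite /= => /andP []; move: pl; rewrite !is_part_cons /=; lia.
Qed.

Lemma hS_schur k : hS k.+1 = schur R [:: k.+1].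
Proof.
have := @pieri R k.+1 [::] isT; rewrite schur_nil mulr1 => h.
by rewrite [LHS]h (perm_big _ (ups_nil k)) big_seq1.
Qed.

Variables (f : sring R -> sring R) (m : seq nat -> seq nat -> R).
Hypothesis hf : lin_ring_hom (f : series R -> series R).
Hypothesis fm : forall lam, is_part lam -> f (schur R lam) = sp_sum lam (mt m lam).
Hypothesis mt0 : forall lam mu, is_part lam -> is_part mu -> 0 <= mt m lam mu.
Variable C : nat -> nat -> R.
Hypotheses (C0 : forall k, C k 0%N = 1) (fC : forall k, f (eS k) = EE (C k) k).

Lemma hom_hS_rec k : f (hS k.+1) = \sum_(i < k.+1) (-1) ^+ i * f (eS i.+1) * f (hS (k - i)%N).
Proof.
rewrite hS_rec (hom_sum hf) => [|i _]; last by rewrite -mulrA; apply: in_Lambda_sign; apply: in_Lambda_M; [apply: in_Lambda_eS|apply: in_Lambda_hS].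
apply: eq_bigr => i _; rewrite -!mulrA (hom_sign hf) ?(homM hf) //; try exact: in_Lambda_eS; try exact: in_Lambda_hS.
by apply: in_Lambda_M; [apply: in_Lambda_eS|apply: in_Lambda_hS].
Qed.

(** In one variable only e_0 and e_1 survive, so f e_{i+1} reduces to C_{i+1,i+1} + C_{i+1,i} x. *)
Lemma f_hS_row k j : f (hS k.+1) [:: j] =
  \sum_(i < k.+1) (-1) ^+ i * (C i.+1 i.+1 * f (hS (k - i)%N) [:: j]
     + (if j is j'.+1 then C i.+1 i * f (hS (k - i)%N) [:: j'] else 0)).
Proof.
rewrite hom_hS_rec ser_sum; apply: eq_bigr => i _; rewrite -mulrA.
have sg F (b : seq nat) : ((-1) ^+ i * F) b = (-1) ^+ i * F b.
  elim: (nat_of_ord i) => [|l IH]; first by rewrite !mul1r.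
  by rewrite !exprS -!mulrA !mulN1r serN IH.
rewrite sg mul_row1; congr (_ * _); case: j => [|j]; first by rewrite big_ord1 fC EE_row addr0.
rewrite big_ord_recl big_ord_recl big1 => [|y _]; last by rewrite fC EE_row mul0r.
by rewrite addr0 fC !EE_row /= /bump /= subn0 subSS subn0.
Qed.

Lemma f_hS_deg k : (forall j, (k < j)%N -> f (hS k) [:: j] = 0) /\ f (hS k) [:: k] = 1.
Proof.
have f0 : f (hS 0) = 1 by rewrite hS0; exact: hom1 hf.
elim/ltn_ind: k => -[|k] IH.
  rewrite f0; split=> [j hj|//]; by case: j hj.
split=> [[|j] // hj|].
  rewrite f_hS_row big1 // => i _; have hi := ltn_ord i.
  have [h _] := IH (k - i)%N ltac:(lia).
  by rewrite !h ?mulr0 ?addr0 ?mulr0 //; lia.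
rewrite f_hS_row big_ord_recl big1 => [|i _].
  have [h1 h2] := IH k ltac:(lia).
  by rewrite subn0 h1 // h2 C0 mulr0 !mul1r add0r addr0.
have hi := ltn_ord i; have [h _] := IH (k - (lift ord0 i : nat))%N ltac:(rewrite /=; lia).
have e : (lift ord0 i : nat) = i.+1 by [].
by rewrite !h ?mulr0 ?addr0 ?mulr0 //; rewrite e; lia.
Qed.

(** The coefficient w_k of x^k in f h_{k+1}, taken in one variable, equals w_0 - k (C_{2,1} -
    C_{1,1}) and is nonnegative for every k. This is the upper bound on the slope for n = 1, where
    the shapes of [ineq3] do not exist. *)
Lemma slope_le0 : C 2 1%N - C 1%N 1%N <= 0.
Proof.
pose w k := f (hS k.+1) [:: k].
have w0 k : 0 <= w k.
  rewrite /w hS_schur fm // /sp_sum; apply: sumr_ge0 => n _; rewrite big_seq; apply: sumr_ge0 => nu /partsP [pn sn].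
  apply: mulr_ge0; first exact: mt0.
  have e1 : sumn [:: k.+1] = k.+1 by rewrite /= addn0.
  by apply: sp_row_ge0 => //; apply: leq_trans (eq_leq e1); rewrite sn -ltnS ltn_ord.
have wS k : w k.+1 = w k - (C 2 1%N - C 1%N 1%N).
  rewrite /w f_hS_row 2!big_ord_recl big1 => [|i _].
    have e1 : (k.+1 - (lift ord0 ord0 : 'I_k.+2))%N = k by rewrite /= /bump /= subSS subn0.
    have [h1 h2] := f_hS_deg k; have [h3 h4] := f_hS_deg k.+1.
    rewrite e1 subn0 h1 // h2 h4 /bump /= C0; ring.
  have hi := ltn_ord i; have e : (lift ord0 (lift ord0 i) : nat) = i.+2 by [].
  have [h _] := f_hS_deg (k.+1 - (lift ord0 (lift ord0 i) : nat))%N.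
  by rewrite !h ?mulr0 ?addr0 ?mulr0 //; rewrite e; lia.
have wE k : w k = w 0%N - k%:R * (C 2 1%N - C 1%N 1%N).
  elim: k => [|k IH]; first by rewrite mul0r subr0.
  by rewrite wS IH -natr1; ring.
by apply: (@archi_le0 _ (w 0%N)) => j; have := w0 j; rewrite wE; lra.
Qed.

End Slopes.

(** * Direct part of (a) *)

Section Direct.
Variable R : realType.
Implicit Types (a b c d i j k n : nat) (x y z s t : int) (F G X : sring R).
Notation eS := (@eS R).
Notation hS := (@hS R).

Lemma sp_sum_inj lam (x y : seq nat -> R) nu : sp_sum lam x = sp_sum lam y ->
  is_part nu -> (sumn nu <= sumn lam)%N -> x nu = y nu.
Proof.
move=> e pn hn; apply/eqP; rewrite -subr_eq0.
rewrite (@lead_hall R lam x y (sumn nu) 0) ?hall0 //.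
- by apply/partsP.
- by rewrite e subrr; apply: lead0.
Qed.

Lemma hall_perp_nil F lam : is_sym F -> is_part lam -> hall_schur (perp_schur F lam) [::] = hall_schur F lam.
Proof. by move=> sF pl; rewrite hall_perp // schur_nil mulr1. Qed.

Variables (f : sring R -> sring R) (m : seq nat -> seq nat -> R).
Hypothesis hf : lin_ring_hom (f : series R -> series R).
Hypothesis fm : forall lam, is_part lam -> f (schur R lam) = sp_sum lam (mt m lam).
Hypothesis m_ge0 : forall lam mu, is_part lam -> is_part mu -> dom_lt mu lam -> 0 <= m lam mu.

Lemma diagonal_constant (C : nat -> nat -> R) :
  (forall k, C k 0%N = 1) -> (forall k, f (eS k) = EE (C k) k) ->
  forall n k, (n <= k)%N -> C k n = C n n.
Proof.
move=> C0 fC; elim/ltn_ind=> n IH k hnk.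
case: (posnP n) IH hnk => [->|n_gt0] IH hnk; first by rewrite !C0.
have IHn i k' : (i < n)%N -> (i <= k')%N -> C k' i = C i i by move=> hi; apply: IH.
have [p [p0 pq]] := inv_sign_exists (C0 0%N : (fun i => C i i) 0%N = 1).
have sK : is_sym (kappa p) by apply: is_sym_kappa.
have mt0 := mt_ge0 m_ge0.
have mtd := mt_diff hf fm C0 fC IHn p0 pq.
have un := defect_n C n.
have lin := linear_of_ineqs un (ineq0 n_gt0 sK mt0 mtd) (ineq2 n_gt0 sK mt0 mtd).
suff s0 : defect C n n.+1 = 0.
  have := lin (k - n)%N; rewrite s0 mulr0 subnKC // /defect hnk => /eqP; rewrite subr_eq0 => /eqP //.
apply/eqP; rewrite eq_le; apply/andP; split.
  have [hn|hn] : (1 < n)%N \/ n = 1%N by lia.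
    have [B hB] := ineq3 n_gt0 sK mt0 mtd hn.
    (* B bounds u_{n+j} only for j >= 1; the maximum with 0 takes care of j = 0. *)
    apply: (@archi_le0 _ _ (Num.max B 0)) => -[|j]; first by rewrite mul0r le_max lexx orbT.
    by rewrite -lin le_max hB //; lia.
  by have := slope_le0 hf fm mt0 C0 fC; rewrite hn /defect.
have [B hB] := ineq4 n_gt0 sK mt0 mtd.
rewrite -oppr_le0; apply: (@archi_le0 _ _ (- B)) => j.
by rewrite mulrN lerN2 -lin hB //; lia.
Qed.

(** The last clause, about the coefficient of sp at the empty partition, yields the kappa-positivity
    and is also what (b) needs. *)
Lemma direct_part : exists p : nat -> R, [/\ p 0%N = 1, kappa_positive p,
  forall lam, is_part lam -> f (schur R lam) = fp_schur p lam
  & forall lam, is_part lam -> hall_schur (kappa p) lam = mt m lam [::]].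
Proof.
have [C hC] := boolp.choice (hom_eS fm).
have C0 k : C k 0%N = 1 by case: (hC k).
have fC k : f (eS k) = EE (C k) k by case: (hC k).
pose q i := C i i; have q0 : q 0%N = 1 := C0 0%N.
have [p [p0 pq]] := inv_sign_exists q0.
have fE k : f (eS k) = EE q k.
  rewrite fC /EE /conv; apply: eq_bigr => i _; have hi : (i <= k)%N by rewrite -ltnS; apply: ltn_ord.
  by rewrite (diagonal_constant C0 fC hi).
have fH k : f (hS k) = HH p k.
  elim/ltn_ind: k => -[|k] IH; first by rewrite hS0 HH0 //; exact: hom1 hf.
  rewrite (hom_hS_rec hf) (HH_rec _ q0 pq); apply: eq_bigr => i _.
  by rewrite fE IH // ltnS leq_subr.
have fs lam : is_part lam -> f (schur R lam) = fp_schur p lam.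
  by move=> pl; rewrite (hom_schur hf p0 fH) // fp_schurE.
have kE lam : is_part lam -> hall_schur (kappa p) lam = mt m lam [::].
  move=> pl; rewrite -hall_perp_nil //; last exact: is_sym_kappa.
  apply: (@sp_sum_inj lam) => //; by rewrite -fp_schur_sum -fs // fm.
exists p; split=> // lam pl; rewrite kE //; exact: (mt_ge0 m_ge0).
Qed.

End Direct.

(** * Hook coefficients of kappa_p *)

Section ThreeVertices.
Variable R : realType.
Implicit Types (a b c i j : nat) (F G : sring R).

Let v0 : 'I_3 := @Ordinal 3 0 isT.
Let v1 : 'I_3 := @Ordinal 3 1 isT.
Let v2 : 'I_3 := @Ordinal 3 2 isT.
(** The three booleans select the edges 01, 02 and 12, which parametrises all simple graphs on three
    vertices. *)
Let edges (t : bool * bool * bool) : {set 'I_3 * 'I_3} :=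
  [set e | [|| t.1.1 && (e == (v0, v1)), t.1.2 && (e == (v0, v2)) | t.2 && (e == (v1, v2))]].

Let card_edges t (Q : pred ('I_3 * 'I_3)) : #|[set e in edges t | Q e]| =
  ((t.1.1 && Q (v0, v1)) + (t.1.2 && Q (v0, v2)) + (t.2 && Q (v1, v2)))%N.
Proof.
have e3 (P : pred 'I_3) : (\sum_(i < 3) (P i : nat) = P v0 + P v1 + P v2)%N.
  rewrite !big_ord_recl big_ord0 addn0 addnA; congr (_ + _ + _)%N; congr (nat_of_bool (P _)); exact: val_inj.
rewrite -sum1_card big_mkcond /= (eq_bigr (fun e => ((e \in edges t) && Q e : nat))); last first.
  by move=> e _; rewrite inE; case: (_ && _).
transitivity (\sum_(i < 3) \sum_(j < 3) (((i, j) \in edges t) && Q (i, j)))%N.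
  by rewrite pair_bigA; apply: eq_bigr => -[].
under eq_bigr do rewrite (e3 (fun j : 'I_3 => ((_, j) \in edges t) && Q (_, j))).
rewrite !big_split /= !(e3 (fun i : 'I_3 => ((i, _) \in edges t) && Q (i, _))).
by case: t => -[[] []] []; rewrite !inE /= ?addn0 ?add0n ?addnA.
Qed.

Lemma Pser3 a b c : Pser R [:: a; b; c] =
  \sum_(t : bool * bool * bool | [&& t.1.1 + t.1.2 == a, t.1.1 + t.2 == b & t.1.2 + t.2 == c]%N)
    (-1) ^+ (t.1.1 + t.1.2 + t.2).
Proof.
rewrite /Pser (reindex_onto edges (fun E => ((v0, v1) \in E, (v0, v2) \in E, (v1, v2) \in E))) /=; last first.
  move=> E /andP [/forall_inP hi _]; apply/setP => -[i j]; rewrite inE /=; apply/idP/idP.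
    by case/or3P => /andP [h /eqP ->].
  move=> h; have := hi _ h; case: i h => [[|[|[|i]]] hi'] h //; case: j h => [[|[|[|j]]] hj'] h //= _.
  - by rewrite (_ : (Ordinal hi', Ordinal hj') = (v0, v1)) in h *; [rewrite h eqxx | congr pair; apply: val_inj].
  - by rewrite (_ : (Ordinal hi', Ordinal hj') = (v0, v2)) in h *; [rewrite h eqxx orbT | congr pair; apply: val_inj].
  - by rewrite (_ : (Ordinal hi', Ordinal hj') = (v1, v2)) in h *; [rewrite h eqxx !orbT | congr pair; apply: val_inj].
apply: eq_big => [t|t _]; last first.
  have := card_edges t xpredT; rewrite !andbT => <-; congr (_ ^+ _); apply: eq_card => e.
  by rewrite [RHS]inE andbT.
have -> : (((v0, v1) \in edges t, (v0, v2) \in edges t, (v1, v2) \in edges t) == t) = true.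
  by case: t => -[[] []] []; rewrite !inE.
have -> : [forall e in edges t, (e.1 < e.2)%N].
  by apply/forall_inP => e; rewrite inE => /or3P [] /andP [_ /eqP ->].
rewrite andbT /=; apply/forallP/and3P => [h|[/eqP h1 /eqP h2 /eqP h3]].
  have := h v0; have := h v1; have := h v2; rewrite !card_edges /= !andbT !andbF ?addn0 ?add0n.
  by move=> /eqP <- /eqP <- /eqP <-.
by move=> -[[|[|[|i]]] hi] //; rewrite card_edges /= ?andbT ?andbF ?addn0 ?add0n ?h1 ?h2 ?h3.
Qed.

(** The terms are the eight monomials of (1 - x y)(1 - x z)(1 - y z). *)
Lemma Pser3E a b c : Pser R [:: a; b; c] =
  ([&& a == 0, b == 0 & c == 0]%N)%:R - ([&& a == 1, b == 1 & c == 0]%N)%:R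
  - ([&& a == 1, b == 0 & c == 1]%N)%:R - ([&& a == 0, b == 1 & c == 1]%N)%:R
  + ([&& a == 2, b == 1 & c == 1]%N)%:R + ([&& a == 1, b == 2 & c == 1]%N)%:R
  + ([&& a == 1, b == 1 & c == 2]%N)%:R - ([&& a == 2, b == 2 & c == 2]%N)%:R.
Proof.
have ifE (u : bool) : (if u then 1 else 0) = u%:R :> R by case: u.
rewrite Pser3 big_mkcond /=.
transitivity (\sum_(x : bool) \sum_(y : bool) \sum_(z : bool)
  if [&& x + y == a, x + z == b & y + z == c]%N then (-1) ^+ (x + y + z) else 0 : R).
  by rewrite pair_bigA pair_bigA; apply: eq_bigr => -[[]].
rewrite !big_bool /= ?addn0 ?add0n ?add1n !(eq_sym _ a) !(eq_sym _ b) !(eq_sym _ c).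
have mE (u : bool) k : (if u then (-1) ^+ k else 0) = (-1) ^+ k * u%:R :> R by case: u; rewrite ?mulr1 ?mulr0.
rewrite !mE; ring.
Qed.

Lemma hall_row F j : is_sym F -> (0 < j)%N -> hall_schur F [:: j] = F [:: j].
Proof.
case: j => // j sF _; rewrite -[RHS]/((T j.+1 F : sring R) [::]) -hall_nil; last exact: is_sym_T.
by rewrite hall_T // (perm_big _ (ups_nil j)) big_seq1.
Qed.

End ThreeVertices.

Section Hooks.
Variable R : realType.
Implicit Types (a b c i j : nat) (F G : sring R).

Lemma mul_row3 F G (x y z : nat) : (F * G) [:: x; y; z] =
  \sum_(i < x.+1) \sum_(j < y.+1) \sum_(k < z.+1)
     F [:: i : nat; j : nat; k : nat] * G [:: (x - i)%N; (y - j)%N; (z - k)%N].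
Proof.
rewrite -[LHS]/((T x (F * G) : sring R) [:: y; z]) T_mul ser_sum; apply: eq_bigr => i _.
rewrite -[LHS]/((T y ((T i F : sring R) * T (x - i) G) : sring R) [:: z]) T_mul ser_sum; apply: eq_bigr => j _.
by rewrite mul_row1.
Qed.

Let is_part_nil : is_part [::] = true. Proof. by []. Qed.

Lemma ups_row1 a : (0 < a)%N -> perm_eq (ups [:: a] 1) [:: [:: a.+1]; [:: a; 1%N]].
Proof.
move=> a0; apply: uniq_perm; rewrite ?uniq_ups //= ?inE ?andbT; first by apply/eqP => -[]; lia.
move=> lam; rewrite mem_ups !inE; apply/and3P/orP => [[pl /hsP hh /eqP sl]|[] /eqP ->].
- case: lam pl hh sl => [|x [|y [|z lam]]] // pl hh sl; rewrite /= in sl.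
  + by lia.
  + by left; apply/eqP; congr cons; lia.
  + have := hh 0%N; rewrite /= => h; right; apply/eqP; move: pl; rewrite !is_part_cons ?is_part_nil /= => pl.
    have -> : x = a by lia. have -> // : y = 1%N by lia.
  + by have := hh 1%N; rewrite /= => h; move: pl; rewrite !is_part_cons ?is_part_nil /=; lia.
- by split; [rewrite is_part_cons | apply/hsP => -[|[|i]]; rewrite /= ?nth_nil; lia | rewrite /= !addn0 addn1].
- split; [by rewrite !is_part_cons ?is_part_nil /= a0 | apply/hsP => -[|[|i]]; rewrite /= ?nth_nil; lia | by rewrite /= !addn0].
Qed.

Lemma ups_row2 a : (1 < a)%N -> perm_eq (ups [:: a] 2) [:: [:: a.+2]; [:: a.+1; 1%N]; [:: a; 2%N]].
Proof.
move=> a0; apply: uniq_perm; rewrite ?uniq_ups //= ?inE ?andbT.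
  by rewrite negb_or; apply/andP; split; [apply/andP; split|]; apply/eqP => -[]; lia.
move=> lam; rewrite mem_ups !inE; apply/and3P/or3P => [[pl /hsP hh /eqP sl]|[] /eqP ->].
- case: lam pl hh sl => [|x [|y [|z lam]]] // pl hh sl; rewrite /= in sl.
  + by lia.
  + by apply: Or31; apply/eqP; congr cons; lia.
  + have := hh 0%N; rewrite /= => h; move: pl; rewrite !is_part_cons ?is_part_nil /= => pl.
    have [hy|hy] : y = 1%N \/ y = 2 by lia.
      by apply: Or32; rewrite hy; have -> : x = a.+1 by lia.
    by apply: Or33; rewrite hy; have -> : x = a by lia.
  + by have := hh 1%N; rewrite /= => h; move: pl; rewrite !is_part_cons ?is_part_nil /=; lia.
- by split; [rewrite is_part_cons | apply/hsP => -[|[|i]]; rewrite /= ?nth_nil; lia | rewrite /= !addn0 addn2].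
- by split; [rewrite !is_part_cons ?is_part_nil /= ?ltnS ?leqnn ?andbT; lia | apply/hsP => -[|[|i]]; rewrite /= ?nth_nil; lia | rewrite /=; lia].
- by split; [rewrite !is_part_cons ?is_part_nil /= ?ltnS ?leqnn ?andbT; lia | apply/hsP => -[|[|i]]; rewrite /= ?nth_nil; lia | rewrite /=; lia].
Qed.

Lemma ups_hook a : (1 < a)%N -> perm_eq (ups [:: a; 1%N] 1) [:: [:: a.+1; 1%N]; [:: a; 2%N]; [:: a; 1%N; 1%N]].
Proof.
move=> a0; apply: uniq_perm; rewrite ?uniq_ups //= ?inE ?andbT.
  by rewrite negb_or; apply/andP; split; [apply/andP; split|]; apply/eqP => -[]; lia.
move=> lam; rewrite mem_ups !inE; apply/and3P/or3P => [[pl /hsP hh /eqP sl]|[] /eqP ->].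
- have := hh 0%N; have := hh 1%N; have := hh 2%N.
  case: lam pl hh sl => [|x [|y [|z [|w lam]]]] // pl _ sl; rewrite /= in sl; rewrite /= => h2 h1 h0;
    move: pl; rewrite !is_part_cons ?is_part_nil /= => pl; try lia.
  + have [hy|hy] : y = 1%N \/ y = 2 by lia.
      by apply: Or31; rewrite hy; have -> : x = a.+1 by lia.
    by apply: Or32; rewrite hy; have -> : x = a by lia.
  + have -> : x = a by lia. have -> : y = 1%N by lia. have -> : z = 1%N by lia. exact: Or33.
- by split; [rewrite !is_part_cons ?is_part_nil /= ?ltnS ?leqnn ?andbT; lia | apply/hsP => -[|[|[|i]]]; rewrite /= ?nth_nil; lia | rewrite /=; lia].
- by split; [rewrite !is_part_cons ?is_part_nil /= ?ltnS ?leqnn ?andbT; lia | apply/hsP => -[|[|[|i]]]; rewrite /= ?nth_nil; lia | rewrite /=; lia].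
- by split; [rewrite !is_part_cons ?is_part_nil /= ?ltnS ?leqnn ?andbT; lia | apply/hsP => -[|[|[|i]]]; rewrite /= ?nth_nil; lia | rewrite /=; lia].
Qed.

Variable p : nat -> R.
Hypotheses (p0 : p 0%N = 1) (p1 : p 1%N = 0).
Notation K := (kappa p).

Let sK : is_sym K. Proof. exact: is_sym_kappa. Qed.

(** The share of the exponents i, j of kappa_p in the coefficient of x_1^x x_2^y x_3^z in kappa_p P.
    Comparing with prod p(x_i), the coefficients of kappa_p with small first two exponents are
    solved for one after another. *)
Let S (x y z i j : nat) : R :=
  \sum_(k < z.+1) K [:: i; j; k : nat] * Pser R [:: (x - i)%N; (y - j)%N; (z - k)%N].

Let KP (x y z : nat) : p x * (p y * p z) = \sum_(i < x.+1) \sum_(j < y.+1) S x y z i j.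
Proof. by rewrite -mul_row3 kappaP /pprod !big_cons big_nil mulr1. Qed.

Let pick (g : nat -> R) (z i : nat) :
  \sum_(k < z.+1) g k * ((z - k)%N == i)%:R = if (i <= z)%N then g (z - i)%N else 0.
Proof.
case: leqP => h; last first.
  by rewrite big1 // => k _; case: eqP => [e|_]; rewrite ?mulr0 //; lia.
have h' : (z - i < z.+1)%N by lia.
rewrite (bigD1 (Ordinal h')) //= subKn // eqxx mulr1 big1 ?addr0 // => k hk.
case: eqP => [e|_]; rewrite ?mulr0 //; case/eqP: hk; apply: val_inj => /=.
by have := ltn_ord k; lia.
Qed.

Let P00 c : Pser R [:: 0%N; 0%N; c] = (c == 0%N)%:R.
Proof. by rewrite Pser3E /= ?andbF /=; ring. Qed.
Let P01 c : Pser R [:: 0%N; 1%N; c] = - (c == 1%N)%:R.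
Proof. by rewrite Pser3E /= ?andbF /=; ring. Qed.
Let P10 c : Pser R [:: 1%N; 0%N; c] = - (c == 1%N)%:R.
Proof. by rewrite Pser3E /= ?andbF /=; ring. Qed.
Let P02 c : Pser R [:: 0%N; 2; c] = 0.
Proof. by rewrite Pser3E /= ?andbF /=; ring. Qed.
Let P11 c : Pser R [:: 1%N; 1%N; c] = (c == 2)%:R - (c == 0%N)%:R.
Proof. by rewrite Pser3E /= ?andbF /=; ring. Qed.

Let pickN (g : nat -> R) (z i : nat) :
  \sum_(k < z.+1) g k * - ((z - k)%N == i)%:R = - if (i <= z)%N then g (z - i)%N else 0.
Proof. by rewrite -pick -sumrN; apply: eq_bigr => k _; rewrite mulrN. Qed.

Let S00 (i j x y z : nat) : x = i -> y = j -> S x y z i j = K [:: i; j; z].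
Proof.
move=> -> ->; rewrite /S; under eq_bigr do rewrite !subnn P00.
by rewrite (pick (fun k => K [:: i; j; k])) /= subn0.
Qed.

Let S01 (i j x y z : nat) : x = i -> y = j.+1 -> (0 < z)%N -> S x y z i j = - K [:: i; j; z.-1].
Proof.
move=> -> -> hz; rewrite /S; under eq_bigr do rewrite subnn subSnn P01.
by rewrite (pickN (fun k => K [:: i; j; k])) hz subn1.
Qed.

Let S10 (i j x y z : nat) : x = i.+1 -> y = j -> (0 < z)%N -> S x y z i j = - K [:: i; j; z.-1].
Proof.
move=> -> -> hz; rewrite /S; under eq_bigr do rewrite subnn subSnn P10.
by rewrite (pickN (fun k => K [:: i; j; k])) hz subn1.
Qed.

Let S02 (z : nat) : S 0 2 z 0 0 = 0.
Proof. by rewrite /S big1 // => k _; rewrite P02 mulr0. Qed.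

Let S11 (z : nat) : (1 < z)%N -> S 1 1 z 0 0 = K [:: 0%N; 0%N; z.-2] - K [:: 0%N; 0%N; z].
Proof.
move=> hz; rewrite /S; under eq_bigr do rewrite P11 mulrBr.
by rewrite sumrB !(pick (fun k => K [:: 0%N; 0%N; k])) hz /= subn0 subn2.
Qed.

Let K00 a : K [:: 0%N; 0%N; a] = p a.
Proof. by have := KP 0 0 a; rewrite !big_ord1 p0 !mul1r S00. Qed.

Let K01 a : (0 < a)%N -> K [:: 0%N; 1%N; a] = p a.-1.
Proof.
move=> a0; have := KP 0 1 a; rewrite !big_ord_recl !big_ord0 !addr0 p1 mul0r mulr0.
by rewrite S01 // S00 // K00 /bump /= => h; lra.
Qed.

Let K02 a : (1 < a)%N -> K [:: 0%N; 2; a] = p a.-2 + p 2 * p a.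
Proof.
move=> a0; have := KP 0 2 a; rewrite !big_ord_recl !big_ord0 !addr0 p0 mul1r S02.
rewrite S01 //; last by lia.
by rewrite S00 // /bump /= K01; [lra | lia].
Qed.

Let K10 a : K [:: 1%N; 0%N; a] = K [:: 0%N; 1%N; a].
Proof. by apply: sK => /=; case: ifP. Qed.

Let K11 a : (1 < a)%N -> K [:: 1%N; 1%N; a] = p a + p a.-2.
Proof.
move=> a1; have a0 : (0 < a)%N by lia.
have := KP 1 1 a; rewrite !big_ord_recl !big_ord0 !addr0 p1 !mul0r S11 // S10 // S01 // S00 //.
rewrite /bump /= K10 !K00 K01; [lra | lia].
Qed.

Let Kz (s : seq nat) : K (0%N :: s) = K s.
Proof. exact: sK. Qed.

Lemma kappa_row a : (0 < a)%N -> hall_schur K [:: a] = p a.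
Proof. by move=> a0; rewrite hall_row // -K00 !Kz. Qed.

Lemma hall_T_row F j a : is_sym F -> (0 < a)%N -> \sum_(lam <- ups [:: a] j) hall_schur F lam = F [:: j; a].
Proof.
move=> sF a0; rewrite -hall_T //; last by rewrite is_part_cons a0.
by rewrite hall_row //; apply: is_sym_T.
Qed.

(** Two evaluations of the coefficient of x y^a in kappa_p: p_{a-1} from kappa_p P = prod p(x_i)
    with p_1 = 0, and kappa_(a+1) + kappa_(a,1) from the Schur expansion. *)
Lemma kappa_hook1 a : (0 < a)%N -> hall_schur K [:: a; 1%N] = p a.-1 - p a.+1.
Proof.
move=> a0; have := hall_T_row 1 sK a0; rewrite (perm_big _ (ups_row1 a0)) !big_cons big_nil /= addr0.
by rewrite kappa_row // -Kz K01 // => <-; ring.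
Qed.

(** The coefficient of x^2 y^a determines kappa_(a,2); that of x y z^a then determines
    kappa_(a,1,1). *)
Lemma kappa_hook2 a : (1 < a)%N -> hall_schur K [:: a; 1%N; 1%N] = p a.+2 - p 2 * p a.
Proof.
move=> a1; have a0 : (0 < a)%N by lia.
have h2 := hall_T_row 2 sK a0; rewrite (perm_big _ (ups_row2 a1)) !big_cons big_nil /= addr0 in h2.
rewrite kappa_row // kappa_hook1 // -Kz K02 //= in h2.
have sT : is_sym (T 1 K) by apply: is_sym_T.
have h1 := hall_T_row 1 sT a0; rewrite (perm_big _ (ups_row1 a0)) !big_cons big_nil /= addr0 in h1.
have pa : is_part [:: a; 1%N] by rewrite !is_part_cons ?is_part_nil /=; lia.
rewrite hall_row // (@hall_T _ 1 K [:: a; 1%N]) // (perm_big _ (ups_hook a1)) !big_cons big_nil /= addr0 in h1.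
rewrite kappa_hook1 // -[T 1 K [:: 1%N; a]]/(K [:: 1%N; 1%N; a]) K11 // in h1.
rewrite -[T 1 K [:: a.+1]]/(K [:: 1%N; a.+1]) -Kz K01 //= in h1.
lra.
Qed.

End Hooks.

(** * Integral coefficients and part (b) *)

Section Integral.
Variable R : realType.

(** Nonnegativity of kappa_(a,1) and kappa_(a,1,1) reads p_{a+1} <= p_{a-1} and p_{a+2} >= p_2 p_a.
    So the integer p_2 is at most p_0 = 1, and p is constantly p_2 on the positive even indices. *)
Lemma integral_kappa (p : nat -> R) : p 0%N = 1 ->
  (forall lam, is_part lam -> 0 < sumn lam -> exists k : nat, hall_schur (kappa p) lam = k%:R)%N ->
  (forall lam, is_part lam -> odd (sumn lam) -> hall_schur (kappa p) lam = 0) ->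
  p = p_one R \/ p = p_inv_sq R.
Proof.
move=> p0 hN hodd.
have podd a : odd a -> p a = 0.
  move=> oa; have a0 : (0 < a)%N by case: a oa.
  by rewrite -kappa_row //; apply: hodd; rewrite ?is_part_cons ?a0 //= addn0.
have p1 : p 1%N = 0 by apply: podd.
have pN a : (0 < a)%N -> exists k : nat, p a = k%:R.
  by move=> a0; rewrite -kappa_row //; apply: hN; rewrite ?is_part_cons ?a0 //= addn0.
have p_ge0 a : 0 <= p a by case: a => [|a]; [rewrite p0 | have [k ->] := pN a.+1 isT].
have pdec a : (0 < a)%N -> p a.+1 <= p a.-1.
  move=> a0; rewrite -subr_ge0 -kappa_hook1 //.
  have pa : is_part [:: a; 1%N] by rewrite !is_part_cons /= a0.
  by have [k ->] := hN _ pa (ltn_addr _ a0).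
have pinc a : (1 < a)%N -> p 2 * p a <= p a.+2.
  move=> a1; rewrite -subr_ge0 -kappa_hook2 //.
  have pa : is_part [:: a; 1%N; 1%N] by rewrite !is_part_cons /= ltnW.
  by have [k ->] := hN _ pa (ltn_addr _ (ltnW a1)).
have evenE n : ~~ odd n -> n = (n./2).*2 by move=> h; rewrite -[LHS]odd_double_half (negbTE h).
have [k hk] := pN 2 isT; have k1 : (k <= 1)%N.
  by have := pdec 1%N isT; rewrite p0 hk -[1]/(1%:R) ler_nat.
case: k k1 hk => [|[|k]] // _ p2; [left|right]; apply: funext => n; rewrite /p_one /p_inv_sq.
  have [/[dup] on /podd ->|en] := boolP (odd n); first by case: n on.
  have ev j : p j.+1.*2 = 0.
    elim: j => [|j IH]; first exact: p2.
    by apply/eqP; rewrite eq_le p_ge0 andbT -IH; apply: (pdec j.+1.*2.+1).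
  by rewrite (evenE _ en); case: (n./2) => [|j]; rewrite ?ev ?p0.
have [on|en] := boolP (odd n); first by rewrite podd.
rewrite /= (evenE _ en); elim: (n./2) => [|[|j] IH]; [by rewrite p0|by rewrite [LHS]p2|].
have h1 : p j.+2.*2 <= p j.+1.*2 := pdec j.+1.*2.+1 isT.
have h2 : p 2 * p j.+1.*2 <= p j.+2.*2 := pinc j.+1.*2 isT.
by rewrite IH in h1; rewrite p2 IH in h2; apply/eqP; rewrite eq_le; apply/andP; split; lra.
Qed.

Variables (f : series R -> series R) (m : seq nat -> seq nat -> R).
Hypothesis fm : forall lam, is_part lam -> f (schur R lam) = sadd (sp R lam) (lower_sp m lam).

Lemma lower_sp_sum lam : is_part lam -> f (schur R lam) = sp_sum lam (mt m lam).
Proof. by move=> pl; rewrite fm // lower_spE. Qed.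

(** The empty partition lies strictly below every nonempty one, there being no partial sums to
    compare. *)
Lemma mt_nil lam : (0 < sumn lam)%N -> dom_lt [::] lam /\ mt m lam [::] = m lam [::].
Proof. by case: lam. Qed.

End Integral.

Theorem mainTheorem2 (R : realType) :
  (* (a), direct part *)
  (forall (f : series R -> series R) (m : seq nat -> seq nat -> R),
     lin_ring_hom f ->
     (forall lam, is_part lam -> f (schur R lam) = sadd (sp R lam) (lower_sp m lam)) ->
     (forall lam mu, is_part lam -> is_part mu -> dom_lt mu lam -> 0 <= m lam mu) ->
     exists p : nat -> R,
       [/\ p 0%N = 1, kappa_positive p &
           forall lam, is_part lam -> f (schur R lam) = fp_schur p lam])
  /\
  (* (a), converse *)
  (forall p : nat -> R, p 0%N = 1 -> kappa_positive p ->
     exists m : seq nat -> seq nat -> R,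
       (forall lam mu, is_part lam -> is_part mu -> dom_lt mu lam -> 0 <= m lam mu) /\
       (forall lam, is_part lam -> fp_schur p lam = sadd (sp R lam) (lower_sp m lam)))
  /\
  (* (b) *)
  (forall (f : series R -> series R) (m : seq nat -> seq nat -> R),
     lin_ring_hom f ->
     (forall lam, is_part lam -> f (schur R lam) = sadd (sp R lam) (lower_sp m lam)) ->
     (forall lam mu, is_part lam -> is_part mu -> dom_lt mu lam ->
        exists k : nat, m lam mu = k%:R) ->
     (forall lam mu, is_part lam -> is_part mu -> dom_lt mu lam ->
        odd (sumn lam + sumn mu) -> m lam mu = 0) ->
     exists p : nat -> R,
       (p = p_one R \/ p = p_inv_sq R) /\
       (forall lam, is_part lam -> f (schur R lam) = fp_schur p lam)).
Proof.
split; [|split].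
- move=> f m hf fm m0; have [p [p0 kp fp _]] := direct_part hf (lower_sp_sum fm) m0.
  by exists p.
- exact: fp_schur_lower.
- move=> f m hf fm mN modd.
  have m0 lam mu : is_part lam -> is_part mu -> dom_lt mu lam -> 0 <= m lam mu.
    by move=> pl pm h; have [k ->] := mN lam mu pl pm h.
  have [p [p0 _ fp kE]] := direct_part hf (lower_sp_sum fm) m0.
  exists p; split=> //; apply: integral_kappa => // lam pl hl; rewrite kE //.
    by have [hd ->] := mt_nil m hl; apply: mN.
  have [hd ->] : dom_lt [::] lam /\ mt m lam [::] = m lam [::] by apply: mt_nil; case: (sumn lam) hl.
  by apply: modd; rewrite ?addn0.
Qed.
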